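(* Let $J(g)$ and $\widetilde J(\widetilde g)$ be two self-adjoint semi-infinite Jacobi operators with discrete spectrum, with coefficients $(a_n),(b_n)$ and $(\widetilde a_n),(\widetilde b_n)$ respectively, where $g,\widetilde g\in\mathbb{R}\cup\{\infty\}$. Let $h_1\neq h_2$ and $\widetilde h_1\ne\widetilde h_2$ be real numbers. Write $\sigma(J_{h_1}(g))=\{\lambda_n\}_{n\in M}$, $\sigma(J_{h_2}(g))=\{\nu_n\}_{n\in M}$, $\sigma(\widetilde J_{\widetilde h_1}(\widetilde g))=\{\widetilde\lambda_n\}_{n\in M}$, $\sigma(\widetilde J_{\widetilde h_2}(\widetilde g))=\{\widetilde\nu_n\}_{n\in M}$, with the same index set $M\subset\mathbb{Z}$, each pair of spectra being enumerated according to the convention described in the context. Let $\{\gamma_n(h_1)\}_{n\in M}$ and $\{\widetilde\gamma_n(\widetilde h_1)\}_{n\in M}$ be the norming constants corresponding to $J_{h_1}(g)$ and $\widetilde J_{\widetilde h_1}(\widetilde g)$. Let $A\subset M$ and suppose that $$\lambda_n=\widetilde\lambda_n\ (n\in M),\qquad \nu_n=\widetilde\nu_n\ (n\in M\setminus A),\qquad \gamma_n(h_1)=\widetilde\gamma_n(\widetilde h_1)\ (n\in A),$$ that $\gamma_m(h_1)=\widetilde\gamma_m(\widetilde h_1)$ for some $m\in M\setminus A$, and that $h_1=\widetilde h_1$ (respectively $h_2=\widetilde h_2$). Then $a_n=\widetilde a_n$ and $b_n=\widetilde b_n$ for all $n\in\mathbb{N}$, $h_2=\widetilde h_2$ (respectively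 $h_1=\widetilde h_1$), and, if $J_{min}\neq J_{min}^*$ (limit circle case), also $g=\widetilde g$. In other words, $\{\lambda_n\}_{n\in M}$, $\{\nu_n\}_{n\in M\setminus A}$, $\{\gamma_n(h_1)\}_{n\in A}$, $h_1$ (respectively $h_2$) and $\gamma_m(h_1)$ for some $m\in M\setminus A$ uniquely determine the operator $J(g)$, $h_2$ (respectively $h_1$) and, in the limit circle case, the boundary condition $g$ at infinity.
   Context: Jacobi operators. Given $a_n\in\mathbb{R}$, $b_n>0$ ($n\in\mathbb{N}=\{1,2,\dots\}$), let $(\tau f)_1=a_1f_1+b_1f_2$ and $(\tau f)_n=b_{n-1}f_{n-1}+a_nf_n+b_nf_{n+1}$ for $n\ge 2$. In $l^2(\mathbb{N})$ let $J_{min}$ be $\tau$ on the finitely supported sequences and $J_{max}=J_{min}^*$ be $\tau$ on $\{f\in l^2(\mathbb{N}):\tau f\in l^2(\mathbb{N})\}$. The limit point case is when $\overline{J_{min}}$ is self-adjoint; otherwise one is in the limit circle case (written $J_{min}\ne J_{min}^*$). In the limit point case put $J(g):=\overline{J_{min}}$ for every $g\in\mathbb{R}\cup\{\infty\}$. In the limit circle case let $c_0,s_0$ be the sequences satisfying $b_{n-1}u_{n-1}+a_nu_n+b_nu_{n+1}=0$ for $n\ge2$ with $c_0(1)=1,c_0(2)=0$, $s_0(1)=0,s_0(2)=1$; for $g=\cot\alpha$, $\alpha\in[0,\pi)$ (with $g=\infty$ for $\alpha=0$), put $v_\alpha=\cos(\alpha)c_0+\sin(\alpha)s_0$ and let $J(g)$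 be the restriction of $J_{max}$ to $\{f\in\mathcal{D}(J_{max}):\lim_{n\to\infty}W_n(v_\alpha,f)=0\}$, where $W_n(f,k)=b_n(f(n)k(n+1)-k(n)f(n+1))$. These are all the self-adjoint extensions of $J_{min}$, and distinct $g$ give distinct extensions. For $h\in\mathbb{R}$, $J_h(g):=J(g)-h\langle\cdot,e_1\rangle e_1$, where $e_1$ is the first canonical basis vector; $h$ is called a boundary condition at the origin. ''Discrete spectrum'' means that the spectrum $\sigma(J(g))$ consists of isolated eigenvalues of finite multiplicity (then the same holds for every $J_h(g)$, and all eigenvalues are simple). The same notation with tildes is used for the operator with coefficients $\widetilde a_n,\widetilde b_n$. Norming constants. If $\lambda_k$ is an eigenvalue of $J_h(g)$ and $u$ is its eigenvector normalized by $u(1)=1$, then $\gamma_k(h)=\left(\sum_{n\in\mathbb{N}}|u(n)|^2\right)^{-1}$. Equivalently $-\gamma_k(h)$ is the residue at $\lambda_k$ of the Weyl $m$-function $m_h(z,g)=\langle e_1,(J_h(g)-z)^{-1}e_1\rangle$. Enumeration of two spectra. For $h_1\ne h_2$ the two spectra are disjoint, infinite and interlacing. Denote by $\{x_n\}_{n\in M}$ the spectrum for the larger of the two values $h_1,h_2$ and by $\{y_n\}_{n\in M}$ the spectrum for the smaller one (so if $h_1>h_2$ then $x_n=\lambda_n$, $y_n=\nu_n$, and if $h_1<h_2$ then $x_n=\nu_n$, $y_n=\lambda_n$). They are enumerated so that $x_n<y_n<x_{n+1}$ for $n\in M$ (whenever $n+1\in M$ for the last inequality), where: if $\inf x_n=-\infty$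 and $\sup x_n=\infty$, then $M=\mathbb{Z}$ and $y_{-1}<0<x_1$; if $0<\sup x_n<\infty$, then $M=\{n\in\mathbb{Z}:n\le n_{max}\}$ with $n_{max}\ge1$ and $y_{-1}<0<x_1$; if $\sup x_n\le0$, then $M=\{n\in\mathbb{Z}:n\le0\}$; if $\inf y_n\ge0$, then $M=\{n\in\mathbb{Z}:n\ge0\}$; if $-\infty<\inf y_n<0$, then $M=\{n\in\mathbb{Z}:n\ge n_{min}\}$ with $n_{min}\le-1$ and $y_{-1}<0<x_1$. The same convention applies to the tilde operator with $\widetilde h_1,\widetilde h_2$. *)

(* Defs.v *)
(* Sequences indexed by {1, 2, ...} are functions on nat shifted by one:
   [f n] is the term usually written f_{n+1}, so [f 0] is the first term. *)
From Stdlib Require Import Reals ZArith Lra.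
From Coquelicot Require Import Coquelicot.

Open Scope R_scope.

Definition cseq := nat -> C.

Definition l2 (f : cseq) : Prop := ex_series (fun n => (Cmod (f n)) ^ 2).

Definition norm2 (f : cseq) : R := Series (fun n => (Cmod (f n)) ^ 2).

Definition l2norm (f : cseq) : R := sqrt (norm2 f).

(* Linear in the first argument; meaningful for square-summable arguments. *)
Definition inner (f g : cseq) : C :=
  (Series (fun n => Re (f n * Cconj (g n))%C),
   Series (fun n => Im (f n * Cconj (g n))%C)).

Definition e1 : cseq := fun n => match n with O => RtoC 1 | S _ => RtoC 0 end.

(* An unbounded operator in l^2 is represented by its graph:
   [T f w] means that f is in the domain of T and T f = w. *)
Definition operator := cseq -> cseq -> Prop.

Definition adjoint (T : operator) : operator := fun f w =>
  l2 f /\ l2 w /\ forall u v, T u v -> inner v f = inner u w.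

Definition self_adjoint (T : operator) : Prop :=
  forall f w, T f w <-> adjoint T f w.

Definition closure (T : operator) : operator := fun f w =>
  l2 f /\ l2 w /\
  forall eps : R, 0 < eps ->
    exists f' w', T f' w' /\
      l2norm (fun n => f n - f' n)%C < eps /\
      l2norm (fun n => w n - w' n)%C < eps.

Definition resolvent_set (T : operator) (z : C) : Prop :=
  (forall y, l2 y ->
     exists x w, T x w /\ forall n, (w n - z * x n)%C = y n) /\
  (exists K : R, forall x w, T x w ->
     l2norm x <= K * l2norm (fun n => w n - z * x n)%C).

Definition spectrum (T : operator) (z : C) : Prop := ~ resolvent_set T z.

Definition eigenvector (T : operator) (z : C) (f : cseq) : Prop :=
  T f (fun n => z * f n)%C.

Definition eigenvalue (T : operator) (z : C) : Prop :=
  exists f, eigenvector T z f /\ exists n, f n <> RtoC 0.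

Definition finite_multiplicity (T : operator) (z : C) : Prop :=
  exists (N : nat) (e : nat -> cseq), forall f, eigenvector T z f ->
    exists c : nat -> C, forall n,
      f n = sum_n (fun k => c k * e k n)%C N.

Definition isolated_in (S : C -> Prop) (z : C) : Prop :=
  exists eps : R, 0 < eps /\
    forall z', S z' -> Cmod (z' - z)%C < eps -> z' = z.

Definition discrete_spectrum (T : operator) : Prop :=
  forall z, spectrum T z ->
    isolated_in (spectrum T) z /\ eigenvalue T z /\ finite_multiplicity T z.

Definition tau (a b : nat -> R) (f : cseq) : cseq := fun n =>
  match n with
  | O => (a O * f O + b O * f 1%nat)%C
  | S k => (b k * f k + a n * f n + b n * f (S n))%C
  end.

Definition finitely_supported (f : cseq) : Prop :=
  exists N : nat, forall n, (N <= n)%nat -> f n = RtoC 0.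

Definition Jmin (a b : nat -> R) : operator := fun f w =>
  finitely_supported f /\ forall n, w n = tau a b f n.

Definition Jmax (a b : nat -> R) : operator := fun f w =>
  l2 f /\ l2 w /\ forall n, w n = tau a b f n.

Definition limit_point (a b : nat -> R) : Prop :=
  self_adjoint (closure (Jmin a b)).

Definition limit_circle (a b : nat -> R) : Prop := ~ limit_point a b.

(* The solution with initial values u1, u2 of the difference equation in
   [zero_solution_rec]. *)
Fixpoint zero_solution (a b : nat -> R) (u1 u2 : R) (n : nat) : R :=
  match n with
  | O => u1
  | S m =>
      match m with
      | O => u2
      | S k =>
          - (b k * zero_solution a b u1 u2 k + a m * zero_solution a b u1 u2 m)
          / b m
      end
  end.

Lemma zero_solution_rec (a b : nat -> R) (u1 u2 : R) (n : nat) :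
  0 < b (S n) ->
  let u := zero_solution a b u1 u2 in
  b n * u n + a (S n) * u (S n) + b (S n) * u (S (S n)) = 0.
Proof.
intros Hb u; unfold u.
change (zero_solution a b u1 u2 (S (S n))) with
  (- (b n * zero_solution a b u1 u2 n
      + a (S n) * zero_solution a b u1 u2 (S n)) / b (S n)).
field; lra.
Qed.

Definition c0 (a b : nat -> R) : nat -> R := zero_solution a b 1 0.
Definition s0 (a b : nat -> R) : nat -> R := zero_solution a b 0 1.

Definition v_alpha (a b : nat -> R) (alpha : R) : cseq := fun n =>
  RtoC (cos alpha * c0 a b n + sin alpha * s0 a b n).

Definition W (b : nat -> R) (f k : cseq) (n : nat) : C :=
  (b n * (f n * k (S n) - k n * f (S n)))%C.

(* g = cot alpha with alpha in [0, pi); [None] stands for infinity. *)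
Definition is_cot (g : option R) (alpha : R) : Prop :=
  0 <= alpha < PI /\
  match g with
  | None => alpha = 0
  | Some t => alpha <> 0 /\ t = cos alpha / sin alpha
  end.

Definition J (a b : nat -> R) (g : option R) : operator := fun f w =>
  (limit_point a b /\ closure (Jmin a b) f w) \/
  (limit_circle a b /\ Jmax a b f w /\
   exists alpha, is_cot g alpha /\
     filterlim (W b (v_alpha a b alpha) f) eventually (locally (RtoC 0))).

Definition Jh (a b : nat -> R) (h : R) (g : option R) : operator := fun f w =>
  exists w', J a b g f w' /\
    forall n, w n = (w' n - h * inner f e1 * e1 n)%C.

Definition norming_constant (T : operator) (l gamma : R) : Prop :=
  exists u, eigenvector T (RtoC l) u /\ u O = RtoC 1 /\ gamma = / norm2 u.

Definition enumerates (M : Z -> Prop) (x : Z -> R) (S : C -> Prop) : Prop :=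
  forall z : C, S z <-> exists n, M n /\ z = RtoC (x n).

Definition sup_on (M : Z -> Prop) (x : Z -> R) : Rbar :=
  Lub_Rbar (fun r => exists n, M n /\ r = x n).

Definition inf_on (M : Z -> Prop) (x : Z -> R) : Rbar :=
  Glb_Rbar (fun r => exists n, M n /\ r = x n).

Definition interlaced (M : Z -> Prop) (x y : Z -> R) : Prop :=
  forall n, M n -> x n < y n /\ (M (n + 1)%Z -> y n < x (n + 1)%Z).

Definition around_zero (x y : Z -> R) : Prop := y (-1)%Z < 0 < x 1%Z.

(* For two infinite interlacing sets without finite accumulation points exactly
   one of the five alternatives on infima and suprema holds. *)
Definition indexed (M : Z -> Prop) (x y : Z -> R) : Prop :=
  interlaced M x y /\
  ((inf_on M x = m_infty /\ sup_on M x = p_infty /\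
    (forall n, M n) /\ around_zero x y)
   \/
   (Rbar_lt 0 (sup_on M x) /\ Rbar_lt (sup_on M x) p_infty /\
    (exists nmax : Z, (1 <= nmax)%Z /\ forall n, M n <-> (n <= nmax)%Z) /\
    around_zero x y)
   \/
   (Rbar_le (sup_on M x) 0 /\ forall n, M n <-> (n <= 0)%Z)
   \/
   (Rbar_le 0 (inf_on M y) /\ forall n, M n <-> (0 <= n)%Z)
   \/
   (Rbar_lt m_infty (inf_on M y) /\ Rbar_lt (inf_on M y) 0 /\
    (exists nmin : Z, (nmin <= -1)%Z /\ forall n, M n <-> (nmin <= n)%Z) /\
    around_zero x y)).

(* [lam] and [nu] enumerate the spectra for the boundary conditions h1 and h2;
   the larger of h1, h2 gives the lower sequence. *)
Definition two_spectra (a b : nat -> R) (g : option R) (h1 h2 : R)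
    (M : Z -> Prop) (lam nu : Z -> R) : Prop :=
  enumerates M lam (spectrum (Jh a b h1 g)) /\
  enumerates M nu (spectrum (Jh a b h2 g)) /\
  (h2 < h1 -> indexed M lam nu) /\
  (h1 < h2 -> indexed M nu lam).

Definition norming_constants (a b : nat -> R) (g : option R) (h : R)
    (M : Z -> Prop) (lam gam : Z -> R) : Prop :=
  forall n, M n -> norming_constant (Jh a b h g) (lam n) (gam n).

(* Main.v *)
Require Import Defs.
From Stdlib Require Import Reals ZArith Lra Lia.
From Stdlib Require Import FunctionalExtensionality Classical ClassicalEpsilon.
From Coquelicot Require Import Coquelicot.

(* Let [c = h1 - h2] and let [u_i] be the eigenvectors of [J_{h1}] normalized at
   the first entry, with eigenvalues [lam_i] and norming constants [gam_i].

   Completeness of the [u_i] needs no spectral theorem: on the orthogonal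
   complement of finitely many of them, the norm of the resolvent at [z0] is
   approached along approximate eigenvectors at a point [z0 + 1/s] or
   [z0 - 1/s], and [lam_i] is not approached from within the complement of
   [u_i] because it lies in the resolvent set of the rank-one perturbation
   [J_{h2}].  Hence [sum gam_i = 1], and the rank-one perturbation formula turns
   the eigenvalues [nu_k] of [J_{h2}] into the zeros of
     [F z = 1/c + sum_i gam_i / (lam_i - z)].

   Dividing [F] by [(z - nu_k) / (z - lam_k)] replaces the weights [gam_i] by
   [gam_i (lam_i - lam_k) / (lam_i - nu_k)], which are again nonnegative and
   whose sum has decreased by [(nu_k - lam_k) / c].  Removing in this way more
   and more of the pairs with [k] outside [A] leaves equal weights on [A] for
   the two operators, while the contribution of the pairs not yet removed tends
   to 0 because the total mass stays at most 1 and [|lam_k|] tends to infinity.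
   Evaluating at [lam_m] gives the equality of the two values of [c], and
   evaluating at the other [lam_k] that of the norming constants.

   Orthonormality of the polynomials [u_i(n)] in [lam_i] with respect to the
   weights [gam_i] then determines the coefficients recursively.  In the limit
   circle case, if the eigenvectors satisfied two boundary conditions at
   infinity, then by the Pluecker identity their Wronskians with every element
   of the maximal domain would vanish at infinity.  This fails for the solution
   at energy 0 with [J_{h1}], or with [J_{h2}] if 0 is one of the [lam_i]: it is
   square-summable but not in the domain of [J(g)]. *)

Open Scope R_scope.

(** * Square-summable real sequences *)

Lemma is_series_ext_R (x y : nat -> R) (l : R) :
  (forall n, x n = y n) -> is_series x l -> is_series y l.
Proof. exact (is_series_ext x y l). Qed.

Lemma ex_series_ext_R (x y : nat -> R) :
  (forall n, x n = y n) -> ex_series x -> ex_series y.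
Proof. exact (ex_series_ext x y). Qed.

Lemma sum_n_S (x : nat -> R) (n : nat) :
  @eq R (sum_n x (S n)) (sum_n x n + x (S n)).
Proof. exact (sum_Sn x n). Qed.

Lemma is_series_lin (x y : nat -> R) (s t l k : R) :
  is_series x l -> is_series y k ->
  is_series (fun n => s * x n + t * y n) (s * l + t * k).
Proof.
  intros Hx Hy.
  apply (is_series_plus (fun n => s * x n) (fun n => t * y n)).
  - apply (is_series_scal s x l Hx).
  - apply (is_series_scal t y k Hy).
Qed.

Lemma ex_series_lin (x y : nat -> R) (s t : R) :
  ex_series x -> ex_series y -> ex_series (fun n => s * x n + t * y n).
Proof.
  intros [l Hl] [k Hk]; exists (s * l + t * k); now apply is_series_lin.
Qed.

Lemma Series_lin (x y : nat -> R) (s t : R) :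
  ex_series x -> ex_series y ->
  Series (fun n => s * x n + t * y n) = s * Series x + t * Series y.
Proof.
  intros Hx Hy; apply is_series_unique, is_series_lin; now apply Series_correct.
Qed.

Lemma ex_series_dom (x y : nat -> R) :
  (forall n, Rabs (x n) <= y n) -> ex_series y -> ex_series x.
Proof. intros H Hy; exact (ex_series_le x y H Hy). Qed.

Lemma is_series_finite (x : nat -> R) (N : nat) :
  (forall n, (N < n)%nat -> x n = 0) -> is_series x (sum_n x N).
Proof.
  intros H.
  change (is_lim_seq (sum_n x) (sum_n x N)).
  apply (is_lim_seq_ext_loc (fun _ => sum_n x N)); [|apply is_lim_seq_const].
  exists N; intros n Hn; induction Hn as [|n Hn IH]; [reflexivity|].
  rewrite sum_Sn, <- IH, H by lia. symmetry; apply Rplus_0_r.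
Qed.

Lemma Series_nonneg (x : nat -> R) :
  (forall n, 0 <= x n) -> ex_series x -> 0 <= Series x.
Proof.
  intros H Hx.
  replace 0 with (Series (fun n => 0 * x n)).
  - apply Series_le; [|exact Hx]. intros n; specialize (H n); nra.
  - rewrite Series_scal_l; ring.
Qed.

Lemma Series_ge_term (x : nat -> R) (n : nat) :
  (forall n, 0 <= x n) -> ex_series x -> x n <= Series x.
Proof.
  intros H Hx.
  assert (Hd : is_series (fun k => if Nat.eqb k n then x k else 0) (x n)).
  { replace (x n) with (sum_n (fun k => if Nat.eqb k n then x k else 0) n).
    - apply is_series_finite. intros k Hk.
      destruct (Nat.eqb_spec k n); [lia|reflexivity].
    - destruct n as [|n].
      + now rewrite sum_O.
      + rewrite sum_Sn, Nat.eqb_refl.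
        rewrite (sum_n_ext_loc _ (fun _ => 0)).
        * rewrite sum_n_const, Rmult_0_r. apply Rplus_0_l.
        * intros k Hk. destruct (Nat.eqb_spec k (S n)); [lia|reflexivity]. }
  rewrite <- (is_series_unique _ _ Hd).
  apply Series_le; [|exact Hx].
  intros k; specialize (H k); destruct (Nat.eqb k n); lra.
Qed.

Definition sqs (f : nat -> R) : Prop := ex_series (fun n => f n * f n).

Definition dot (f g : nat -> R) : R := Series (fun n => f n * g n).

Definition nrm (f : nat -> R) : R := sqrt (dot f f).

(** All vector operations go through this one combination; a difference is [lc 1 f (-1) g]. *)
Definition lc (s : R) (f : nat -> R) (t : R) (g : nat -> R) : nat -> R :=
  fun n => s * f n + t * g n.

Definition finsupp (f : nat -> R) : Prop :=
  exists N, forall n, (N <= n)%nat -> f n = 0.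

Lemma ex_dot (f g : nat -> R) :
  sqs f -> sqs g -> ex_series (fun n => f n * g n).
Proof.
  intros Hf Hg.
  apply ex_series_dom with (fun n => 1 * (f n * f n) + 1 * (g n * g n)).
  - intros n; apply Rabs_le; nra.
  - now apply ex_series_lin.
Qed.

Lemma sqs_lc (f g : nat -> R) (s t : R) :
  sqs f -> sqs g -> sqs (lc s f t g).
Proof.
  intros Hf Hg.
  apply ex_series_ext_R with
    (fun n => 1 * ((s * s) * (f n * f n) + (2 * s * t) * (f n * g n))
              + (t * t) * (g n * g n)).
  - intros n; unfold lc; ring.
  - apply ex_series_lin; [apply ex_series_lin|]; auto using ex_dot.
Qed.

Lemma dot_comm (f g : nat -> R) : dot f g = dot g f.
Proof. apply Series_ext; intros n; ring. Qed.

Lemma dot_lc_l (f g k : nat -> R) (s t : R) :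
  sqs f -> sqs g -> sqs k ->
  dot (lc s f t g) k = s * dot f k + t * dot g k.
Proof.
  intros Hf Hg Hk; unfold dot.
  rewrite <- Series_lin by now apply ex_dot.
  apply Series_ext; intros n; unfold lc; ring.
Qed.

Lemma dot_lc_r (f g k : nat -> R) (s t : R) :
  sqs f -> sqs g -> sqs k ->
  dot k (lc s f t g) = s * dot k f + t * dot k g.
Proof.
  intros; rewrite dot_comm, dot_lc_l, (dot_comm f), (dot_comm g); auto.
Qed.

Lemma dot_ge0 (f : nat -> R) : sqs f -> 0 <= dot f f.
Proof. intros Hf; apply Series_nonneg; [intros n; nra|exact Hf]. Qed.

Lemma nrm_sq (f : nat -> R) : sqs f -> nrm f * nrm f = dot f f.
Proof. intros Hf; apply sqrt_sqrt, dot_ge0, Hf. Qed.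

Lemma nrm_ge0 (f : nat -> R) : 0 <= nrm f.
Proof. apply sqrt_pos. Qed.

Lemma dot_ge_coord (f : nat -> R) (n : nat) : sqs f -> f n * f n <= dot f f.
Proof.
  intros Hf; apply (Series_ge_term (fun k => f k * f k)); [intros k; nra|exact Hf].
Qed.

Lemma le_of_sq (x y : R) : 0 <= y -> x * x <= y * y -> x <= y.
Proof. intros; nra. Qed.

Lemma nrm_ge_coord (f : nat -> R) (n : nat) : sqs f -> Rabs (f n) <= nrm f.
Proof.
  intros Hf; apply le_of_sq; [apply nrm_ge0|].
  rewrite nrm_sq by assumption.
  replace (Rabs (f n) * Rabs (f n)) with (f n * f n).
  - now apply dot_ge_coord.
  - rewrite <- Rabs_mult; symmetry; apply Rabs_pos_eq; nra.
Qed.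

Lemma cauchy_schwarz_sq (f g : nat -> R) :
  sqs f -> sqs g -> dot f g * dot f g <= dot f f * dot g g.
Proof.
  intros Hf Hg.
  assert (H : forall t, 0 <= dot f f + 2 * t * dot f g + t * t * dot g g).
  { intros t.
    assert (H := dot_ge0 _ (sqs_lc f g 1 t Hf Hg)).
    rewrite dot_lc_l, !dot_lc_r, (dot_comm g f) in H; auto using sqs_lc. nra. }
  destruct (Req_dec (dot g g) 0) as [H0|H0].
  - assert (Hz : dot f g = 0).
    { destruct (Req_dec (dot f g) 0) as [Hz|Hz]; [exact Hz|exfalso].
      (* With [dot g g = 0] the quadratic is affine in [t], and this [t] gives it the value -1. *)
      specialize (H (- (dot f f + 1) / (2 * dot f g))); rewrite H0 in H.
      replace (dot f f + 2 * (- (dot f f + 1) / (2 * dot f g)) * dot f g + _)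
        with (-1) in H by (field; exact Hz); lra. }
    rewrite Hz, H0; lra.
  - assert (Hp : 0 < dot g g) by (pose proof (dot_ge0 _ Hg); lra).
    (* The minimizer of the quadratic in [t]. *)
    specialize (H (- dot f g / dot g g)).
    replace (dot f f + 2 * (- dot f g / dot g g) * dot f g
             + - dot f g / dot g g * (- dot f g / dot g g) * dot g g)
      with ((dot f f * dot g g - dot f g * dot f g) / dot g g) in H by (field; lra).
    apply Rmult_le_compat_r with (r := dot g g) in H; [|lra].
    unfold Rdiv in H; rewrite Rmult_assoc, Rinv_l, Rmult_0_l, Rmult_1_r in H; lra.
Qed.

Lemma cauchy_schwarz (f g : nat -> R) :
  sqs f -> sqs g -> Rabs (dot f g) <= nrm f * nrm g.
Proof.
  intros Hf Hg; apply le_of_sq.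
  - apply Rmult_le_pos; apply nrm_ge0.
  - replace (Rabs (dot f g) * Rabs (dot f g)) with (dot f g * dot f g).
    + replace (nrm f * nrm g * (nrm f * nrm g))
        with ((nrm f * nrm f) * (nrm g * nrm g)) by ring.
      rewrite !nrm_sq by assumption. now apply cauchy_schwarz_sq.
    + rewrite <- Rabs_mult; symmetry; apply Rabs_pos_eq; nra.
Qed.

Lemma Rabs_m1 : Rabs (-1) = 1.
Proof. rewrite Rabs_left; lra. Qed.

Lemma nrm_lc_le (f g : nat -> R) (s t : R) :
  sqs f -> sqs g -> nrm (lc s f t g) <= Rabs s * nrm f + Rabs t * nrm g.
Proof.
  intros Hf Hg.
  pose proof (nrm_ge0 f); pose proof (nrm_ge0 g).
  pose proof (Rabs_pos s); pose proof (Rabs_pos t).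
  apply le_of_sq; [nra|].
  rewrite nrm_sq, dot_lc_l, !dot_lc_r, (dot_comm g f) by auto using sqs_lc.
  rewrite <- !nrm_sq by assumption.
  pose proof (cauchy_schwarz f g Hf Hg) as Hc.
  assert (Hst : s * t * dot f g <= Rabs s * Rabs t * (nrm f * nrm g)).
  { apply Rle_trans with (Rabs (s * t * dot f g)); [apply Rle_abs|].
    rewrite !Rabs_mult. apply Rmult_le_compat_l; [nra|exact Hc]. }
  assert (Hs : Rabs s * Rabs s = s * s)
    by (rewrite <- Rabs_mult; apply Rabs_pos_eq; nra).
  assert (Ht : Rabs t * Rabs t = t * t)
    by (rewrite <- Rabs_mult; apply Rabs_pos_eq; nra).
  nra.
Qed.

Lemma nrm_scal (f : nat -> R) (s : R) :
  nrm (fun n => s * f n) = Rabs s * nrm f.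
Proof.
  unfold nrm, dot.
  rewrite (Series_ext _ (fun n => (s * s) * (f n * f n))) by (intros; ring).
  rewrite Series_scal_l, sqrt_mult_alt by nra.
  f_equal. apply sqrt_Rsqr_abs.
Qed.

Lemma nrm_eq_0 (f : nat -> R) : sqs f -> nrm f <= 0 -> forall n, f n = 0.
Proof.
  intros Hf H n. pose proof (nrm_ge_coord f n Hf) as Hn.
  pose proof (Rabs_pos (f n)).
  destruct (Req_dec (f n) 0) as [E|E]; [exact E|].
  apply Rabs_pos_lt in E; lra.
Qed.

Lemma sqs_finsupp (f : nat -> R) : finsupp f -> sqs f.
Proof.
  intros [N HN]; eexists; apply (is_series_finite _ N).
  intros n Hn; rewrite HN by lia; ring.
Qed.

Lemma finsupp_lc (f g : nat -> R) (s t : R) :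
  finsupp f -> finsupp g -> finsupp (lc s f t g).
Proof.
  intros [N HN] [N' HN']; exists (max N N'); intros n Hn; unfold lc.
  rewrite HN, HN' by lia; ring.
Qed.

Definition trunc (N : nat) (f : nat -> R) : nat -> R :=
  fun n => if Nat.ltb n N then f n else 0.

Lemma finsupp_trunc (N : nat) (f : nat -> R) : finsupp (trunc N f).
Proof.
  exists N; intros n Hn; unfold trunc; destruct (Nat.ltb_spec n N); [lia|easy].
Qed.

Lemma nrm_trunc (f : nat -> R) (eps : R) :
  sqs f -> 0 < eps -> exists N, nrm (lc 1 f (-1) (trunc N f)) < eps.
Proof.
  intros Hf He.
  destruct Hf as [l Hl].
  assert (Hlim : is_lim_seq (sum_n (fun n => f n * f n)) l) by exact Hl.
  apply is_lim_seq_spec in Hlim.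
  assert (Hee : 0 < eps * eps) by nra.
  destruct (Hlim (mkposreal _ Hee)) as [N HN]; simpl in HN.
  exists (S N).
  specialize (HN N (le_n _)).
  assert (Hd : is_series (fun n => lc 1 f (-1) (trunc (S N) f) n
                            * lc 1 f (-1) (trunc (S N) f) n)
                 (1 * l + (-1) * sum_n (fun n => trunc (S N) f n * trunc (S N) f n) N)).
  { apply is_series_ext_R with
      (fun n => 1 * (f n * f n) + (-1) * (trunc (S N) f n * trunc (S N) f n)).
    - intros n; unfold lc, trunc; destruct (Nat.ltb n (S N)); ring.
    - apply is_series_lin; [exact Hl|].
      apply is_series_finite; intros n Hn; unfold trunc.
      destruct (Nat.ltb_spec n (S N)); [lia|ring]. }
  rewrite (sum_n_ext_loc _ (fun n => f n * f n)) in Hd.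
  2:{ intros n Hn; unfold trunc; destruct (Nat.ltb_spec n (S N)); [easy|lia]. }
  unfold nrm, dot; rewrite (is_series_unique _ _ Hd).
  rewrite <- (sqrt_square eps) by lra.
  apply sqrt_lt_1_alt. split.
  - rewrite <- (is_series_unique _ _ Hd).
    apply Series_nonneg; [intros; nra|eexists; exact Hd].
  - apply Rabs_def2 in HN; lra.
Qed.

Lemma dot_diff (f g u v : nat -> R) :
  sqs f -> sqs g -> sqs u -> sqs v ->
  Rabs (dot f g - dot u v)
  <= nrm (lc 1 f (-1) u) * nrm g + nrm u * nrm (lc 1 g (-1) v).
Proof.
  intros Hf Hg Hu Hv.
  replace (dot f g - dot u v)
    with (dot (lc 1 f (-1) u) g + dot u (lc 1 g (-1) v))
    by (rewrite dot_lc_l, dot_lc_r by assumption; ring).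
  eapply Rle_trans; [apply Rabs_triang|].
  apply Rplus_le_compat; apply cauchy_schwarz; auto using sqs_lc.
Qed.

(** * Symmetry *)

Definition rtau (a b : nat -> R) (f : nat -> R) : nat -> R := fun n =>
  match n with
  | O => a O * f O + b O * f 1%nat
  | S k => b k * f k + a n * f n + b n * f (S n)
  end.

Definition shifted (a b : nat -> R) (z : R) (f : nat -> R) : nat -> R :=
  fun n => rtau a b f n - z * f n.

(** The orthogonal polynomials of the first kind, that is, the solution of the eigenvalue equation
    at [z] with first entry 1. *)
Fixpoint pol (a b : nat -> R) (z : R) (n : nat) : R :=
  match n with
  | O => 1
  | S m =>
      match m with
      | O => (z - a O) / b O
      | S k => ((z - a m) * pol a b z m - b k * pol a b z k) / b m
      end
  end.

(** What is kept of the domain of a self-adjoint realization: a linear space between the finitely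
    supported sequences and the maximal domain. Symmetry is not part of it; it is derived from the
    existence of a real regular point. *)
Definition jacobi_domain (a b : nat -> R) (D : (nat -> R) -> Prop) : Prop :=
  (forall f, D f -> sqs f /\ sqs (rtau a b f)) /\
  (forall f g s t, D f -> D g -> D (lc s f t g)) /\
  (forall f, finsupp f -> D f).

(** The resolvent set at a real point, tested on real sequences; [resolvent_iff] justifies this
    restriction. *)
Definition regular (a b : nat -> R) (D : (nat -> R) -> Prop) (z : R) : Prop :=
  (forall y, sqs y -> exists f, D f /\ forall n, shifted a b z f n = y n) /\
  (exists K, forall f, D f -> nrm f <= K * nrm (shifted a b z f)).

Lemma rtau_lc (a b f g : nat -> R) (s t : R) :
  rtau a b (lc s f t g) = lc s (rtau a b f) t (rtau a b g).
Proof.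
  apply functional_extensionality; intros [|n]; unfold rtau, lc; ring.
Qed.

Lemma shifted_lc (a b f g : nat -> R) (z s t : R) :
  shifted a b z (lc s f t g) = lc s (shifted a b z f) t (shifted a b z g).
Proof.
  apply functional_extensionality; intros n; unfold shifted.
  rewrite rtau_lc; unfold lc; ring.
Qed.

Lemma finsupp_rtau (a b f : nat -> R) : finsupp f -> finsupp (rtau a b f).
Proof.
  intros [N HN]; exists (S N); intros [|n] Hn; [lia|].
  simpl; rewrite !HN by lia; ring.
Qed.

Lemma shifted_lc_eq (a b f : nat -> R) (z : R) :
  shifted a b z f = lc 1 (rtau a b f) (- z) f.
Proof.
  apply functional_extensionality; intros n; unfold shifted, lc; ring.
Qed.

Lemma shifted_shift (a b f : nat -> R) (z z' : R) :
  shifted a b z' f = lc 1 (shifted a b z f) (z - z') f.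
Proof.
  apply functional_extensionality; intros n; unfold shifted, lc; ring.
Qed.

Lemma sqs_shifted (a b : nat -> R) D (f : nat -> R) (z : R) :
  jacobi_domain a b D -> D f -> sqs (shifted a b z f).
Proof.
  intros [HD _] Hf. rewrite shifted_lc_eq.
  destruct (HD f Hf); now apply sqs_lc.
Qed.

Lemma pol_solution (a b : nat -> R) (z : R) (n : nat) :
  (forall n, 0 < b n) -> shifted a b z (pol a b z) n = 0.
Proof.
  intros Hb; destruct n as [|n]; unfold shifted, rtau.
  - simpl; field. specialize (Hb O); lra.
  - change (pol a b z (S (S n))) with
      (((z - a (S n)) * pol a b z (S n) - b n * pol a b z n) / b (S n)).
    field. specialize (Hb (S n)); lra.
Qed.

Lemma tail_solution_unique (a b f g : nat -> R) (z : R) (N : nat) :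
  (forall n, 0 < b n) ->
  (forall n, (N < n)%nat -> shifted a b z f n = shifted a b z g n) ->
  f N = g N -> f (S N) = g (S N) ->
  forall n, (N <= n)%nat -> f n = g n.
Proof.
  intros Hb H H0 H1.
  assert (HH : forall n, (N <= n)%nat -> f n = g n /\ f (S n) = g (S n)).
  { intros n Hn; induction Hn as [|n Hn [IH1 IH2]]; [easy|].
    split; [exact IH2|].
    specialize (H (S n) ltac:(lia)); unfold shifted, rtau in H.
    rewrite IH1, IH2 in H. specialize (Hb (S n)).
    apply Rmult_eq_reg_l with (b (S n)); lra. }
  intros n Hn; now apply HH.
Qed.

Lemma solution_unique (a b f g : nat -> R) (z : R) :
  (forall n, 0 < b n) ->
  (forall n, shifted a b z f n = shifted a b z g n) ->
  f O = g O -> forall n, f n = g n.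
Proof.
  intros Hb H H0 n.
  apply (tail_solution_unique a b f g z 0); auto; [|lia].
  specialize (H O); unfold shifted, rtau in H.
  rewrite H0 in H. specialize (Hb O).
  apply Rmult_eq_reg_l with (b O); lra.
Qed.

Lemma solution_is_pol (a b f : nat -> R) (z : R) :
  (forall n, 0 < b n) -> (forall n, shifted a b z f n = 0) ->
  forall n, f n = f O * pol a b z n.
Proof.
  intros Hb H.
  apply (solution_unique a b f (fun n => f O * pol a b z n) z Hb).
  - intros n; rewrite H.
    replace (fun n => f O * pol a b z n) with (lc (f O) (pol a b z) 0 (pol a b z))
      by (apply functional_extensionality; intros; unfold lc; ring).
    rewrite shifted_lc; unfold lc; rewrite pol_solution by assumption; ring.
  - simpl; ring.
Qed.

(** Discrete Green's formula: the sum telescopes, and the first row, having no left neighbour,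
    contributes no boundary term at the origin. *)
Lemma green (a b f g : nat -> R) (z : R) (n : nat) :
  @eq R (sum_n (fun k => shifted a b z f k * g k - f k * shifted a b z g k) n)
    (b n * (f (S n) * g n - f n * g (S n))).
Proof.
  induction n as [|n IH].
  - rewrite sum_O; unfold shifted, rtau; ring.
  - rewrite sum_n_S, IH; unfold shifted, rtau; ring.
Qed.

Lemma Series_zero_tail (x : nat -> R) (N : nat) :
  (forall n, (N <= n)%nat -> @eq R (sum_n x n) 0) -> is_series x 0.
Proof.
  intros H.
  change (is_lim_seq (sum_n x) 0).
  apply (is_lim_seq_ext_loc (fun _ => 0)); [|apply is_lim_seq_const].
  exists N; intros n Hn; now rewrite H.
Qed.

(** The lower bound at a regular point would force this null solution to vanish, while its first
    entry is 1. *)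
Lemma kernel_trivial (a b : nat -> R) D (z : R) :
  (forall n, 0 < b n) -> jacobi_domain a b D -> regular a b D z ->
  ~ D (pol a b z).
Proof.
  intros Hb HD [_ [K HK]] Hp.
  specialize (HK _ Hp).
  replace (shifted a b z (pol a b z)) with (fun n : nat => 0 * 0) in HK.
  2:{ apply functional_extensionality; intros; rewrite pol_solution; auto; ring. }
  rewrite (nrm_scal (fun _ => 0)), Rabs_R0, Rmult_0_l, Rmult_0_r in HK.
  apply (nrm_eq_0 _ (proj1 (proj1 HD _ Hp))) with (n := O) in HK.
  simpl in HK; lra.
Qed.

(* If the Wronskian at infinity of two such solutions did not vanish, then the
   kernel element [pol a b z] would coincide eventually with one of their
   combinations and hence lie in [D]. *)
Lemma wronskian_vanishes (a b : nat -> R) D (z : R) (f g : nat -> R) (N : nat) :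
  (forall n, 0 < b n) -> jacobi_domain a b D -> regular a b D z ->
  D f -> D g ->
  (forall n, (N < n)%nat -> shifted a b z f n = 0) ->
  (forall n, (N < n)%nat -> shifted a b z g n = 0) ->
  f (S N) * g N - f N * g (S N) = 0.
Proof.
  intros Hb HD HR Hf Hg HfN HgN.
  destruct (Req_dec (f (S N) * g N - f N * g (S N)) 0) as [E|E]; [exact E|].
  exfalso; apply (kernel_trivial a b D z Hb HD HR).
  set (p := pol a b z).
  set (w := f (S N) * g N - f N * g (S N)) in *.
  set (s := (p (S N) * g N - p N * g (S N)) / w).
  set (t := (f (S N) * p N - f N * p (S N)) / w).
  assert (Hpq : forall n, (N <= n)%nat -> p n = lc s f t g n).
  { apply tail_solution_unique with a b z; auto.
    - intros n Hn. rewrite shifted_lc; unfold lc.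
      rewrite HfN, HgN by assumption. unfold p; rewrite pol_solution by assumption.
      ring.
    - unfold lc, s, t; unfold w in *; field; exact E.
    - unfold lc, s, t; unfold w in *; field; exact E. }
  destruct HD as (HD1 & HD2 & HD3).
  replace p with (lc 1 (lc s f t g) 1 (lc 1 p (-1) (lc s f t g))).
  - apply HD2; [now apply HD2|].
    apply HD3; exists N; intros n Hn; specialize (Hpq n Hn).
    unfold lc at 1; rewrite <- Hpq; ring.
  - apply functional_extensionality; intros n; unfold lc; ring.
Qed.

(** Past both supports the partial sums in Green's formula are multiples of Wronskians of solutions
    from [D], which vanish. *)
Lemma symmetric_finsupp (a b : nat -> R) D (z : R) (f g : nat -> R) :
  (forall n, 0 < b n) -> jacobi_domain a b D -> regular a b D z ->
  D f -> D g ->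
  finsupp (shifted a b z f) -> finsupp (shifted a b z g) ->
  dot (shifted a b z f) g = dot f (shifted a b z g).
Proof.
  intros Hb HD HR Hf Hg [N HN] [N' HN'].
  assert (Hs : is_series
    (fun k => shifted a b z f k * g k - f k * shifted a b z g k) 0).
  { apply Series_zero_tail with (max N N'); intros n Hn; rewrite green.
    rewrite (wronskian_vanishes a b D z f g n); auto; [ring|intros..];
      [apply HN|apply HN']; lia. }
  pose proof (proj1 (proj1 HD _ Hf)). pose proof (proj1 (proj1 HD _ Hg)).
  apply is_series_unique in Hs.
  rewrite (Series_ext _ (fun k => 1 * (shifted a b z f k * g k)
             + (-1) * (f k * shifted a b z g k))) in Hs by (intros; ring).
  rewrite Series_lin in Hs by (apply ex_dot; eauto using sqs_shifted).
  unfold dot; lra.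
Qed.

(** This passes to the limit in estimates proved for each small [eps]; the cutoff [e] lets such an
    estimate assume that [eps] is small. *)
Lemma Rle_of_eps (x K e : R) :
  0 < e -> (forall eps, 0 < eps < e -> x <= K * eps) -> x <= 0.
Proof.
  intros He H; destruct (Rle_lt_dec x 0) as [L|L]; [exact L|exfalso].
  set (K' := Rmax K 1).
  assert (HK : K <= K') by apply Rmax_l.
  assert (HK1 : 1 <= K') by apply Rmax_r.
  assert (H0 : 0 < x / (2 * K')) by (apply Rdiv_lt_0_compat; lra).
  set (d := Rmin (x / (2 * K')) (e / 2)).
  assert (Hd1 : d <= x / (2 * K')) by apply Rmin_l.
  assert (Hd2 : d <= e / 2) by apply Rmin_r.
  assert (Hd : 0 < d) by (apply Rmin_glb_lt; lra).
  specialize (H d ltac:(lra)).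
  assert (K * d <= K' * d) by (apply Rmult_le_compat_r; lra).
  assert (K' * d <= K' * (x / (2 * K'))) by (apply Rmult_le_compat_l; lra).
  replace (K' * (x / (2 * K'))) with (x / 2) in * by (field; lra).
  lra.
Qed.

(** The image of [f] is truncated and the equation solved again; the resolvent bound turns the error
    of the image into an error of the preimage. *)
Lemma resolvent_approx (a b : nat -> R) D (z : R) (f : nat -> R) (eps : R) :
  jacobi_domain a b D -> regular a b D z -> D f -> 0 < eps ->
  exists f', D f' /\ finsupp (shifted a b z f') /\
    nrm (lc 1 f (-1) f') < eps /\
    nrm (lc 1 (shifted a b z f) (-1) (shifted a b z f')) < eps.
Proof.
  intros HD [HR [K HK]] Hf He.
  pose proof (sqs_shifted a b D f z HD Hf) as HF.
  set (K' := Rmax K 1).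
  assert (HKK : K <= K') by apply Rmax_l.
  assert (HK1 : 1 <= K') by apply Rmax_r.
  assert (He' : 0 < eps / K') by (apply Rdiv_lt_0_compat; lra).
  destruct (nrm_trunc _ _ HF He') as [N HN].
  destruct (HR (trunc N (shifted a b z f))) as (f' & Hf' & Hf'N).
  { apply sqs_finsupp, finsupp_trunc. }
  apply functional_extensionality in Hf'N.
  exists f'; rewrite Hf'N; split; [exact Hf'|split; [apply finsupp_trunc|]].
  assert (Hlt : nrm (lc 1 (shifted a b z f) (-1) (trunc N (shifted a b z f))) < eps).
  { apply Rlt_le_trans with (1 := HN).
    apply Rmult_le_reg_r with K'; [lra|].
    unfold Rdiv; rewrite Rmult_assoc, Rinv_l by lra. nra. }
  split; [|exact Hlt].
  specialize (HK (lc 1 f (-1) f')).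
  rewrite shifted_lc, Hf'N in HK.
  apply Rle_lt_trans with (1 := HK (proj1 (proj2 HD) _ _ _ _ Hf Hf')).
  pose proof (nrm_ge0 (lc 1 (shifted a b z f) (-1) (trunc N (shifted a b z f)))).
  apply Rle_lt_trans with
    (K' * nrm (lc 1 (shifted a b z f) (-1) (trunc N (shifted a b z f)))); [nra|].
  replace eps with (K' * (eps / K')) by (field; lra).
  apply Rmult_lt_compat_l; [lra|exact HN].
Qed.

Lemma nrm_near (f g : nat -> R) (eps : R) :
  sqs f -> sqs g -> nrm (lc 1 f (-1) g) < eps -> nrm g <= nrm f + eps.
Proof.
  intros Hf Hg H.
  replace g with (lc 1 f (-1) (lc 1 f (-1) g))
    by (apply functional_extensionality; intros; unfold lc; ring).
  eapply Rle_trans; [apply nrm_lc_le; auto using sqs_lc|].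
  rewrite Rabs_m1, Rabs_R1; lra.
Qed.

(** Elements with finitely supported image are dense in the graph norm, and both sides are
    continuous in that norm, so [symmetric_finsupp] extends to all of [D]. *)
Lemma symmetric_shifted (a b : nat -> R) D (z : R) (f g : nat -> R) :
  (forall n, 0 < b n) -> jacobi_domain a b D -> regular a b D z ->
  D f -> D g -> dot (shifted a b z f) g = dot f (shifted a b z g).
Proof.
  intros Hb HD HR Hf Hg.
  assert (HE : forall h, D h -> sqs h /\ sqs (shifted a b z h)).
  { intros h Hh; split; [apply (proj1 HD _ Hh)|eauto using sqs_shifted]. }
  destruct (HE _ Hf), (HE _ Hg).
  set (x := dot (shifted a b z f) g - dot f (shifted a b z g)).
  enough (Rabs x <= 0).
  { destruct (Req_dec x 0) as [E|E]; [unfold x in E; lra|].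
    apply Rabs_pos_lt in E; lra. }
  set (F := shifted a b z f) in *; set (G := shifted a b z g) in *.
  set (B := nrm f + nrm g + nrm F + nrm G + 4).
  assert (HB : forall eps, 0 < eps <= 1 -> Rabs x <= B * eps).
  { intros eps He.
    destruct (resolvent_approx a b D z f eps HD HR Hf) as (f' & Hf' & Sf & Af & AF);
      [lra|].
    destruct (resolvent_approx a b D z g eps HD HR Hg) as (g' & Hg' & Sg & Ag & AG);
      [lra|].
    pose proof (symmetric_finsupp a b D z f' g' Hb HD HR Hf' Hg' Sf Sg) as E.
    fold F in AF; fold G in AG.
    destruct (HE _ Hf'), (HE _ Hg').
    set (F' := shifted a b z f') in *; set (G' := shifted a b z g') in *.
    replace x with ((dot F g - dot F' g') - (dot f G - dot f' G'))
      by (unfold x; rewrite E; ring).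
    eapply Rle_trans; [apply Rabs_triang|]; rewrite Rabs_Ropp.
    assert (I1 := dot_diff F g F' g').
    assert (I2 := dot_diff f G f' G').
    assert (I3 := nrm_near F F' eps).
    assert (I4 := nrm_near f f' eps).
    pose proof (nrm_ge0 f); pose proof (nrm_ge0 g); pose proof (nrm_ge0 F);
      pose proof (nrm_ge0 G); pose proof (nrm_ge0 f'); pose proof (nrm_ge0 F').
    pose proof (nrm_ge0 (lc 1 F (-1) F')). pose proof (nrm_ge0 (lc 1 f (-1) f')).
    pose proof (nrm_ge0 (lc 1 G (-1) G')). pose proof (nrm_ge0 (lc 1 g (-1) g')).
    specialize (I3 ltac:(assumption) ltac:(assumption) AF).
    specialize (I4 ltac:(assumption) ltac:(assumption) Af).
    assert (B1 : nrm (lc 1 F (-1) F') * nrm g <= eps * nrm g) by nra.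
    assert (B2 : nrm F' * nrm (lc 1 g (-1) g') <= (nrm F + 1) * eps) by nra.
    assert (B3 : nrm (lc 1 f (-1) f') * nrm G <= eps * nrm G) by nra.
    assert (B4 : nrm f' * nrm (lc 1 G (-1) G') <= (nrm f + 1) * eps) by nra.
    specialize (I1 ltac:(assumption) ltac:(assumption) ltac:(assumption) ltac:(assumption)).
    specialize (I2 ltac:(assumption) ltac:(assumption) ltac:(assumption) ltac:(assumption)).
    unfold B; nra. }
  assert (HB1 : 0 <= B).
  { unfold B; pose proof (nrm_ge0 f); pose proof (nrm_ge0 g); pose proof (nrm_ge0 F);
      pose proof (nrm_ge0 G); lra. }
  apply Rle_of_eps with B 1; [lra|].
  intros eps He; apply HB; lra.
Qed.

Lemma symmetric (a b : nat -> R) D (z : R) (f g : nat -> R) :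
  (forall n, 0 < b n) -> jacobi_domain a b D -> regular a b D z ->
  D f -> D g -> dot (rtau a b f) g = dot f (rtau a b g).
Proof.
  intros Hb HD HR Hf Hg.
  pose proof (symmetric_shifted a b D z f g Hb HD HR Hf Hg) as H.
  destruct (proj1 HD _ Hf), (proj1 HD _ Hg).
  rewrite !shifted_lc_eq, dot_lc_l, dot_lc_r in H by assumption. lra.
Qed.

(** * The gap estimate *)

Definition unit0 : nat -> R := fun n => match n with O => 1 | S _ => 0 end.

(** A rank-one perturbation along the first basis vector, expressed through the first diagonal
    coefficient; the domain stays the same. *)
Definition bump (c : R) (a : nat -> R) : nat -> R :=
  fun n => match n with O => a O + c | S _ => a n end.

(* [lam] enumerates the spectrum of the operator with coefficients [a], [b] and
   domain [D], and [nu] that of its perturbation by [c <., e1> e1]. *)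
Record model (a b : nat -> R) (D : (nat -> R) -> Prop) (c : R)
    (lam nu : nat -> R) : Prop := {
  model_pos : forall n, 0 < b n;
  model_dom : jacobi_domain a b D;
  model_eig : forall i, D (pol a b (lam i));
  model_reg : forall z, (forall i, z <> lam i) -> regular a b D z;
  model_reg' : forall z, (forall i, z <> nu i) -> regular (bump c a) b D z;
  model_spec' : forall i, ~ regular (bump c a) b D (nu i);
  model_sep : forall i j, nu i <> lam j;
  model_inj : forall i j, lam i = lam j -> i = j }.

Lemma finsupp_unit0 : finsupp unit0.
Proof. exists 1%nat; intros [|n] Hn; [lia|easy]. Qed.

Lemma shifted_bump (a b f : nat -> R) (c z : R) :
  shifted (bump c a) b z f = lc 1 (shifted a b z f) (c * f O) unit0.
Proof.
  apply functional_extensionality; intros [|n];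
    unfold shifted, rtau, lc, bump, unit0; ring.
Qed.

Lemma jacobi_domain_bump (a b : nat -> R) D (c : R) :
  jacobi_domain a b D -> jacobi_domain (bump c a) b D.
Proof.
  intros (H1 & H2 & H3); split; [|now split].
  intros f Hf; destruct (H1 f Hf) as [Hs Ht]; split; [exact Hs|].
  replace (rtau (bump c a) b f) with (shifted (bump c a) b 0 f)
    by (apply functional_extensionality; intros; unfold shifted; ring).
  rewrite shifted_bump, shifted_lc_eq.
  apply sqs_lc; [now apply sqs_lc|apply sqs_finsupp, finsupp_unit0].
Qed.

Lemma shifted_pol (a b : nat -> R) (l z : R) :
  (forall n, 0 < b n) ->
  shifted a b z (pol a b l) = fun n => (l - z) * pol a b l n.
Proof.
  intros Hb; apply functional_extensionality; intros n.
  rewrite (shifted_shift a b _ l z); unfold lc.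
  rewrite pol_solution by assumption; ring.
Qed.

Lemma sqs_dom (a b : nat -> R) D f : jacobi_domain a b D -> D f -> sqs f.
Proof. intros [H _] Hf; apply H, Hf. Qed.

Lemma dot_scal_l (f g : nat -> R) (s : R) :
  dot (fun n => s * f n) g = s * dot f g.
Proof.
  unfold dot; rewrite <- Series_scal_l; apply Series_ext; intros; ring.
Qed.

Lemma dot_scal_r (f g : nat -> R) (s : R) :
  dot f (fun n => s * g n) = s * dot f g.
Proof. now rewrite dot_comm, dot_scal_l, dot_comm. Qed.

Lemma nrm_perp_le (f g : nat -> R) (t : R) :
  sqs f -> sqs g -> dot f g = 0 -> nrm f <= nrm (lc 1 f t g).
Proof.
  intros Hf Hg H; apply le_of_sq; [apply nrm_ge0|].
  rewrite !nrm_sq by auto using sqs_lc.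
  rewrite dot_lc_l, !dot_lc_r, (dot_comm g f), H by auto using sqs_lc.
  pose proof (dot_ge0 g Hg); nra.
Qed.

(** Subtracting [f O] times the eigenvector makes the first entry 0, where the perturbation acts as
    zero and the lower bound of the perturbed operator applies. The subtraction does not change the
    image, and by orthogonality it does not decrease the norm. *)
Lemma lower_bound_perp (a b : nat -> R) D (c l : R) :
  (forall n, 0 < b n) -> jacobi_domain a b D ->
  D (pol a b l) -> regular (bump c a) b D l ->
  exists K, 0 < K /\ forall f, D f -> dot f (pol a b l) = 0 ->
    nrm f <= K * nrm (shifted a b l f).
Proof.
  intros Hb HD Hp [_ [K HK]].
  exists (Rmax K 1); split; [apply Rlt_le_trans with (2 := Rmax_r K 1); lra|].
  intros f Hf Hperp.
  apply Rle_trans with (nrm (lc 1 f (- f O) (pol a b l))).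
  { apply nrm_perp_le; eauto using sqs_dom. }
  apply Rle_trans with (1 := HK _ (proj1 (proj2 HD) _ _ _ _ Hf Hp)).
  rewrite shifted_bump, shifted_lc, shifted_pol by assumption.
  replace (lc 1 (lc 1 (shifted a b l f) (- f 0%nat)
            (fun n : nat => (l - l) * pol a b l n))
            (c * lc 1 f (- f 0%nat) (pol a b l) 0%nat) unit0)
    with (shifted a b l f).
  - apply Rmult_le_compat_r; [apply nrm_ge0|apply Rmax_l].
  - apply functional_extensionality; intros n; unfold lc.
    change (pol a b l 0%nat) with 1; ring.
Qed.

Lemma regular_bound (a b : nat -> R) D (z : R) :
  regular a b D z ->
  exists K, 0 < K /\ forall f, D f -> nrm f <= K * nrm (shifted a b z f).
Proof.
  intros [_ [K HK]].
  exists (Rmax K 1); split; [apply Rlt_le_trans with (2 := Rmax_r K 1); lra|].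
  intros f Hf; apply Rle_trans with (1 := HK f Hf).
  apply Rmult_le_compat_r; [apply nrm_ge0|apply Rmax_l].
Qed.

Lemma nrm_pol_pos (a b : nat -> R) (l : R) :
  sqs (pol a b l) -> 0 < nrm (pol a b l).
Proof.
  intros H; pose proof (nrm_ge_coord _ O H) as H1; simpl in H1.
  rewrite Rabs_R1 in H1; lra.
Qed.

Lemma orthogonal_eig (a b : nat -> R) D c lam nu :
  model a b D c lam nu -> forall i j, i <> j ->
  dot (pol a b (lam i)) (pol a b (lam j)) = 0.
Proof.
  intros H i j Hij; destruct H.
  (* Symmetry requires one real regular point, and the eigenvalues of the perturbed operator are
     such points. *)
  assert (HR : regular a b D (nu O)) by (apply model_reg0; auto).
  pose proof (symmetric_shifted a b D (nu O) _ _ model_pos0 model_dom0 HR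
    (model_eig0 i) (model_eig0 j)) as E.
  rewrite !shifted_pol, dot_scal_l, dot_scal_r in E by assumption.
  assert (Hl : lam i <> lam j) by (intros e; apply Hij; auto).
  apply Rmult_eq_reg_l with (lam i - lam j); lra.
Qed.

(* The spectrum of the perturbed operator is disjoint from that of the
   original one, hence each eigenvalue is isolated. *)
Lemma model_isolated (a b : nat -> R) D c lam nu :
  model a b D c lam nu -> forall x, exists d, 0 < d /\
  forall i, lam i <> x -> d <= Rabs (lam i - x).
Proof.
  intros H x; pose proof (orthogonal_eig _ _ _ _ _ _ H) as Ho; destruct H.
  assert (HH : exists K, 0 < K /\ forall i, lam i <> x ->
    nrm (pol a b (lam i)) <= K * nrm (shifted a b x (pol a b (lam i)))).
  { destruct (classic (exists j, x = lam j)) as [[j Hj]|Hn].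
    - destruct (lower_bound_perp a b D c (lam j)) as (K & K0 & HK); auto.
      exists K; split; [exact K0|]. intros i Hi; rewrite Hj; apply HK; auto.
      apply Ho; intros e; apply Hi; now rewrite Hj, e.
    - destruct (regular_bound a b D x) as (K & K0 & HK).
      + apply model_reg0; intros i e; apply Hn; now exists i.
      + exists K; split; auto. }
  destruct HH as (K & K0 & HK).
  (* For the eigenvector at [lam i] the bound reads [1 <= K * Rabs (lam i - x)]. *)
  exists (/ K); split; [now apply Rinv_0_lt_compat|].
  intros i Hi; specialize (HK i Hi).
  rewrite shifted_pol, nrm_scal in HK by assumption.
  assert (Hp := nrm_pol_pos a b (lam i) (sqs_dom _ _ _ _ model_dom0 (model_eig0 i))).
  apply Rmult_le_reg_l with K; [exact K0|]; rewrite Rinv_r by lra.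
  apply Rmult_le_reg_r with (nrm (pol a b (lam i))); lra.
Qed.

(** Infinitely many eigenvalues in a bounded interval would accumulate at some [x] by
    Bolzano-Weierstrass; isolation then forces the value [x] at two different indices, against
    injectivity. *)
Lemma model_infinity (a b : nat -> R) D c lam nu :
  model a b D c lam nu ->
  forall B, exists N, forall i, (N <= i)%nat -> B <= Rabs (lam i).
Proof.
  intros H B; apply NNPP; intros Hn.
  assert (HS : forall N, exists i, (N <= i)%nat /\ Rabs (lam i) < B).
  { intros N; apply NNPP; intros Hc; apply Hn; exists N; intros i Hi.
    destruct (Rle_lt_dec B (Rabs (lam i))) as [L|L]; [exact L|].
    exfalso; apply Hc; now exists i. }
  destruct (choice _ HS) as [s Hs].
  destruct (Bolzano_Weierstrass (fun n => lam (s n)) (fun x => - B <= x <= B))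
    as [x Hx].
  { apply compact_P3. }
  { intros n; destruct (Hs n) as [_ L]; apply Rabs_def2 in L; lra. }
  destruct (model_isolated _ _ _ _ _ _ H x) as (d & Hd & Hiso).
  assert (Hnb : neighbourhood (fun y => Rabs (y - x) < d) x).
  { exists (mkposreal d Hd); intros y Hy; exact Hy. }
  assert (Hall : forall N, exists n, (N <= n)%nat /\ lam n = x).
  { intros N; destruct (Hx _ N Hnb) as (p & Hp & Hlt).
    exists (s p); split; [destruct (Hs p); lia|].
    destruct (Req_dec (lam (s p)) x) as [E|E]; [exact E|].
    specialize (Hiso _ E); lra. }
  destruct (Hall O) as (n & _ & En); destruct (Hall (S n)) as (k & Hk & Ek).
  assert (n = k) by (apply (model_inj _ _ _ _ _ _ H); lra). lia.
Qed.

(** Let [s] be the norm of the inverse of [A] on the complement [V] of the first [N] eigenvectors. A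
    near-maximizer of that norm is nearly an eigenvector of the squared inverse with eigenvalue
    [s * s], whereas for [/ s < r] both [A - / s] and [A + / s] are bounded below on [V]. *)
Lemma gap (a b : nat -> R) D c lam nu (z r : R) (N : nat) :
  model a b D c lam nu -> (forall i, z <> lam i) -> 0 < r ->
  (forall i, (N <= i)%nat -> r <= Rabs (lam i - z)) ->
  forall f, D f -> (forall i, (i < N)%nat -> dot f (pol a b (lam i)) = 0) ->
  r * nrm f <= nrm (shifted a b z f).
Proof.
  intros H Hz Hr HN.
  set (V := fun f => D f /\ forall i, (i < N)%nat -> dot f (pol a b (lam i)) = 0).
  pose proof (model_reg _ _ _ _ _ _ H z Hz) as HR.
  destruct (regular_bound _ _ _ _ HR) as (K & HK0 & HK).
  pose proof (model_pos _ _ _ _ _ _ H) as Hb.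
  pose proof (model_dom _ _ _ _ _ _ H) as HD.
  pose proof (model_eig _ _ _ _ _ _ H) as Heig.
  set (A := shifted a b z).
  assert (HVlc : forall f g s t, V f -> V g -> V (lc s f t g)).
  { intros f g s t [Hf1 Hf2] [Hg1 Hg2]; split; [now apply (proj1 (proj2 HD))|].
    intros i Hi; rewrite dot_lc_l, Hf2, Hg2; eauto using sqs_dom; ring. }
  assert (HVs : forall f, V f -> sqs f) by (intros f [Hf _]; eauto using sqs_dom).
  assert (HAs : forall f, V f -> sqs (A f))
    by (intros f [Hf _]; eapply sqs_shifted; eauto).
  (* A point nearer to [z] than [r] is either regular or an eigenvalue [lam j] with [j < N], and
     then [lower_bound_perp] applies on [V]. *)
  assert (Hbd : forall z', Rabs (z' - z) < r ->
    exists C, 0 < C /\ forall f, V f -> nrm f <= C * nrm (shifted a b z' f)).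
  { intros z' Hz'.
    destruct (classic (exists j, z' = lam j)) as [[j Hj]|Hn].
    - assert (Hj' : (j < N)%nat).
      { destruct (Nat.lt_ge_cases j N) as [L|L]; [exact L|].
        specialize (HN j L); rewrite <- Hj in HN; lra. }
      destruct (lower_bound_perp a b D c (lam j)) as (C & C0 & HC); auto.
      { apply (model_reg' _ _ _ _ _ _ H); intros i e.
        apply (model_sep _ _ _ _ _ _ H i j); auto. }
      exists C; split; [exact C0|]; intros f [Hf1 Hf2]; rewrite Hj; auto.
    - destruct (regular_bound a b D z') as (C & C0 & HC).
      { apply (model_reg _ _ _ _ _ _ H); intros i e; apply Hn; now exists i. }
      exists C; split; [exact C0|]; intros f [Hf1 _]; auto. }
  (* The supremum [s] of [E] is the norm of the inverse of [A] on [V]. *)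
  set (E := fun x => exists f, V f /\ nrm (A f) <= 1 /\ x = nrm f).
  assert (HE0 : E 0).
  { exists (fun n => 0 * 0); split; [split|split].
    - apply (proj2 (proj2 HD)); exists O; intros; ring.
    - intros i _; rewrite (dot_scal_l (fun _ => 0)); ring.
    - replace (A (fun n => 0 * 0)) with (fun n : nat => 0 * 0).
      + rewrite (nrm_scal (fun _ => 0)), Rabs_R0; lra.
      + apply functional_extensionality; intros [|n]; unfold A, shifted, rtau; ring.
    - rewrite (nrm_scal (fun _ => 0)), Rabs_R0; ring. }
  destruct (completeness E) as [s [Hs1 Hs2]].
  { exists K; intros x (f & [Hf _] & Hf1 & ->).
    specialize (HK f Hf); fold (A f) in HK; nra. }
  { now exists 0. }
  assert (Hs0 : 0 <= s) by (apply Hs1, HE0).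
  assert (Hhom : forall f, V f -> nrm f <= s * nrm (A f)).
  { intros f Hf.
    pose proof (nrm_ge0 (A f)) as H0.
    destruct (Req_dec (nrm (A f)) 0) as [E0|E0].
    - specialize (HK f (proj1 Hf)); fold (A f) in HK; rewrite E0 in *; lra.
    - set (t := / nrm (A f)).
      assert (Ht : 0 < t) by (apply Rinv_0_lt_compat; lra).
      assert (HEt : E (t * nrm f)).
      { exists (lc t f 0 f); split; [now apply HVlc|].
        replace (lc t f 0 f) with (fun n => t * f n)
          by (apply functional_extensionality; intros; unfold lc; ring).
        rewrite nrm_scal, (Rabs_pos_eq t) by lra; split; [|reflexivity].
        replace (A (fun n => t * f n)) with (fun n => t * A f n).
        - rewrite nrm_scal, (Rabs_pos_eq t) by lra. unfold t; rewrite Rinv_l; lra.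
        - apply functional_extensionality; intros [|n]; unfold A, shifted, rtau; ring. }
      apply Hs1 in HEt.
      apply Rmult_le_reg_l with t; [exact Ht|].
      replace (t * (s * nrm (A f))) with s by (unfold t; field; exact E0).
      exact HEt. }
  enough (Hrs : r * s <= 1).
  { intros f Hf1 Hf2. specialize (Hhom f (conj Hf1 Hf2)).
    pose proof (nrm_ge0 (A f)); fold (A f). nra. }
  destruct (Rle_lt_dec (r * s) 1) as [L|L]; [exact L|exfalso].
  assert (Hsp : 0 < s) by nra.
  assert (Hs_r : / s < r).
  { apply Rmult_lt_reg_r with s; [exact Hsp|]; rewrite Rinv_l; lra. }
  assert (Hsi : 0 < / s) by now apply Rinv_0_lt_compat.
  destruct (Hbd (z + / s)) as (C1 & C10 & HC1).
  { replace (z + / s - z) with (/ s) by ring; rewrite Rabs_pos_eq; lra. }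
  destruct (Hbd (z - / s)) as (C2 & C20 & HC2).
  { replace (z - / s - z) with (- / s) by ring.
    rewrite Rabs_Ropp, Rabs_pos_eq; lra. }
  set (M := / s * C1 + / s * C2 * (/ s * C1)).
  assert (HM0 : 0 < M).
  { unfold M; assert (0 < / s * C1) by nra. assert (0 < / s * C2) by nra. nra. }
  enough (Hle : s * s * (s * s) / 4 <= 0).
  { assert (0 < s * s) by nra. nra. }
  (* Here [d] is the defect of a near-maximizer [f]; [d < s / 2] keeps [nrm f] above [s / 2]. *)
  apply Rle_of_eps with (M * M * (4 * s * s * s)) (s / 2); [lra|].
  intros d Hd.
  assert (Hex : exists f, V f /\ nrm (A f) <= 1 /\ s - d < nrm f).
  { apply NNPP; intros Hn.
    assert (s <= s - d); [|lra].
    apply Hs2; intros x (f & Hf & Hf1 & ->).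
    destruct (Rle_lt_dec (nrm f) (s - d)) as [L'|L']; [exact L'|].
    exfalso; apply Hn; now exists f. }
  destruct Hex as (f & Hf & Hf1 & Hfd).
  destruct (proj1 HR f (HVs f Hf)) as (h & Hh & HAh).
  apply functional_extensionality in HAh; fold (A h) in HAh.
  (* By symmetry the inverse of [A] preserves orthogonality to eigenvectors. *)
  assert (HVh : V h).
  { split; [exact Hh|]; intros i Hi.
    pose proof (symmetric_shifted a b D z _ _ Hb HD HR Hh (Heig i)) as Es.
    fold (A h) in Es. rewrite HAh, (proj2 Hf i Hi), shifted_pol, dot_scal_r in Es by auto.
    symmetry in Es; apply Rmult_integral in Es; destruct Es as [Es|Es]; [|exact Es].
    exfalso; apply (Hz i); lra. }
  set (g := A f) in *.
  assert (Hhg : dot h g = dot f f).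
  { unfold g, A; rewrite <- (symmetric_shifted a b D z h f Hb HD HR Hh (proj1 Hf)).
    fold (A h); now rewrite HAh. }
  assert (Hsg : sqs g) by (apply HAs, Hf).
  assert (Hsh : sqs h) by (apply HVs, HVh).
  assert (Hsf : sqs f) by (apply HVs, Hf).
  (* The defect [w] factors: [A - / s] maps [q] to [- w / s], and [A + / s] maps [h] to [q / s].
     Hence a small [w] forces [q] and [h] to be small, although [q - h] equals [s] times [f]. *)
  set (w := lc 1 h (- (s * s)) g).
  set (q := lc 1 h s f).
  assert (Hfs : nrm f <= s) by (apply Hs1; exists f; auto).
  assert (Hw : nrm w * nrm w <= 4 * s * s * s * d).
  { unfold w; rewrite nrm_sq by auto using sqs_lc.
    rewrite dot_lc_l, !dot_lc_r, (dot_comm g h), Hhg by auto using sqs_lc.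
    rewrite <- !nrm_sq by assumption.
    pose proof (Hhom h HVh) as Hh1; rewrite HAh in Hh1.
    pose proof (nrm_ge0 h). pose proof (nrm_ge0 g). pose proof (nrm_ge0 f).
    assert (nrm h * nrm h <= (s * nrm f) * (s * nrm f)) by nra.
    assert (nrm f * nrm f <= s * s) by nra.
    assert (nrm g * nrm g <= 1) by nra.
    assert (Hss : 0 < s * s) by nra.
    assert (s * s - nrm f * nrm f <= 2 * s * d) by nra.
    assert (s * s * (nrm g * nrm g) <= s * s) by nra.
    apply Rle_trans with (2 * (s * s) * (s * s - nrm f * nrm f)); [|nra].
    assert (s * s * (s * s * (nrm g * nrm g)) <= s * s * (s * s)) by nra.
    assert (nrm h * nrm h <= s * s * (s * s)) by nra.
    nra. }
  assert (Hq : nrm q <= / s * C1 * nrm w).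
  { apply Rle_trans with (1 := HC1 q (HVlc _ _ _ _ HVh Hf)).
    replace (shifted a b (z + / s) q) with (fun n => (- / s) * w n).
    - rewrite nrm_scal, Rabs_Ropp, Rabs_pos_eq by lra; lra.
    - unfold q; rewrite (shifted_shift a b _ z), shifted_lc.
      fold (A h) (A f) g; rewrite HAh.
      apply functional_extensionality; intros n; unfold w, lc; field; lra. }
  assert (Hh2 : nrm h <= / s * C2 * nrm q).
  { apply Rle_trans with (1 := HC2 h HVh).
    replace (shifted a b (z - / s) h) with (fun n => (/ s) * q n).
    - rewrite nrm_scal, Rabs_pos_eq by lra; lra.
    - rewrite (shifted_shift a b _ z); fold (A h); rewrite HAh.
      apply functional_extensionality; intros n; unfold q, lc; field; lra. }
  assert (Hsf2 : s * nrm f <= nrm q + nrm h).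
  { replace (s * nrm f) with (nrm (lc 1 q (-1) h)).
    - eapply Rle_trans; [apply nrm_lc_le; auto; unfold q; auto using sqs_lc|].
      rewrite Rabs_m1, Rabs_R1; lra.
    - replace (lc 1 q (-1) h) with (fun n => s * f n).
      + rewrite nrm_scal, Rabs_pos_eq; lra.
      + apply functional_extensionality; intros n; unfold q, lc; ring. }
  pose proof (nrm_ge0 w) as Hw0.
  assert (Hfin : s * nrm f <= M * nrm w).
  { assert (/ s * C2 * nrm q <= / s * C2 * (/ s * C1 * nrm w)).
    { apply Rmult_le_compat_l; [nra|exact Hq]. }
    unfold M; nra. }
  assert (Hlow : s * s / 2 <= M * nrm w) by nra.
  assert (Hsq : (s * s / 2) * (s * s / 2) <= (M * nrm w) * (M * nrm w)).
  { apply Rmult_le_compat; nra. }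
  assert (HMM : M * M * (nrm w * nrm w) <= M * M * (4 * s * s * s * d))
    by (apply Rmult_le_compat_l; [nra|exact Hw]).
  lra.
Qed.

(** * Eigenfunction expansion *)

(** This is the remainder of [x] after subtracting its components along the first [N] vectors, not
    the projection onto their span. *)
Fixpoint proj (u : nat -> nat -> R) (N : nat) (x : nat -> R) : nat -> R :=
  match N with
  | O => x
  | S n => lc 1 (proj u n x) (- (/ dot (u n) (u n) * dot x (u n))) (u n)
  end.

Definition eigenbasis (a b lam : nat -> R) : nat -> nat -> R :=
  fun i => pol a b (lam i).

(** The norming constants, which are the masses of the spectral measure of the first basis
    vector. *)
Definition weight (a b lam : nat -> R) (i : nat) : R :=
  / dot (pol a b (lam i)) (pol a b (lam i)).

Lemma proj_sqs (u : nat -> nat -> R) (N : nat) (x : nat -> R) :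
  (forall i, sqs (u i)) -> sqs x -> sqs (proj u N x).
Proof. intros Hu Hx; induction N; simpl; auto using sqs_lc. Qed.

Lemma proj_dot (u : nat -> nat -> R) (N : nat) (x : nat -> R) (i : nat) :
  (forall i, sqs (u i)) -> (forall i, dot (u i) (u i) <> 0) ->
  (forall i j, i <> j -> dot (u i) (u j) = 0) -> sqs x ->
  dot (proj u N x) (u i) = if Nat.ltb i N then 0 else dot x (u i).
Proof.
  intros Hu Hn Ho Hx; induction N as [|N IH]; simpl proj; [easy|].
  rewrite dot_lc_l, IH by auto using proj_sqs.
  destruct (Nat.ltb_spec i N), (Nat.ltb_spec i (S N)); try lia.
  - rewrite (Ho N i) by lia; ring.
  - replace i with N by lia; field; apply Hn.
  - rewrite (Ho N i) by lia; ring.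
Qed.

Lemma proj_nrm (u : nat -> nat -> R) (N : nat) (x : nat -> R) :
  (forall i, sqs (u i)) -> (forall i, dot (u i) (u i) <> 0) ->
  (forall i j, i <> j -> dot (u i) (u j) = 0) -> sqs x ->
  nrm (proj u N x) <= nrm x.
Proof.
  intros Hu Hn Ho Hx; induction N as [|N IH]; [apply Rle_refl|].
  apply Rle_trans with (2 := IH).
  apply le_of_sq; [apply nrm_ge0|].
  rewrite !nrm_sq by auto using proj_sqs.
  simpl proj.
  pose proof (proj_dot u N x N Hu Hn Ho Hx) as E.
  rewrite Nat.ltb_irrefl in E.
  rewrite dot_lc_l, !dot_lc_r, (dot_comm (u N) (proj u N x)), E
    by auto using proj_sqs, sqs_lc.
  pose proof (dot_ge0 (u N) (Hu N)) as Hp; specialize (Hn N).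
  set (d := dot x (u N)); set (q := dot (u N) (u N)) in *.
  apply Rminus_le.
  replace (_ - _) with (- (d * d * / q)) by (field; exact Hn).
  assert (0 < / q) by (apply Rinv_0_lt_compat; lra).
  nra.
Qed.

Lemma proj_sum (u : nat -> nat -> R) (N : nat) (x : nat -> R) (k : nat) :
  @eq R (sum_n (fun i => / dot (u i) (u i) * dot x (u i) * u i k) N)
    (x k - proj u (S N) x k).
Proof.
  induction N as [|N IH].
  - rewrite sum_O; simpl; unfold lc; ring.
  - rewrite sum_n_S, IH.
    change (proj u (S (S N)) x) with
      (lc 1 (proj u (S N) x)
         (- (/ dot (u (S N)) (u (S N)) * dot x (u (S N)))) (u (S N))).
    unfold lc; ring.
Qed.

Section Model.
Context (a b : nat -> R) (D : (nat -> R) -> Prop) (c : R) (lam nu : nat -> R).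
Context (H : model a b D c lam nu).

Let u := eigenbasis a b lam.

Lemma eig_sqs i : sqs (u i).
Proof. exact (sqs_dom _ _ _ _ (model_dom _ _ _ _ _ _ H) (model_eig _ _ _ _ _ _ H i)). Qed.

Lemma eig_pos i : 0 < dot (u i) (u i).
Proof.
  rewrite <- nrm_sq by apply eig_sqs.
  pose proof (nrm_pol_pos a b (lam i) (eig_sqs i)); unfold u, eigenbasis; nra.
Qed.

Lemma eig_neq i : dot (u i) (u i) <> 0.
Proof. pose proof (eig_pos i); lra. Qed.

Lemma eig_orth i j : i <> j -> dot (u i) (u j) = 0.
Proof. apply (orthogonal_eig _ _ _ _ _ _ H). Qed.

Lemma proj_dom N f : D f -> D (proj u N f).
Proof.
  intros Hf; induction N as [|N IH]; [exact Hf|].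
  apply (proj1 (proj2 (model_dom _ _ _ _ _ _ H))); [exact IH|].
  apply (model_eig _ _ _ _ _ _ H).
Qed.

Lemma dot_shifted_eig (z : R) f i :
  D f -> dot (shifted a b z f) (u i) = (lam i - z) * dot f (u i).
Proof.
  intros Hf.
  pose proof (model_reg _ _ _ _ _ _ H (nu O)
    (fun i => model_sep _ _ _ _ _ _ H O i)) as HR.
  pose proof (sqs_dom _ _ _ _ (model_dom _ _ _ _ _ _ H) Hf).
  pose proof (eig_sqs i).
  pose proof (symmetric_shifted _ _ _ _ _ _ (model_pos _ _ _ _ _ _ H)
    (model_dom _ _ _ _ _ _ H) HR Hf (model_eig _ _ _ _ _ _ H i)) as E.
  rewrite shifted_pol, dot_scal_r in E by apply (model_pos _ _ _ _ _ _ H).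
  fold (u i) in E. change (pol a b (lam i)) with (u i) in E.
  rewrite (shifted_shift a b f (nu O) z), dot_lc_l, E; auto; [ring|].
  eapply sqs_shifted; [exact (model_dom _ _ _ _ _ _ H)|exact Hf].
Qed.

Lemma shifted_proj (z : R) N f :
  D f -> shifted a b z (proj u N f) = proj u N (shifted a b z f).
Proof.
  intros Hf; induction N as [|N IH]; [easy|]; simpl proj.
  assert (E : shifted a b z (u N) = fun n => (lam N - z) * u N n)
    by apply shifted_pol, (model_pos _ _ _ _ _ _ H).
  rewrite shifted_lc, IH, dot_shifted_eig, E by assumption.
  apply functional_extensionality; intros n; unfold lc; ring.
Qed.

(** Taking remainders commutes with [shifted] and does not increase norms, so the gap estimate
    bounds the remainder by [B / r], where [r] can be taken large because [Rabs (lam i)] tends to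
    infinity. *)
Lemma proj_lim f (eps : R) :
  D f -> 0 < eps -> exists N0, forall N, (N0 <= N)%nat -> nrm (proj u N f) < eps.
Proof.
  intros Hf He.
  set (z := nu O).
  assert (Hz : forall i, z <> lam i) by (intros i; apply (model_sep _ _ _ _ _ _ H)).
  pose proof (sqs_shifted _ _ _ _ z (model_dom _ _ _ _ _ _ H) Hf) as Hs.
  set (B := nrm (shifted a b z f)).
  assert (HB : 0 <= B) by apply nrm_ge0.
  set (r := (B + 1) / eps).
  assert (Hr : 0 < r) by (apply Rdiv_lt_0_compat; lra).
  destruct (model_infinity _ _ _ _ _ _ H (r + Rabs z)) as [N0 HN0].
  exists N0; intros N HN.
  assert (HG : r * nrm (proj u N f) <= nrm (shifted a b z (proj u N f))).
  { apply (gap a b D c lam nu z r N H Hz Hr).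
    - intros i Hi; specialize (HN0 i ltac:(lia)).
      pose proof (Rabs_triang_inv (lam i) z); lra.
    - now apply proj_dom.
    - intros i Hi; change (pol a b (lam i)) with (u i).
      rewrite proj_dot; auto using eig_sqs, eig_neq, eig_orth.
      + destruct (Nat.ltb_spec i N); [easy|lia].
      + exact (sqs_dom _ _ _ _ (model_dom _ _ _ _ _ _ H) Hf). }
  rewrite shifted_proj in HG by assumption.
  pose proof (proj_nrm u N _ eig_sqs eig_neq eig_orth Hs) as HP; fold B in HP.
  apply Rmult_lt_reg_l with r; [exact Hr|].
  replace (r * eps) with (B + 1) by (unfold r; field; lra). lra.
Qed.

Lemma eigenfunction_expansion f k :
  D f -> is_series (fun i => weight a b lam i * dot f (u i) * u i k) (f k).
Proof.
  intros Hf.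
  change (is_lim_seq (sum_n (fun i => weight a b lam i * dot f (u i) * u i k)) (f k)).
  apply is_lim_seq_spec; intros eps.
  destruct (proj_lim f eps Hf (cond_pos eps)) as [N0 HN0].
  exists N0; intros N HN.
  assert (E : sum_n (fun i => weight a b lam i * dot f (u i) * u i k) N
    = f k - proj u (S N) f k) by apply (proj_sum u N f k).
  rewrite E.
  replace (f k - proj u (S N) f k - f k) with (- proj u (S N) f k) by ring.
  rewrite Rabs_Ropp.
  apply Rle_lt_trans with (nrm (proj u (S N) f)).
  - apply nrm_ge_coord, proj_sqs; [apply eig_sqs|].
    exact (sqs_dom _ _ _ _ (model_dom _ _ _ _ _ _ H) Hf).
  - apply HN0; lia.
Qed.

End Model.

Definition unit_at (j : nat) : nat -> R := fun n => if Nat.eqb n j then 1 else 0.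

Lemma finsupp_unit_at j : finsupp (unit_at j).
Proof.
  exists (S j); intros n Hn; unfold unit_at; destruct (Nat.eqb_spec n j); [lia|easy].
Qed.

Lemma is_series_single (x : nat -> R) (j : nat) :
  (forall n, n <> j -> x n = 0) -> is_series x (x j).
Proof.
  intros Hx.
  replace (x j) with (sum_n x j).
  - apply is_series_finite; intros n Hn; apply Hx; lia.
  - destruct j as [|j]; [apply sum_O|].
    rewrite sum_n_S, (sum_n_ext_loc _ (fun _ => 0)).
    + rewrite sum_n_const, Rmult_0_r; apply Rplus_0_l.
    + intros n Hn; apply Hx; lia.
Qed.

Lemma dot_unit_at j f : dot (unit_at j) f = f j.
Proof.
  unfold dot; apply is_series_unique.
  replace (f j) with (unit_at j j * f j)
    by (unfold unit_at; rewrite Nat.eqb_refl; ring).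
  apply (is_series_single (fun n => unit_at j n * f n)).
  intros n Hn; unfold unit_at; destruct (Nat.eqb_spec n j); [easy|ring].
Qed.

Lemma unit0_at : unit0 = unit_at O.
Proof. apply functional_extensionality; now intros [|n]. Qed.

(** The expansion of the [j]-th unit vector read at coordinate [k], a relation dual to the
    orthogonality of the eigenvectors. At [j = k = 0] it gives total mass 1. *)
Lemma orthonormality (a b : nat -> R) D c lam nu :
  model a b D c lam nu -> forall j k,
  is_series (fun i => weight a b lam i * pol a b (lam i) j * pol a b (lam i) k)
    (unit_at j k).
Proof.
  intros H j k.
  apply is_series_ext_R with
    (fun i => weight a b lam i * dot (unit_at j) (eigenbasis a b lam i)
              * eigenbasis a b lam i k).
  - intros i; now rewrite dot_unit_at.
  - apply eigenfunction_expansion with D c nu; [exact H|].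
    apply (model_dom _ _ _ _ _ _ H), finsupp_unit_at.
Qed.

(** Since [f] is only square-summable, unit vectors are expanded instead: subtracting eigenvectors
    leaves the product with [f] unchanged, and the remainders tend to 0. *)
Lemma eigenbasis_complete (a b : nat -> R) D c lam nu f :
  model a b D c lam nu -> sqs f ->
  (forall i, dot f (pol a b (lam i)) = 0) -> forall j, f j = 0.
Proof.
  intros H Hf Ho j.
  set (u := eigenbasis a b lam).
  assert (Hu := eig_sqs a b D c lam nu H : forall i, sqs (u i)).
  assert (HD : D (unit_at j)).
  { apply (model_dom _ _ _ _ _ _ H), finsupp_unit_at. }
  assert (Hs := sqs_finsupp _ (finsupp_unit_at j)).
  assert (E : forall N, dot f (proj u N (unit_at j)) = f j).
  { intros N; induction N as [|N IH]; simpl proj.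
    - now rewrite dot_comm, dot_unit_at.
    - rewrite dot_lc_r, IH by auto using proj_sqs.
      change (dot f (u N)) with (dot f (pol a b (lam N))); rewrite Ho; ring. }
  enough (Rabs (f j) <= 0).
  { destruct (Req_dec (f j) 0) as [E0|E0]; [exact E0|].
    apply Rabs_pos_lt in E0; lra. }
  apply Rle_of_eps with (nrm f) 1; [lra|]; intros eps He.
  destruct (proj_lim a b D c lam nu H _ eps HD (proj1 He)) as [N HN].
  rewrite <- (E N); eapply Rle_trans; [apply cauchy_schwarz; auto using proj_sqs|].
  apply Rmult_le_compat_l; [apply nrm_ge0|].
  specialize (HN N (le_n _)); unfold u; lra.
Qed.

(* If [1 + c <e1, (T - nu)^{-1} e1>] were nonzero, the rank-one perturbation
   formula would give a bounded inverse of the perturbed operator minus [nu]. *)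
Lemma perturbation_zero (a b : nat -> R) D c z f :
  jacobi_domain a b D -> regular a b D z -> ~ regular (bump c a) b D z ->
  D f -> shifted a b z f = unit0 -> 1 + c * f O = 0.
Proof.
  intros HD HR HR' Hf Hfe.
  destruct (Req_dec (1 + c * f O) 0) as [E|E]; [exact E|exfalso; apply HR'].
  destruct (regular_bound _ _ _ _ HR) as (K & K0 & HK).
  pose proof (proj1 (proj2 HD)) as Hlc.
  split.
  - intros y Hy; destruct (proj1 HR y Hy) as (x & Hx & Hxy).
    apply functional_extensionality in Hxy.
    exists (lc 1 x (- (c * x O / (1 + c * f O))) f); split; [now apply Hlc|].
    intros n; rewrite shifted_bump, shifted_lc, Hxy, Hfe; unfold lc.
    field; exact E.
  - exists (K + Rabs c * (K / Rabs (1 + c * f O)) * nrm f).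
    intros x Hx.
    set (y := shifted (bump c a) b z x).
    assert (Hy : sqs y).
    { eapply sqs_shifted; [apply jacobi_domain_bump, HD|exact Hx]. }
    set (v := lc 1 x (c * x O) f).
    assert (Hv : D v) by now apply Hlc.
    assert (Hvy : shifted a b z v = y).
    { unfold v, y; rewrite shifted_lc, Hfe, shifted_bump; reflexivity. }
    pose proof (HK v Hv) as Hvn; rewrite Hvy in Hvn.
    assert (Hsx := sqs_dom _ _ _ _ HD Hx); assert (Hsf := sqs_dom _ _ _ _ HD Hf).
    assert (Hsv := sqs_dom _ _ _ _ HD Hv).
    assert (Hx0 : Rabs (x O) <= K / Rabs (1 + c * f O) * nrm y).
    { pose proof (nrm_ge_coord v O Hsv) as H0.
      replace (v O) with ((1 + c * f O) * x O) in H0 by (unfold v, lc; ring).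
      rewrite Rabs_mult in H0.
      assert (Hp : 0 < Rabs (1 + c * f O)) by now apply Rabs_pos_lt.
      apply Rmult_le_reg_l with (Rabs (1 + c * f O)); [exact Hp|].
      replace (Rabs (1 + c * f O) * (K / Rabs (1 + c * f O) * nrm y))
        with (K * nrm y) by (field; lra).
      lra. }
    replace x with (lc 1 v (- (c * x O)) f) at 1
      by (apply functional_extensionality; intros n; unfold v, lc; ring).
    eapply Rle_trans; [now apply nrm_lc_le|].
    rewrite Rabs_R1, Rabs_Ropp, Rabs_mult.
    pose proof (nrm_ge0 f); pose proof (Rabs_pos c); pose proof (Rabs_pos (x O)).
    assert (Rabs c * Rabs (x O) * nrm f
            <= Rabs c * (K / Rabs (1 + c * f O) * nrm y) * nrm f).
    { apply Rmult_le_compat_r; [lra|]; apply Rmult_le_compat_l; lra. }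
    lra.
Qed.

(** Expanding the resolvent at [nu k] applied to the first basis vector writes its first entry, the
    Weyl function, as this series; the value comes from [perturbation_zero]. *)
Lemma weyl_zero (a b : nat -> R) D c lam nu k :
  model a b D c lam nu ->
  is_series (fun i => weight a b lam i / (lam i - nu k)) (- / c).
Proof.
  intros H.
  assert (HR : regular a b D (nu k)).
  { apply (model_reg _ _ _ _ _ _ H); apply (model_sep _ _ _ _ _ _ H). }
  pose proof (model_dom _ _ _ _ _ _ H) as HD.
  destruct (proj1 HR unit0 (sqs_finsupp _ finsupp_unit0)) as (f & Hf & Hfe).
  apply functional_extensionality in Hfe.
  pose proof (perturbation_zero _ _ _ c _ _ HD HR (model_spec' _ _ _ _ _ _ H k)
    Hf Hfe) as E.
  assert (Hc : c <> 0) by (intros e; rewrite e in E; lra).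
  replace (- / c) with (f O).
  2:{ apply Rmult_eq_reg_l with c; [|exact Hc].
      replace (c * - / c) with (-1) by (field; exact Hc). lra. }
  eapply is_series_ext_R; [|apply (eigenfunction_expansion a b D c lam nu H f O Hf)].
  intros i; simpl.
  (* Pairing the resolvent equation with an eigenvector of first entry 1 yields the expansion
     coefficient. *)
  assert (Hd : (lam i - nu k) * dot f (eigenbasis a b lam i) = 1).
  { rewrite <- (dot_shifted_eig a b D c lam nu H) by exact Hf.
    rewrite Hfe, unit0_at, dot_unit_at; reflexivity. }
  assert (Hn : lam i - nu k <> 0) by (intros e; rewrite e in Hd; lra).
  change (eigenbasis a b lam i 0%nat) with 1.
  apply Rmult_eq_reg_l with (lam i - nu k); [|exact Hn].
  replace ((lam i - nu k) * (weight a b lam i * dot f (eigenbasis a b lam i) * 1))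
    with (weight a b lam i * ((lam i - nu k) * dot f (eigenbasis a b lam i))) by ring.
  rewrite Hd; field; exact Hn.
Qed.

(** * Removing pole-zero pairs *)

Section Removal.
Context (lam p : nat -> R) (l v c s : R).
Context (Hl : forall n, lam n <> v).
Context (Hp : is_series p s).
Context (Hv : is_series (fun n => p n / (lam n - v)) (- / c)).

(** The weights of the quotient of [/ c + sum p n / (lam n - z)] by [(z - v) / (z - l)], read off
    from the residues. *)
Let p1 n := p n * ((lam n - l) / (lam n - v)).

(** The factor equals [1 + (v - l) / (lam n - v)], and the series of the second part is known from
    [Hv]. *)
Lemma removal_mass : is_series p1 (s - (v - l) / c).
Proof.
  replace (s - (v - l) / c) with (1 * s + (v - l) * (- / c)) by (unfold Rdiv; ring).
  eapply is_series_ext_R; [|apply is_series_lin; [exact Hp|exact Hv]].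
  intros n; unfold p1; simpl; field. specialize (Hl n); lra.
Qed.

(** Partial fractions in [lam n] with poles [v] and [z]. Here [x] is the value at [z] of the
    function including its constant [/ c], so a remaining zero is the case [x = 0]; a pole of weight
    0 may sit at [z]. *)
Lemma removal_value (z x : R) :
  z <> v -> (forall n, p n <> 0 -> lam n <> z) ->
  is_series (fun n => p n / (lam n - z)) (x - / c) ->
  is_series (fun n => p1 n / (lam n - z)) (x * ((z - l) / (z - v)) - / c).
Proof.
  intros Hz Hn Hx.
  replace (x * ((z - l) / (z - v)) - / c)
    with ((v - l) / (v - z) * (- / c) + (z - l) / (z - v) * (x - / c)).
  2:{ replace (v - z) with (- (z - v)) by ring.
      generalize (/ c); intros y; field; lra. }
  eapply is_series_ext_R; [|apply is_series_lin; [exact Hv|exact Hx]].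
  intros n; unfold p1; simpl. specialize (Hl n).
  destruct (Req_dec (p n) 0) as [E|E].
  - rewrite E; unfold Rdiv; ring.
  - specialize (Hn n E); field; repeat split; lra.
Qed.

(** At the removed pole the quotient takes the finite value [p k / (v - l)], through which the lost
    weight remains visible. *)
Lemma removal_pole (k : nat) :
  l = lam k -> (forall n, n <> k -> lam n <> l) ->
  is_series (fun n => p1 n / (lam n - l)) (p k / (v - l) - / c).
Proof.
  intros Hk Hn.
  assert (Hlv := Hl k); rewrite <- Hk in Hlv.
  replace (p k / (v - l) - / c) with (1 * (- / c) + (-1) * (p k / (lam k - v))).
  2:{ rewrite <- Hk; generalize (/ c); intros; field; lra. }
  (* The new weight at [k] is 0, so its term has to be taken out of the series at [v]; in the other
     terms [lam n - l] cancels. *)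
  set (d := fun n => if Nat.eqb n k then p k / (lam k - v) else 0).
  assert (Hd : is_series d (p k / (lam k - v))).
  { replace (p k / (lam k - v)) with (d k) by (unfold d; now rewrite Nat.eqb_refl).
    apply is_series_single; intros n Hnk; unfold d.
    destruct (Nat.eqb_spec n k); [easy|reflexivity]. }
  eapply is_series_ext_R; [|apply is_series_lin; [exact Hv|exact Hd]].
  intros n; unfold p1, d; simpl; specialize (Hl n).
  destruct (Nat.eqb_spec n k) as [e|e].
  - rewrite e, <- Hk; unfold Rdiv; rewrite Rminus_diag; ring.
  - specialize (Hn n e); field; lra.
Qed.
End Removal.

(** * Comparison of two operators with partly common spectral data *)

Section MixedData.
Context (lam nu : nat -> R) (B : nat -> Prop) (j : nat).
Context (Hinj : forall n k, n <> k -> lam n <> lam k)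
  (Hsep : forall k n, B k -> lam n <> nu k)
  (Hnu : forall k l, B k -> B l -> k <> l -> nu k <> nu l)
  (Hord : forall k n, B k -> n <> k -> 0 < (lam n - lam k) * (lam n - nu k))
  (Hj : B j).

(* [p n] are the weights left after the poles [lam k] and the zeros [nu k] with
   [k = j] or [B k], [k < N] have been removed; [F] is the value at [lam j]
   contributed by the removed factors. *)
Definition removed (c : R) (g : nat -> R) (N : nat) (p : nat -> R) (F s : R) : Prop :=
  (forall n, 0 <= p n) /\ is_series p s /\ s <= 1 /\
  (forall n, B n -> n = j \/ (n < N)%nat -> p n = 0) /\
  (forall k, B k -> k <> j -> (N <= k)%nat ->
     is_series (fun n => p n / (lam n - nu k)) (- / c)) /\
  is_series (fun n => p n / (lam n - lam j)) (g j * F - / c).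

(** Interlacing, in the form of [Hord], keeps [lam n] from separating [lam k] and [nu k], so
    numerator and denominator have the same sign. *)
Lemma removal_factor_nonneg (k n : nat) : B k ->
  n <> k -> 0 <= (lam n - lam k) / (lam n - nu k).
Proof.
  intros Hk Hn; specialize (Hord k n Hk Hn); specialize (Hsep k n Hk).
  assert (Hn0 : lam n - nu k <> 0) by lra.
  replace ((lam n - lam k) / (lam n - nu k))
    with ((lam n - lam k) * (lam n - nu k) * (/ (lam n - nu k) * / (lam n - nu k)))
    by (field; exact Hn0).
  assert (0 <= / (lam n - nu k) * / (lam n - nu k)) by apply Rle_0_sqr.
  nra.
Qed.

Lemma removal_nonneg (k : nat) (p : nat -> R) : B k -> (forall n, 0 <= p n) ->
  forall n, 0 <= p n * ((lam n - lam k) / (lam n - nu k)).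
Proof.
  intros Hk Hp n; destruct (Nat.eq_dec n k) as [e|e].
  - rewrite e; unfold Rdiv; rewrite Rminus_diag, Rmult_0_l, Rmult_0_r; lra.
  - apply Rmult_le_pos; [apply Hp|now apply removal_factor_nonneg].
Qed.

Lemma removal_kills (k : nat) (p : nat -> R) :
  p k * ((lam k - lam k) / (lam k - nu k)) = 0.
Proof. unfold Rdiv; rewrite Rminus_diag; ring. Qed.

Lemma mass_drop_pos (x c : R) : 0 < x * c -> 0 < x / c.
Proof.
  intros H. assert (c <> 0) by (intros e; rewrite e in H; lra).
  replace (x / c) with (x * c * (/ c * / c)) by (field; assumption).
  apply Rmult_lt_0_compat; [exact H|]. apply Rlt_0_sqr, Rinv_neq_0_compat; assumption.
Qed.

(** The pair [j] is removed first: by [removal_pole] the value at [lam j] is then a multiple of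
    [g j], with the factor [/ (nu j - lam j)]. *)
Lemma removed_start (c : R) (g : nat -> R) :
  0 < (nu j - lam j) * c -> (forall n, 0 <= g n) -> is_series g 1 ->
  (forall k, B k -> is_series (fun n => g n / (lam n - nu k)) (- / c)) ->
  removed c g 0 (fun n => g n * ((lam n - lam j) / (lam n - nu j)))
    (/ (nu j - lam j)) (1 - (nu j - lam j) / c).
Proof.
  intros Hc Hg H1 Hw; refine (conj _ (conj _ (conj _ (conj _ (conj _ _))))).
  - now apply removal_nonneg.
  - apply removal_mass; auto.
  - pose proof (mass_drop_pos _ _ Hc); lra.
  - intros n _ [e|e]; [rewrite e; apply removal_kills|lia].
  - intros k Hk Hkj _.
    replace (- / c) with (0 * ((nu k - lam j) / (nu k - nu j)) - / c) by ring.
    apply (removal_value lam g (lam j) (nu j) c); auto.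
    + replace (0 - / c) with (- / c) by ring; auto.
  - apply (removal_pole lam g (lam j) (nu j) c); auto.
Qed.

Lemma removed_step (c : R) (g : nat -> R) (N : nat) (p : nat -> R) (F s : R) :
  B N -> N <> j -> 0 < (nu N - lam N) * c ->
  removed c g N p F s ->
  removed c g (S N) (fun n => p n * ((lam n - lam N) / (lam n - nu N)))
    (F * ((lam j - lam N) / (lam j - nu N))) (s - (nu N - lam N) / c).
Proof.
  intros HN HNj Hc (H1 & H2 & H3 & H4 & H5 & H6); refine (conj _ (conj _ (conj _ (conj _ (conj _ _))))).
  - now apply removal_nonneg.
  - apply removal_mass; auto.
  - pose proof (mass_drop_pos _ _ Hc); lra.
  - intros n Hn Hor; destruct (Nat.eq_dec n N) as [e|e].
    + rewrite e; apply removal_kills.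
    + rewrite H4; [ring|exact Hn|destruct Hor; [auto|right; lia]].
  - intros k Hk Hkj Hle.
    replace (- / c) with (0 * ((nu k - lam N) / (nu k - nu N)) - / c) by ring.
    apply (removal_value lam p (lam N) (nu N) c); auto.
    + apply Hnu; auto; lia.
    + replace (0 - / c) with (- / c) by ring; apply H5; auto; lia.
  - rewrite <- Rmult_assoc.
    apply (removal_value lam p (lam N) (nu N) c); auto.
    (* The point [lam j] is a former pole whose weight is already 0. *)
    intros n Hpn e; apply Hpn, H4.
    + destruct (Nat.eq_dec n j) as [e'|e']; [now rewrite e'|exfalso; now apply (Hinj n j)].
    + left; destruct (Nat.eq_dec n j) as [e'|e']; [exact e'|exfalso; now apply (Hinj n j)].
Qed.

Lemma removed_skip (c : R) (g : nat -> R) (N : nat) (p : nat -> R) (F s : R) :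
  ~ B N \/ N = j -> removed c g N p F s -> removed c g (S N) p F s.
Proof.
  intros Hor (H1 & H2 & H3 & H4 & H5 & H6); refine (conj _ (conj _ (conj _ (conj _ (conj _ _))))); auto.
  - intros n Hn Ho. apply H4; [exact Hn|].
    destruct (Nat.eq_dec n j) as [e|e]; [now left|right].
    destruct Ho as [Ho|Ho]; [easy|].
    destruct (Nat.eq_dec n N) as [e'|e']; [|lia].
    exfalso; destruct Hor as [Hor|Hor]; [apply Hor; now rewrite <- e'|lia].
  - intros k Hk Hkj Hle; apply H5; auto; lia.
Qed.

Context (c c' : R) (g g' : nat -> R).
Context (Hc : forall k, B k -> 0 < (nu k - lam k) * c)
  (Hc' : forall k, B k -> 0 < (nu k - lam k) * c')
  (Hg : forall n, 0 <= g n) (Hg' : forall n, 0 <= g' n)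
  (H1 : is_series g 1) (H1' : is_series g' 1)
  (Hw : forall k, B k -> is_series (fun n => g n / (lam n - nu k)) (- / c))
  (Hw' : forall k, B k -> is_series (fun n => g' n / (lam n - nu k)) (- / c'))
  (Hinf : forall R0, exists N, forall n, (N <= n)%nat -> R0 <= Rabs (lam n))
  (HA : forall n, ~ B n -> g n = g' n).

(** The factor [F] depends only on the common [lam] and [nu], so it is shared by the two operators,
    whereas the remaining masses [s] and [s'] may differ through the couplings. Equality of the
    weights off [B] persists because both are multiplied by the same factors. *)
Definition both (N : nat) (F s : R) : Prop :=
  F <> 0 /\ exists p p' s',
  removed c g N p F s /\ removed c' g' N p' F s' /\
  forall n, ~ B n -> p n = p' n.

Lemma both_start : exists F s, both 0 F s.
Proof.
  exists (/ (nu j - lam j)), (1 - (nu j - lam j) / c); split.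
  { apply Rinv_neq_0_compat; specialize (Hsep j j Hj); lra. }
  do 3 eexists; split; [apply removed_start; auto|split; [apply removed_start; auto|]].
  intros n Hn; simpl; now rewrite HA.
Qed.

Lemma both_step (N : nat) (F s : R) : both N F s ->
  both (S N) F s \/
  (B N /\ N <> j /\
   both (S N) (F * ((lam j - lam N) / (lam j - nu N))) (s - (nu N - lam N) / c)).
Proof.
  intros (HF & p & p' & s' & Hp & Hp' & HAp).
  destruct (classic (B N /\ N <> j)) as [[HN HNj]|Hn].
  - right; split; [exact HN|split; [exact HNj|split]].
    + assert (lam j <> lam N) by auto. assert (lam j <> nu N) by auto.
      apply Rmult_integral_contrapositive; split; [exact HF|].
      unfold Rdiv; apply Rmult_integral_contrapositive; split; [lra|].
      apply Rinv_neq_0_compat; lra.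
    + do 3 eexists; split; [apply removed_step; eauto|split; [apply removed_step; eauto|]].
      intros n Hn; simpl; now rewrite HAp.
  - left; split; [exact HF|exists p, p', s'].
    assert (~ B N \/ N = j) by (destruct (classic (B N)); tauto).
    split; [now apply removed_skip|split; [now apply removed_skip|exact HAp]].
Qed.

(** In the difference of the two series at [lam j] the terms outside [B] cancel and those in [B]
    below [N] vanish. The others have denominators of modulus at least [/ e] and total mass at most
    1 for each operator. *)
Lemma both_difference (N : nat) (F s e : R) : both N F s -> 0 < e ->
  (forall n, (N <= n)%nat -> / e <= Rabs (lam n - lam j)) ->
  Rabs ((g j - g' j) * F - (/ c - / c')) <= 2 * e.
Proof.
  intros (HF & p & p' & s' & Hp & Hp' & HAp) He HN.
  destruct Hp as (P1 & P2 & P3 & P4 & _ & P6).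
  destruct Hp' as (Q1 & Q2 & Q3 & Q4 & _ & Q6).
  pose proof (is_series_lin _ _ 1 (-1) _ _ P6 Q6) as HS.
  replace (1 * (g j * F - / c) + -1 * (g' j * F - / c'))
    with ((g j - g' j) * F - (/ c - / c')) in HS by ring.
  pose proof (is_series_lin _ _ e e _ _ P2 Q2) as HD.
  rewrite <- (is_series_unique _ _ HS).
  assert (Hle : forall n, Rabs (1 * (p n / (lam n - lam j)) + -1 * (p' n / (lam n - lam j)))
                  <= e * p n + e * p' n).
  { intros n; specialize (P1 n); specialize (Q1 n).
    destruct (classic (B n)) as [HB|HB].
    - destruct (Nat.lt_ge_cases n N) as [L|L].
      + rewrite P4, Q4 by auto.
        unfold Rdiv; rewrite !Rmult_0_l, !Rmult_0_r, Rplus_0_r, Rabs_R0; lra.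
      + specialize (HN n L).
        assert (He' : 0 < / e) by now apply Rinv_0_lt_compat.
        assert (Hi : / Rabs (lam n - lam j) <= e).
        { rewrite <- (Rinv_inv e). apply Rinv_le_contravar; assumption. }
        assert (0 < / Rabs (lam n - lam j)) by (apply Rinv_0_lt_compat; lra).
        replace (1 * (p n / (lam n - lam j)) + -1 * (p' n / (lam n - lam j)))
          with ((p n - p' n) * / (lam n - lam j)) by (unfold Rdiv; ring).
        rewrite Rabs_mult, Rabs_inv.
        assert (Rabs (p n - p' n) <= p n + p' n) by (apply Rabs_le; lra).
        pose proof (Rabs_pos (p n - p' n)).
        nra.
    - rewrite HAp by exact HB.
      replace (1 * (p' n / (lam n - lam j)) + -1 * (p' n / (lam n - lam j)))
        with 0 by ring.
      rewrite Rabs_R0; nra. }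
  assert (HX : ex_series (fun n => e * p n + e * p' n)) by (eexists; exact HD).
  eapply Rle_trans; [apply Series_Rabs|].
  { eapply ex_series_dom; [|exact HX]. intros n; rewrite Rabs_Rabsolu; apply Hle. }
  eapply Rle_trans; [apply Series_le; [|exact HX]|].
  { intros n; split; [apply Rabs_pos|apply Hle]. }
  rewrite (is_series_unique _ _ HD); nra.
Qed.

Lemma far_away (X : R) :
  exists N, forall n, (N <= n)%nat -> X <= Rabs (lam n - lam j).
Proof.
  destruct (Hinf (X + Rabs (lam j))) as [N HN]; exists N; intros n Hn.
  specialize (HN n Hn); pose proof (Rabs_triang_inv (lam n) (lam j)); lra.
Qed.

Lemma both_exists (N : nat) : exists F s, both N F s.
Proof.
  induction N as [|N (F & s & IH)]; [apply both_start|].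
  destruct (both_step N F s IH) as [H|(_ & _ & H)]; eauto.
Qed.

(** Equality of the weights at [j] eliminates [F], so the estimate of [both_difference] concerns
    [/ c - / c'] alone. *)
Lemma couplings_equal : g j = g' j -> c = c'.
Proof.
  intros E.
  assert (Hcj := Hc j Hj); assert (Hcj' := Hc' j Hj).
  assert (c <> 0) by (intros e; rewrite e in Hcj; lra).
  assert (c' <> 0) by (intros e; rewrite e in Hcj'; lra).
  enough (Rabs (/ c - / c') <= 0).
  { destruct (Req_dec (/ c - / c') 0) as [E0|E0].
    - rewrite <- (Rinv_inv c), <- (Rinv_inv c'); f_equal; lra.
    - apply Rabs_pos_lt in E0; lra. }
  apply Rle_of_eps with 2 1; [lra|]; intros e He.
  destruct (far_away (/ e)) as [N HN].
  destruct (both_exists N) as (F & s & HB).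
  pose proof (both_difference N F s e HB (proj1 He) HN) as HD.
  rewrite E in HD.
  replace ((g' j - g' j) * F - (/ c - / c')) with (- (/ c - / c')) in HD by ring.
  now rewrite Rabs_Ropp in HD.
Qed.

(* Each further factor exceeds [1 - x / 2], where [x] is the mass lost with it,
   and the total mass lost is at most 1. *)
Lemma factor_bounded_below : exists K y, 0 < y /\ forall N, (K <= N)%nat ->
  exists F s, both N F s /\ y <= Rabs F.
Proof.
  (* Since the lost mass [x] is at most 1, [nu N] lies within [Rabs c] of [lam N]; the distance
     [3 * Rabs c] then keeps the denominator [lam j - nu N] at least [2 * Rabs c] in modulus. *)
  destruct (far_away (3 * Rabs c)) as [K HK].
  destruct (both_exists K) as (F0 & s0 & H0).
  assert (HF0 : 0 < Rabs F0) by (apply Rabs_pos_lt, H0).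
  (* A product of factors [1 - x / 2] is at least 1 minus half the total lost mass, hence at least
     1/2. *)
  exists K, (Rabs F0 / 2); split; [lra|].
  assert (Hall : forall N, (K <= N)%nat -> exists F s, both N F s /\ s <= s0 /\
    Rabs F0 * (1 - (s0 - s) / 2) <= Rabs F).
  { intros N HN; induction HN as [|N HN (F & s & IH & Hs & HF)].
    - exists F0, s0; split; [exact H0|split; [lra|]].
      rewrite Rminus_diag; unfold Rdiv; rewrite Rmult_0_l; lra.
    - destruct (both_step N F s IH) as [HS|(HB & HNj & HS)]; [exists F, s; auto|].
      exists (F * ((lam j - lam N) / (lam j - nu N))), (s - (nu N - lam N) / c).
      pose proof (mass_drop_pos _ _ (Hc N HB)) as Hx.
      set (x := (nu N - lam N) / c) in *.
      assert (Hs1 : 0 <= s - x).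
      { destruct HS as (_ & p & _ & _ & (P1 & P2 & _) & _).
        rewrite <- (is_series_unique _ _ P2).
        apply Series_nonneg; [exact P1|eexists; exact P2]. }
      assert (Hs01 : s0 <= 1).
      { destruct H0 as (_ & p & _ & _ & (_ & _ & P3 & _) & _); exact P3. }
      split; [exact HS|split; [lra|]].
      rewrite Rabs_mult.
      assert (c <> 0) by (intros e; specialize (Hc j Hj); rewrite e in Hc; lra).
      assert (Hcp : 0 < Rabs c) by now apply Rabs_pos_lt.
      assert (Hd : nu N - lam N = x * c) by (unfold x; field; assumption).
      assert (Hq : 1 - x / 2 <= Rabs ((lam j - lam N) / (lam j - nu N))).
      { specialize (HK N HN). specialize (Hsep N j HB).
        rewrite Rabs_minus_sym in HK.
        assert (Hden : 2 * Rabs c <= Rabs (lam j - nu N)).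
        { replace (lam j - nu N) with ((lam j - lam N) - x * c) by lra.
          pose proof (Rabs_triang_inv (lam j - lam N) (x * c)) as Ht.
          rewrite (Rabs_mult x c), (Rabs_pos_eq x) in Ht by lra.
          nra. }
        replace ((lam j - lam N) / (lam j - nu N)) with (1 - - (x * c / (lam j - nu N))).
        2:{ rewrite <- Hd; field; lra. }
        pose proof (Rabs_triang_inv 1 (- (x * c / (lam j - nu N)))) as Ht.
        rewrite Rabs_R1, Rabs_Ropp in Ht.
        unfold Rdiv in Ht; rewrite !Rabs_mult, Rabs_inv, (Rabs_pos_eq x) in Ht by lra.
        assert (Hi : Rabs c * / Rabs (lam j - nu N) <= 1 / 2).
        { apply Rmult_le_reg_r with (Rabs (lam j - nu N)); [lra|].
          rewrite Rmult_assoc, Rinv_l by lra. lra. }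
        unfold Rdiv; nra. }
      assert (Hx1 : x <= 1) by lra.
      apply Rle_trans with (Rabs F0 * (1 - (s0 - s) / 2) * (1 - x / 2)).
      + rewrite Rmult_assoc; apply Rmult_le_compat_l; [lra|]. nra.
      + apply Rmult_le_compat; try lra. apply Rmult_le_pos; lra. }
  intros N HN; destruct (Hall N HN) as (F & s & HB & Hs & HF).
  exists F, s; split; [exact HB|].
  assert (Hs1 : 0 <= s).
  { destruct HB as (_ & p & _ & _ & (P1 & P2 & _) & _).
    rewrite <- (is_series_unique _ _ P2).
    apply Series_nonneg; [exact P1|eexists; exact P2]. }
  assert (Hs01 : s0 <= 1).
  { destruct H0 as (_ & p & _ & _ & (_ & _ & P3 & _) & _); exact P3. }
  nra.
Qed.

(** Equal couplings leave only the term with [F] in [both_difference], and [F] stays away from 0. *)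
Lemma weights_equal : c = c' -> g j = g' j.
Proof.
  intros E.
  destruct factor_bounded_below as (K & y & Hy & HF).
  enough (Rabs (g j - g' j) * y <= 0).
  { destruct (Req_dec (g j - g' j) 0) as [E0|E0]; [lra|].
    apply Rabs_pos_lt in E0; nra. }
  apply Rle_of_eps with 2 1; [lra|]; intros e He.
  destruct (far_away (/ e)) as [N HN].
  destruct (HF (max K N) ltac:(lia)) as (F & s & HB & HyF).
  pose proof (both_difference _ F s e HB (proj1 He)
    (fun n Hn => HN n ltac:(lia))) as H.
  rewrite E, Rminus_diag, Rminus_0_r, Rabs_mult in H.
  pose proof (Rabs_pos (g j - g' j)); nra.
Qed.
End MixedData.

Lemma mixed_data_unique (lam nu : nat -> R) (B : nat -> Prop) (m : nat)
    (c c' : R) (g g' : nat -> R) :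
  (forall n k, n <> k -> lam n <> lam k) ->
  (forall k n, B k -> lam n <> nu k) ->
  (forall k l, B k -> B l -> k <> l -> nu k <> nu l) ->
  (forall k n, B k -> n <> k -> 0 < (lam n - lam k) * (lam n - nu k)) ->
  (forall R0, exists N, forall n, (N <= n)%nat -> R0 <= Rabs (lam n)) ->
  (forall k, B k -> 0 < (nu k - lam k) * c) ->
  (forall k, B k -> 0 < (nu k - lam k) * c') ->
  (forall n, 0 <= g n) -> (forall n, 0 <= g' n) ->
  is_series g 1 -> is_series g' 1 ->
  (forall k, B k -> is_series (fun n => g n / (lam n - nu k)) (- / c)) ->
  (forall k, B k -> is_series (fun n => g' n / (lam n - nu k)) (- / c')) ->
  (forall n, ~ B n -> g n = g' n) ->
  B m -> g m = g' m ->
  c = c' /\ forall n, g n = g' n.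
Proof.
  intros Hinj Hsep Hnu Hord Hinf Hc Hc' Hg Hg' H1 H1' Hw Hw' HA Hm Em.
  (* The couplings are compared at the base index [m], where equality of the weights is given;
     afterwards each [n] in [B] serves as its own base index. *)
  assert (E : c = c').
  { apply (couplings_equal lam nu B m) with g g'; assumption. }
  split; [exact E|]; intros n.
  destruct (classic (B n)) as [HB|HB]; [|now apply HA].
  apply (weights_equal lam nu B n) with c c'; assumption.
Qed.

(** * Recovering the coefficients *)

Lemma pol_recurrence (a b : nat -> R) (z : R) (n : nat) :
  (forall n, 0 < b n) -> rtau a b (pol a b z) n = z * pol a b z n.
Proof.
  intros Hb; pose proof (pol_solution a b z n Hb) as H; unfold shifted in H; lra.
Qed.

Lemma pol_local (a b a' b' : nat -> R) (z : R) (n : nat) :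
  (forall k, (k < n)%nat -> a k = a' k /\ b k = b' k) ->
  forall k, (k <= n)%nat -> pol a b z k = pol a' b' z k.
Proof.
  intros Hn.
  assert (HH : forall k, ((k <= n)%nat -> pol a b z k = pol a' b' z k) /\
    ((S k <= n)%nat -> pol a b z (S k) = pol a' b' z (S k))).
  { intros k; induction k as [|k [IH1 IH2]].
    - split; [easy|]; intros Hk; simpl.
      destruct (Hn O) as [-> ->]; [lia|reflexivity].
    - split; [exact IH2|]; intros Hk.
      change (((z - a (S k)) * pol a b z (S k) - b k * pol a b z k) / b (S k)
        = ((z - a' (S k)) * pol a' b' z (S k) - b' k * pol a' b' z k) / b' (S k)).
      rewrite IH1, IH2 by lia.
      destruct (Hn k) as [_ ->]; [lia|]; destruct (Hn (S k)) as [-> ->]; [lia|].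
      reflexivity. }
  intros k; apply HH.
Qed.

(** The diagonal coefficient is the first moment of the square of the [n]-th orthonormal polynomial:
    the recurrence turns multiplication by [lam i] into a combination of orthonormality
    relations. *)
Lemma diagonal_coefficient (a b lam g : nat -> R) (n : nat) :
  (forall n, 0 < b n) ->
  (forall j k, is_series (fun i => g i * pol a b (lam i) j * pol a b (lam i) k)
     (unit_at j k)) ->
  is_series (fun i => g i * pol a b (lam i) n * (lam i * pol a b (lam i) n)) (a n).
Proof.
  intros Hb Ho.
  replace (a n) with (rtau a b (unit_at n) n).
  2:{ destruct n as [|n]; unfold rtau, unit_at.
      - simpl; ring.
      - rewrite (proj2 (Nat.eqb_neq n (S n))), Nat.eqb_refl,
          (proj2 (Nat.eqb_neq (S (S n)) (S n))) by lia; ring. }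
  apply is_series_ext_R with
    (fun i => g i * pol a b (lam i) n * rtau a b (pol a b (lam i)) n).
  { intros i; now rewrite pol_recurrence. }
  destruct n as [|n]; unfold rtau.
  - eapply is_series_ext_R; [|apply (is_series_lin _ _ (a O) (b O) _ _ (Ho O O) (Ho O 1%nat))].
    intros i; simpl; ring.
  - replace (_ + _ + _) with
      (1 * (b n * unit_at (S n) n + a (S n) * unit_at (S n) (S n))
       + b (S n) * unit_at (S n) (S (S n))) by ring.
    eapply is_series_ext_R; [|apply is_series_lin;
      [apply is_series_lin; [apply (Ho (S n) n)|apply (Ho (S n) (S n))]
      |apply (Ho (S n) (S (S n)))]].
    intros i; simpl; ring.
Qed.

(** Strong induction: the polynomials up to degree [n] agree, so [diagonal_coefficient] gives [a n],
    and the normalization of the next polynomial gives [b n]. *)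
Lemma coefficients_unique (a b a' b' lam g : nat -> R) :
  (forall n, 0 < b n) -> (forall n, 0 < b' n) ->
  (forall j k, is_series (fun i => g i * pol a b (lam i) j * pol a b (lam i) k)
     (unit_at j k)) ->
  (forall j k, is_series (fun i => g i * pol a' b' (lam i) j * pol a' b' (lam i) k)
     (unit_at j k)) ->
  forall n, a n = a' n /\ b n = b' n.
Proof.
  intros Hb Hb' Ho Ho' n.
  induction n as [n IH] using (well_founded_induction Wf_nat.lt_wf).
  assert (Hp : forall z k, (k <= n)%nat -> pol a b z k = pol a' b' z k)
    by (intros z; now apply pol_local).
  assert (Ha : a n = a' n).
  { rewrite <- (is_series_unique _ _ (diagonal_coefficient a b lam g n Hb Ho)).
    rewrite <- (is_series_unique _ _ (diagonal_coefficient a' b' lam g n Hb' Ho')).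
    apply Series_ext; intros i; now rewrite (Hp (lam i) n) by lia. }
  split; [exact Ha|].
  (* The recurrence expresses this product through quantities already known to agree. *)
  assert (Hy : forall z, b n * pol a b z (S n) = b' n * pol a' b' z (S n)).
  { intros z.
    pose proof (pol_recurrence a b z n Hb) as E.
    pose proof (pol_recurrence a' b' z n Hb') as E'.
    destruct n as [|k]; unfold rtau in E, E'.
    - rewrite <- (Hp z O), <- Ha in E' by lia; lra.
    - rewrite <- (Hp z (S k)), <- (Hp z k), <- Ha in E' by lia.
      destruct (IH k) as [_ Hk]; [lia|]; rewrite <- Hk in E'; lra. }
  (* The next polynomial has norm 1, so the squared norm of the product is [b n * b n]; positivity
     then selects the root. *)
  assert (Hsq : forall a b, (forall j k, is_series
      (fun i => g i * pol a b (lam i) j * pol a b (lam i) k) (unit_at j k)) ->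
    Series (fun i => g i * (b n * pol a b (lam i) (S n)) * (b n * pol a b (lam i) (S n)))
    = b n * b n).
  { intros a1 b1 H1.
    rewrite (Series_ext _ (fun i => (b1 n * b1 n)
      * (g i * pol a1 b1 (lam i) (S n) * pol a1 b1 (lam i) (S n)))) by (intros; ring).
    rewrite Series_scal_l, (is_series_unique _ _ (H1 (S n) (S n))).
    unfold unit_at; rewrite Nat.eqb_refl; ring. }
  pose proof (Hsq a b Ho) as E; pose proof (Hsq a' b' Ho') as E'.
  rewrite (Series_ext _ (fun i =>
    g i * (b' n * pol a' b' (lam i) (S n)) * (b' n * pol a' b' (lam i) (S n)))), E' in E.
  2:{ intros i; now rewrite Hy. }
  specialize (Hb n); specialize (Hb' n); nra.
Qed.

(** * The closure of the minimal operator *)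

Fixpoint particular_solution (a b : nat -> R) (z : R) (x : nat -> R) (n : nat) : R :=
  match n with
  | O => 0
  | S m =>
      match m with
      | O => x O / b O
      | S k => (x m + (z - a m) * particular_solution a b z x m
                - b k * particular_solution a b z x k) / b m
      end
  end.

Lemma particular_solution_spec (a b : nat -> R) (z : R) (x : nat -> R) (n : nat) :
  (forall n, 0 < b n) -> shifted a b z (particular_solution a b z x) n = x n.
Proof.
  intros Hb; destruct n as [|n]; unfold shifted, rtau.
  - simpl; field. specialize (Hb O); lra.
  - change (particular_solution a b z x (S (S n))) with
      ((x (S n) + (z - a (S n)) * particular_solution a b z x (S n)
        - b n * particular_solution a b z x n) / b (S n)).
    field. specialize (Hb (S n)); lra.
Qed.

Lemma not_sqs_unbounded (p : nat -> R) (B : R) :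
  ~ sqs p -> exists M, B < dot (trunc M p) (trunc M p).
Proof.
  intros Hp; apply NNPP; intros Hn; apply Hp.
  assert (E : forall n, dot (trunc (S n) p) (trunc (S n) p)
    = sum_n (fun k => p k * p k) n).
  { intros n; unfold dot.
    rewrite (is_series_unique _ _
      (is_series_finite (fun k => trunc (S n) p k * trunc (S n) p k) n
        ltac:(intros k Hk; unfold trunc; destruct (Nat.ltb_spec k (S n)); [lia|ring]))).
    apply sum_n_ext_loc; intros k Hk; unfold trunc.
    destruct (Nat.ltb_spec k (S n)); [reflexivity|lia]. }
  destruct (ex_finite_lim_seq_incr (sum_n (fun k => p k * p k)) B) as [l Hl].
  - intros n; rewrite sum_n_S; nra.
  - intros n; rewrite <- E.
    destruct (Rle_lt_dec (dot (trunc (S n) p) (trunc (S n) p)) B) as [L|L]; [exact L|].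
    exfalso; apply Hn; now exists (S n).
  - exists l; exact Hl.
Qed.

(* A finitely supported [x] orthogonal to [pol a b z] is hit by a finitely
   supported sequence: by Green's formula any solution of the inhomogeneous
   equation is eventually a multiple of [pol a b z]. *)
Lemma finsupp_preimage (a b : nat -> R) (z : R) (x : nat -> R) :
  (forall n, 0 < b n) -> ~ sqs (pol a b z) -> finsupp x -> dot x (pol a b z) = 0 ->
  exists f, finsupp f /\ shifted a b z f = x.
Proof.
  intros Hb Hp [N HN] Hx.
  set (p := pol a b z) in *; set (f := particular_solution a b z x).
  assert (Hf : shifted a b z f = x).
  { apply functional_extensionality; intros; now apply particular_solution_spec. }
  (* By Green's formula this Wronskian is, up to the factor [b N], the product of [x] with [p],
     which is 0. *)
  assert (HW : f (S N) * p N - f N * p (S N) = 0).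
  { apply Rmult_eq_reg_l with (b N); [|specialize (Hb N); lra].
    rewrite <- (green a b f p z N), Rmult_0_r, <- Hx.
    symmetry; apply is_series_unique.
    rewrite Hf.
    replace (sum_n (fun k => x k * p k - f k * shifted a b z p k) N)
      with (sum_n (fun k => x k * p k) N).
    - apply is_series_finite; intros n Hn; rewrite HN by lia; ring.
    - apply sum_n_ext; intros k; unfold p; rewrite pol_solution by exact Hb; simpl; ring. }
  (* Two consecutive zeros would make [p] finitely supported, hence square-summable. *)
  assert (Hpn : ~ (p N = 0 /\ p (S N) = 0)).
  { intros [E1 E2]; apply Hp, sqs_finsupp; exists N.
    apply (tail_solution_unique a b p (fun _ => 0) z N); auto.
    intros n Hn; unfold p; rewrite pol_solution by exact Hb.
    destruct n; unfold shifted, rtau; ring. }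
  assert (Ht : exists t, f N = t * p N /\ f (S N) = t * p (S N)).
  { destruct (Req_dec (p N) 0) as [E|E].
    - assert (E' : p (S N) <> 0) by tauto.
      exists (f (S N) / p (S N)); rewrite E in *; split; [|field; exact E'].
      rewrite Rmult_0_r. apply Rmult_eq_reg_r with (p (S N)); [lra|exact E'].
    - exists (f N / p N); split; [field; exact E|].
      apply Rmult_eq_reg_r with (p N); [|exact E].
      replace (f N / p N * p (S N) * p N) with (f N * p (S N)) by (field; exact E).
      lra. }
  destruct Ht as (t & E1 & E2).
  exists (lc 1 f (- t) p); split.
  - exists N; intros n Hn; unfold lc.
    enough (E : f n = lc 0 p t p n) by (rewrite E; unfold lc; ring).
    revert n Hn; apply (tail_solution_unique a b f (lc 0 p t p) z N Hb).
    + intros n Hn; rewrite Hf, HN, shifted_lc by lia; unfold lc, p.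
      rewrite pol_solution by exact Hb; ring.
    + rewrite E1; unfold lc; ring.
    + rewrite E2; unfold lc; ring.
  - rewrite shifted_lc, Hf; apply functional_extensionality; intros n; unfold lc, p.
    rewrite pol_solution by exact Hb; ring.
Qed.

Lemma dot_finsupp (x y : nat -> R) (N : nat) :
  (forall n, (N <= n)%nat -> x n = 0) -> dot x y = dot x (trunc N y).
Proof.
  intros H; apply Series_ext; intros n; unfold trunc.
  destruct (Nat.ltb_spec n N); [ring|rewrite H by lia; ring].
Qed.

(** The truncation of [x] is made orthogonal to [p] by subtracting a multiple of a truncation [q] of
    [p]. The correction has norm [Rabs s / nrm q], which is small because [p] is not
    square-summable. *)
Lemma range_dense (a b : nat -> R) (z : R) (x : nat -> R) (eps : R) :
  (forall n, 0 < b n) -> ~ sqs (pol a b z) -> sqs x -> 0 < eps ->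
  exists f, finsupp f /\ nrm (lc 1 x (-1) (shifted a b z f)) < eps.
Proof.
  intros Hb Hp Hx He.
  set (p := pol a b z) in *.
  destruct (nrm_trunc x (eps / 2) Hx ltac:(lra)) as [N HN].
  set (y := trunc N x) in *.
  assert (Hy : forall n, (N <= n)%nat -> y n = 0).
  { intros n Hn; unfold y, trunc; destruct (Nat.ltb_spec n N); [lia|easy]. }
  assert (Hys : finsupp y) by now exists N.
  set (s := dot y p).
  (* This makes [nrm q] exceed [Rabs (2 * s / eps)], so the correction stays below [eps / 2]. *)
  destruct (not_sqs_unbounded p ((2 * s / eps) * (2 * s / eps)) Hp) as [M HM].
  set (q := trunc M p) in *; set (Q := dot q q) in *.
  assert (Hqs : finsupp q) by apply finsupp_trunc.
  assert (HQ : 0 < Q) by nra.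
  assert (Hqp : dot q p = Q).
  { unfold Q, q; apply dot_finsupp.
    intros n Hn; unfold trunc; destruct (Nat.ltb_spec n M); [lia|easy]. }
  set (y' := lc 1 y (- (s / Q)) q).
  assert (Hyp : dot y' p = 0).
  { set (K := max N M).
    assert (Hcut : forall v, (forall n, (K <= n)%nat -> v n = 0) ->
      dot v p = dot v (trunc K p)) by (intros v; apply dot_finsupp).
    assert (HqK : forall n, (K <= n)%nat -> q n = 0).
    { intros n Hn; unfold q, trunc; destruct (Nat.ltb_spec n M); [lia|easy]. }
    assert (HyK : forall n, (K <= n)%nat -> y n = 0) by (intros; apply Hy; lia).
    rewrite Hcut.
    2:{ intros n Hn; unfold y', lc; rewrite HqK, HyK by exact Hn; ring. }
    unfold y'; rewrite dot_lc_l by auto using sqs_finsupp, finsupp_trunc.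
    rewrite <- !Hcut by assumption. fold s; rewrite Hqp; field; lra. }
  destruct (finsupp_preimage a b z y') as (f & Hf & Hfy); auto.
  { now apply finsupp_lc. }
  exists f; split; [exact Hf|]; rewrite Hfy.
  replace (lc 1 x (-1) y') with (lc 1 (lc 1 x (-1) y) (s / Q) q)
    by (apply functional_extensionality; intros; unfold y', lc; ring).
  eapply Rle_lt_trans; [apply nrm_lc_le; auto using sqs_lc, sqs_finsupp|].
  rewrite Rabs_R1.
  enough (Rabs (s / Q) * nrm q < eps / 2) by lra.
  assert (Hnq : nrm q * nrm q = Q) by (apply nrm_sq; auto using sqs_finsupp).
  pose proof (nrm_ge0 q).
  assert (Hnq0 : 0 < nrm q) by nra.
  assert (Hlt : Rabs (2 * s / eps) < nrm q).
  { apply Rnot_le_lt; intros L.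
    assert (nrm q * nrm q <= Rabs (2 * s / eps) * Rabs (2 * s / eps)) by nra.
    rewrite <- Rabs_mult, Rabs_pos_eq in H0 by nra. lra. }
  replace (Rabs (s / Q) * nrm q) with (eps / 2 * (Rabs (2 * s / eps) / nrm q)).
  - assert (Rabs (2 * s / eps) / nrm q < 1).
    { apply Rmult_lt_reg_r with (nrm q); [exact Hnq0|].
      unfold Rdiv at 1; rewrite Rmult_assoc, Rinv_l by lra; lra. }
    nra.
  - unfold Rdiv; rewrite !Rabs_mult, !Rabs_inv, (Rabs_pos_eq eps), (Rabs_pos_eq Q),
      (Rabs_pos_eq 2) by lra.
    rewrite <- Hnq; field; lra.
Qed.

Definition rclos (a b : nat -> R) (f w : nat -> R) : Prop :=
  sqs f /\ sqs w /\ forall eps, 0 < eps -> exists f', finsupp f' /\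
    nrm (lc 1 f (-1) f') < eps /\ nrm (lc 1 w (-1) (rtau a b f')) < eps.

Lemma rclos_lc (a b f w f' w' : nat -> R) (s t : R) :
  rclos a b f w -> rclos a b f' w' -> rclos a b (lc s f t f') (lc s w t w').
Proof.
  intros (Hf & Hw & Hc) (Hf' & Hw' & Hc').
  split; [now apply sqs_lc|split; [now apply sqs_lc|]].
  intros eps He.
  pose proof (Rabs_pos s); pose proof (Rabs_pos t).
  set (e := eps / (Rabs s + Rabs t + 1)).
  assert (He0 : 0 < e) by (apply Rdiv_lt_0_compat; lra).
  destruct (Hc e He0) as (k & Hk & Hk1 & Hk2).
  destruct (Hc' e He0) as (k' & Hk' & Hk1' & Hk2').
  assert (Ee : (Rabs s + Rabs t) * e < eps).
  { replace eps with ((Rabs s + Rabs t + 1) * e) by (unfold e; field; lra). nra. }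
  exists (lc s k t k'); split; [now apply finsupp_lc|].
  rewrite rtau_lc; split.
  - replace (lc 1 (lc s f t f') (-1) (lc s k t k'))
      with (lc s (lc 1 f (-1) k) t (lc 1 f' (-1) k'))
      by (apply functional_extensionality; intros; unfold lc; ring).
    eapply Rle_lt_trans; [apply nrm_lc_le; auto using sqs_lc, sqs_finsupp|]. nra.
  - replace (lc 1 (lc s w t w') (-1) (lc s (rtau a b k) t (rtau a b k')))
      with (lc s (lc 1 w (-1) (rtau a b k)) t (lc 1 w' (-1) (rtau a b k')))
      by (apply functional_extensionality; intros; unfold lc; ring).
    eapply Rle_lt_trans; [apply nrm_lc_le; auto using sqs_lc, sqs_finsupp, finsupp_rtau|].
    nra.
Qed.

Lemma rclos_finsupp (a b f : nat -> R) : finsupp f -> rclos a b f (rtau a b f).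
Proof.
  intros Hf; split; [now apply sqs_finsupp|split].
  { now apply sqs_finsupp, finsupp_rtau. }
  intros eps He; exists f; split; [exact Hf|].
  assert (E : forall g : nat -> R, lc 1 g (-1) g = fun n => 0 * g n)
    by (intros; apply functional_extensionality; intros; unfold lc; ring).
  rewrite !E, !nrm_scal, Rabs_R0; lra.
Qed.

(** Norm convergence implies convergence of each coordinate, and [rtau] involves at most three
    neighbouring coordinates. *)
Lemma rclos_rtau (a b f w : nat -> R) : rclos a b f w -> w = rtau a b f.
Proof.
  intros (Hf & Hw & Hc); apply functional_extensionality; intros n.
  enough (Rabs (w n - rtau a b f n) <= 0).
  { destruct (Req_dec (w n - rtau a b f n) 0) as [E|E]; [lra|].
    apply Rabs_pos_lt in E; lra. }
  (* At [n = 0] the term with [pred n] only enlarges the constant, since the first row has no left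
     neighbour. *)
  apply Rle_of_eps with (1 + Rabs (b (pred n)) + Rabs (a n) + Rabs (b n)) 1; [lra|].
  intros eps [He _]; destruct (Hc eps He) as (k & Hk & H1 & H2).
  assert (Hd : forall m, Rabs (lc 1 f (-1) k m) <= eps).
  { intros m; apply Rlt_le, Rle_lt_trans with (2 := H1), nrm_ge_coord.
    auto using sqs_lc, sqs_finsupp. }
  assert (Hd' : Rabs (lc 1 w (-1) (rtau a b k) n) <= eps).
  { apply Rlt_le, Rle_lt_trans with (2 := H2), nrm_ge_coord.
    auto using sqs_lc, sqs_finsupp, finsupp_rtau. }
  replace (w n - rtau a b f n)
    with (lc 1 w (-1) (rtau a b k) n - rtau a b (lc 1 f (-1) k) n)
    by (rewrite rtau_lc; unfold lc; ring).
  eapply Rle_trans; [apply Rabs_triang|]; rewrite Rabs_Ropp.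
  assert (Hr : Rabs (rtau a b (lc 1 f (-1) k) n)
    <= (Rabs (b (pred n)) + Rabs (a n) + Rabs (b n)) * eps).
  { assert (Hm : forall x m, Rabs (x * lc 1 f (-1) k m) <= Rabs x * eps).
    { intros x m; rewrite Rabs_mult; apply Rmult_le_compat_l; [apply Rabs_pos|apply Hd]. }
    pose proof (Rabs_pos (b (pred n))).
    destruct n as [|n]; unfold rtau; simpl pred in *.
    - eapply Rle_trans; [apply Rabs_triang|].
      pose proof (Hm (a O) O); pose proof (Hm (b O) 1%nat). nra.
    - eapply Rle_trans; [apply Rabs_triang|].
      eapply Rle_trans; [apply Rplus_le_compat_r, Rabs_triang|].
      pose proof (Hm (b n) n); pose proof (Hm (a (S n)) (S n));
        pose proof (Hm (b (S n)) (S (S n))). nra. }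
  lra.
Qed.

Lemma rtau_bump (a b f : nat -> R) (c : R) :
  rtau (bump c a) b f = lc 1 (rtau a b f) (c * f O) unit0.
Proof.
  apply functional_extensionality; intros [|n]; unfold rtau, lc, bump, unit0; ring.
Qed.

Lemma nrm_unit0 : nrm unit0 = 1.
Proof.
  unfold nrm; rewrite unit0_at, dot_unit_at; unfold unit_at; simpl; apply sqrt_1.
Qed.

(** The assumption that the solution at one real regular point is not square-summable leads to the
    limit point case: the closure of the minimal operator is then the maximal one and symmetric. *)
Section NoSolution.
Context (a b : nat -> R) (h z : R) (D : (nat -> R) -> Prop).
Context (Hb : forall n, 0 < b n) (HD : jacobi_domain a b D)
  (HR : regular (bump h a) b D z) (Hp : ~ sqs (pol (bump h a) b z)).

Lemma sqs_shifted_bump (f : nat -> R) :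
  sqs f -> sqs (rtau a b f) -> sqs (shifted (bump h a) b z f).
Proof.
  intros Hf Hw; rewrite shifted_bump, shifted_lc_eq.
  apply sqs_lc; [now apply sqs_lc|apply sqs_finsupp, finsupp_unit0].
Qed.

(** The resolvent provides an element of [D] with the same image. Its difference from [f] is a
    square-summable multiple of the solution, hence 0. *)
Lemma maximal_domain (f : nat -> R) : sqs f -> sqs (rtau a b f) -> D f.
Proof.
  intros Hf Hw.
  destruct (proj1 HR _ (sqs_shifted_bump f Hf Hw)) as (y & Hy & Hyf).
  assert (Hk : forall n, lc 1 f (-1) y n
    = lc 1 f (-1) y O * pol (bump h a) b z n).
  { apply (solution_is_pol _ _ _ z Hb); intros n.
    rewrite shifted_lc; unfold lc; rewrite Hyf; ring. }
  assert (Hys := sqs_dom _ _ _ _ HD Hy).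
  set (t := lc 1 f (-1) y O) in *.
  destruct (Req_dec t 0) as [E|E].
  - replace f with y; [exact Hy|].
    apply functional_extensionality; intros n; specialize (Hk n).
    rewrite E in Hk; unfold lc in Hk; lra.
  - exfalso; apply Hp.
    replace (pol (bump h a) b z) with (lc (/ t) (lc 1 f (-1) y) 0 y).
    + apply sqs_lc; auto using sqs_lc.
    + apply functional_extensionality; intros n; unfold lc at 1; rewrite Hk.
      field; exact E.
Qed.

(** The image of [f] is approximated by images of finitely supported sequences; the resolvent bound
    then controls both components of the graph. *)
Lemma rclos_maximal (f : nat -> R) :
  sqs f -> sqs (rtau a b f) -> rclos a b f (rtau a b f).
Proof.
  intros Hf Hw; split; [exact Hf|split; [exact Hw|]]; intros eps He.
  destruct (regular_bound _ _ _ _ HR) as (K & K0 & HK).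
  pose proof (Rabs_pos h); pose proof (Rabs_pos z).
  (* The constant collects the costs of recovering [d], the shift by [z] and the perturbation by [h]
     from the image. *)
  set (B := 1 + K + Rabs z * K + Rabs h * K).
  assert (HB : 1 <= B) by (unfold B; nra).
  assert (He' : 0 < eps / B) by (apply Rdiv_lt_0_compat; lra).
  destruct (range_dense (bump h a) b z _ _ Hb Hp (sqs_shifted_bump f Hf Hw) He')
    as (k & Hk & Hlt).
  rewrite <- shifted_lc in Hlt.
  set (d := lc 1 f (-1) k) in *.
  assert (Hd : D d).
  { apply (proj1 (proj2 HD)); [now apply maximal_domain|now apply HD]. }
  pose proof (HK d Hd) as Hn.
  set (x := shifted (bump h a) b z d) in *.
  assert (Hs : sqs d) by eauto using sqs_dom.
  assert (Hx : sqs x) by (eapply sqs_shifted; [apply jacobi_domain_bump, HD|exact Hd]).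
  assert (Hdn : nrm d <= K * (eps / B)) by nra.
  exists k; split; [exact Hk|split].
  - fold d. apply Rle_lt_trans with (1 := Hdn).
    replace eps with (B * (eps / B)) at 2 by (field; lra).
    apply Rmult_lt_compat_r; [exact He'|unfold B; nra].
  - rewrite <- rtau_lc; fold d.
    replace (rtau a b d) with (lc 1 (lc 1 x z d) (- h * d O) unit0).
    2:{ apply functional_extensionality; intros n; unfold x.
        rewrite shifted_bump; unfold lc, shifted; ring. }
    assert (Hu : sqs unit0) by apply sqs_finsupp, finsupp_unit0.
    eapply Rle_lt_trans; [apply nrm_lc_le; auto using sqs_lc|].
    rewrite nrm_unit0, Rabs_R1, Rabs_mult, Rabs_Ropp.
    pose proof (nrm_lc_le x d 1 z Hx Hs) as E; rewrite Rabs_R1 in E.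
    pose proof (nrm_ge_coord d O Hs).
    replace eps with (B * (eps / B)) by (field; lra).
    assert (Rabs h * Rabs (d O) <= Rabs h * (K * (eps / B)))
      by (apply Rmult_le_compat_l; lra).
    assert (Rabs z * nrm d <= Rabs z * (K * (eps / B)))
      by (apply Rmult_le_compat_l; lra).
    unfold B in *; nra.
Qed.

Lemma symmetric_maximal (f g : nat -> R) :
  sqs f -> sqs (rtau a b f) -> sqs g -> sqs (rtau a b g) ->
  dot (rtau a b f) g = dot f (rtau a b g).
Proof.
  intros Hf Hf' Hg Hg'.
  assert (Hu : sqs unit0) by apply sqs_finsupp, finsupp_unit0.
  pose proof (symmetric _ _ _ _ f g Hb (jacobi_domain_bump _ _ _ h HD) HR
    (maximal_domain f Hf Hf') (maximal_domain g Hg Hg')) as E.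
  rewrite !rtau_bump, dot_lc_l, dot_lc_r, (dot_comm f unit0), !unit0_at, !dot_unit_at
    in E by (try rewrite <- unit0_at; assumption).
  lra.
Qed.
End NoSolution.

(** * Complex operators and real sequences *)

Definition re (f : cseq) : nat -> R := fun n => Re (f n).
Definition im (f : cseq) : nat -> R := fun n => Im (f n).
Definition cplx (f g : nat -> R) : cseq := fun n => (f n, g n).

Lemma Cmod_pow2 (z : C) : Cmod z ^ 2 = Re z * Re z + Im z * Im z.
Proof.
  unfold Cmod; rewrite <- Rsqr_pow2, Rsqr_sqrt.
  - unfold Re, Im; ring.
  - nra.
Qed.

Lemma l2_iff (f : cseq) : l2 f <-> sqs (re f) /\ sqs (im f).
Proof.
  split.
  - intros H; split; apply ex_series_dom with (2 := H); intros n;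
      rewrite Cmod_pow2, Rabs_pos_eq; unfold re, im; nra.
  - intros [H1 H2].
    apply ex_series_ext_R with
      (fun n => 1 * (re f n * re f n) + 1 * (im f n * im f n)).
    + intros n; rewrite Cmod_pow2; unfold re, im; ring.
    + now apply ex_series_lin.
Qed.

Lemma norm2_eq (f : cseq) :
  sqs (re f) -> sqs (im f) -> norm2 f = dot (re f) (re f) + dot (im f) (im f).
Proof.
  intros H1 H2; unfold norm2.
  rewrite (Series_ext _ (fun n => 1 * (re f n * re f n) + 1 * (im f n * im f n))).
  - rewrite Series_lin by assumption; unfold dot; ring.
  - intros n; rewrite Cmod_pow2; unfold re, im; ring.
Qed.

Lemma l2norm_sq (f : cseq) : sqs (re f) -> sqs (im f) ->
  l2norm f * l2norm f = nrm (re f) * nrm (re f) + nrm (im f) * nrm (im f).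
Proof.
  intros H1 H2; unfold l2norm; rewrite sqrt_sqrt; rewrite norm2_eq by assumption.
  - now rewrite !nrm_sq.
  - pose proof (dot_ge0 _ H1); pose proof (dot_ge0 _ H2); lra.
Qed.

Lemma l2norm_ge0 (f : cseq) : 0 <= l2norm f.
Proof. apply sqrt_pos. Qed.

Lemma nrm_re_le (f : cseq) : sqs (re f) -> sqs (im f) -> nrm (re f) <= l2norm f.
Proof.
  intros H1 H2; apply le_of_sq; [apply l2norm_ge0|].
  rewrite l2norm_sq by assumption; nra.
Qed.

Lemma nrm_im_le (f : cseq) : sqs (re f) -> sqs (im f) -> nrm (im f) <= l2norm f.
Proof.
  intros H1 H2; apply le_of_sq; [apply l2norm_ge0|].
  rewrite l2norm_sq by assumption; nra.
Qed.

Lemma l2norm_le (f : cseq) : sqs (re f) -> sqs (im f) ->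
  l2norm f <= nrm (re f) + nrm (im f).
Proof.
  intros H1 H2; pose proof (nrm_ge0 (re f)); pose proof (nrm_ge0 (im f)).
  apply le_of_sq; [lra|]; rewrite l2norm_sq by assumption; nra.
Qed.

Lemma re_tau (a b : nat -> R) (f : cseq) : re (tau a b f) = rtau a b (re f).
Proof.
  apply functional_extensionality; intros [|n]; unfold re, Re, tau, rtau; simpl; ring.
Qed.

Lemma im_tau (a b : nat -> R) (f : cseq) : im (tau a b f) = rtau a b (im f).
Proof.
  apply functional_extensionality; intros [|n]; unfold im, Im, tau, rtau; simpl; ring.
Qed.

Lemma C_eq (z w : C) : Re z = Re w -> Im z = Im w -> z = w.
Proof. destruct z, w; simpl; now intros -> ->. Qed.

Lemma cseq_eq (f g : cseq) : re f = re g -> im f = im g -> f = g.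
Proof.
  intros H1 H2; apply functional_extensionality; intros n; apply C_eq.
  - exact (f_equal (fun h => h n) H1).
  - exact (f_equal (fun h => h n) H2).
Qed.

Lemma finitely_supported_iff (f : cseq) :
  finitely_supported f <-> finsupp (re f) /\ finsupp (im f).
Proof.
  split.
  - intros [N HN]; split; exists N; intros n Hn; unfold re, im; now rewrite HN.
  - intros [[N HN] [M HM]]; exists (max N M); intros n Hn.
    apply C_eq; [apply HN|apply HM]; lia.
Qed.

Lemma re_minus (f g : cseq) : re (fun n => (f n - g n)%C) = lc 1 (re f) (-1) (re g).
Proof. apply functional_extensionality; intros n; unfold re, Re, lc; simpl; ring. Qed.

Lemma im_minus (f g : cseq) : im (fun n => (f n - g n)%C) = lc 1 (im f) (-1) (im g).
Proof. apply functional_extensionality; intros n; unfold im, Im, lc; simpl; ring. Qed.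

Lemma closure_iff (a b : nat -> R) (f w : cseq) :
  closure (Jmin a b) f w <-> rclos a b (re f) (re w) /\ rclos a b (im f) (im w).
Proof.
  split.
  - intros (Hf & Hw & Hc); apply l2_iff in Hf, Hw.
    destruct Hf as [Hf1 Hf2], Hw as [Hw1 Hw2].
    assert (HH : forall eps, 0 < eps -> exists k,
      (finsupp (re k) /\ finsupp (im k)) /\
      (nrm (lc 1 (re f) (-1) (re k)) < eps /\ nrm (lc 1 (im f) (-1) (im k)) < eps) /\
      (nrm (lc 1 (re w) (-1) (rtau a b (re k))) < eps /\
       nrm (lc 1 (im w) (-1) (rtau a b (im k))) < eps)).
    { intros eps He; destruct (Hc eps He) as (k & v & [Hk Hv] & H1 & H2).
      apply functional_extensionality in Hv; subst v.
      apply finitely_supported_iff in Hk; destruct Hk as [Hk1 Hk2].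
      exists k; split; [now split|].
      rewrite <- re_tau, <- im_tau, <- !re_minus, <- !im_minus.
      assert (S1 : sqs (re (fun n => (f n - k n)%C)))
        by (rewrite re_minus; auto using sqs_lc, sqs_finsupp).
      assert (S2 : sqs (im (fun n => (f n - k n)%C)))
        by (rewrite im_minus; auto using sqs_lc, sqs_finsupp).
      assert (S3 : sqs (re (fun n => (w n - tau a b k n)%C)))
        by (rewrite re_minus, re_tau; auto using sqs_lc, sqs_finsupp, finsupp_rtau).
      assert (S4 : sqs (im (fun n => (w n - tau a b k n)%C)))
        by (rewrite im_minus, im_tau; auto using sqs_lc, sqs_finsupp, finsupp_rtau).
      repeat split.
      - now apply Rle_lt_trans with (2 := H1), nrm_re_le.
      - now apply Rle_lt_trans with (2 := H1), nrm_im_le.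
      - now apply Rle_lt_trans with (2 := H2), nrm_re_le.
      - now apply Rle_lt_trans with (2 := H2), nrm_im_le. }
    split; (split; [assumption|split; [assumption|]]); intros eps He;
      destruct (HH eps He) as (k & [K1 K2] & [K3 K4] & [K5 K6]);
      [exists (re k)|exists (im k)]; auto.
  - intros [(Hf1 & Hw1 & Hc1) (Hf2 & Hw2 & Hc2)].
    split; [now apply l2_iff|split; [now apply l2_iff|]]; intros eps He.
    destruct (Hc1 (eps / 2) ltac:(lra)) as (k1 & K1 & L1 & M1).
    destruct (Hc2 (eps / 2) ltac:(lra)) as (k2 & K2 & L2 & M2).
    exists (cplx k1 k2), (tau a b (cplx k1 k2)); split; [split; [|easy]|split].
    + now apply finitely_supported_iff.
    + eapply Rle_lt_trans; [apply l2norm_le; rewrite ?re_minus, ?im_minus|].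
      * apply sqs_lc; [assumption|now apply sqs_finsupp].
      * apply sqs_lc; [assumption|now apply sqs_finsupp].
      * rewrite re_minus, im_minus.
        change (re (cplx k1 k2)) with k1; change (im (cplx k1 k2)) with k2; lra.
    + eapply Rle_lt_trans; [apply l2norm_le; rewrite ?re_minus, ?im_minus, ?re_tau, ?im_tau|].
      * apply sqs_lc; [assumption|now apply sqs_finsupp, finsupp_rtau].
      * apply sqs_lc; [assumption|now apply sqs_finsupp, finsupp_rtau].
      * rewrite re_minus, im_minus, re_tau, im_tau.
        change (re (cplx k1 k2)) with k1; change (im (cplx k1 k2)) with k2; lra.
Qed.

Lemma C_lim_0 (u : nat -> C) :
  filterlim u eventually (locally (RtoC 0)) <->
  is_lim_seq (fun n => Re (u n)) 0 /\ is_lim_seq (fun n => Im (u n)) 0.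
Proof.
  split.
  - intros H; rewrite filterlim_locally in H.
    split; apply is_lim_seq_spec; intros eps; destruct (H eps) as [N HN];
      exists N; intros n Hn; destruct (HN n Hn) as [H1 H2]; assumption.
  - intros [H1 H2]; apply is_lim_seq_spec in H1, H2.
    apply filterlim_locally; intros eps.
    destruct (H1 eps) as [N HN], (H2 eps) as [M HM].
    exists (max N M); intros n Hn; split; [apply HN|apply HM]; lia.
Qed.

(** * Boundary conditions at infinity and the domain of the operator in real terms *)

Definition rv (a b : nat -> R) (alpha : R) : nat -> R :=
  fun n => cos alpha * c0 a b n + sin alpha * s0 a b n.

Definition wronskian (b f k : nat -> R) : nat -> R :=
  fun n => b n * (f n * k (S n) - k n * f (S n)).

Lemma W_lim_iff (a b : nat -> R) (alpha : R) (f : cseq) :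
  filterlim (W b (v_alpha a b alpha) f) eventually (locally (RtoC 0)) <->
  is_lim_seq (wronskian b (rv a b alpha) (re f)) 0 /\
  is_lim_seq (wronskian b (rv a b alpha) (im f)) 0.
Proof.
  rewrite C_lim_0.
  assert (E1 : forall n, Re (W b (v_alpha a b alpha) f n)
    = wronskian b (rv a b alpha) (re f) n).
  { intros n; unfold W, v_alpha, wronskian, rv, re, Re; simpl; ring. }
  assert (E2 : forall n, Im (W b (v_alpha a b alpha) f n)
    = wronskian b (rv a b alpha) (im f) n).
  { intros n; unfold W, v_alpha, wronskian, rv, im, Im; simpl; ring. }
  split; intros [H1 H2]; split.
  - apply is_lim_seq_ext with (1 := E1), H1.
  - apply is_lim_seq_ext with (1 := E2), H2.
  - apply is_lim_seq_ext with (1 := fun n => eq_sym (E1 n)), H1.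
  - apply is_lim_seq_ext with (1 := fun n => eq_sym (E2 n)), H2.
Qed.

(** The coefficients and the boundary solution are real, so the operator acts separately on real and
    imaginary parts; this is the domain for each part, as [J_iff] shows. *)
Definition rJ (a b : nat -> R) (g : option R) (f : nat -> R) : Prop :=
  (limit_point a b /\ rclos a b f (rtau a b f)) \/
  (limit_circle a b /\ sqs f /\ sqs (rtau a b f) /\
   exists alpha, is_cot g alpha /\ is_lim_seq (wronskian b (rv a b alpha) f) 0).

Lemma sin_diff_0 (x y : R) :
  0 <= x < PI -> 0 <= y < PI -> sin (x - y) = 0 -> x = y.
Proof.
  intros Hx Hy H.
  destruct (Rtotal_order x y) as [L|[L|L]]; [|exact L|].
  - assert (Hp : 0 < sin (y - x)) by (apply sin_gt_0; lra).
    replace (y - x) with (- (x - y)) in Hp by ring; rewrite sin_neg in Hp; lra.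
  - assert (Hp : 0 < sin (x - y)) by (apply sin_gt_0; lra). lra.
Qed.

Lemma is_cot_sin_pos (x : R) : 0 <= x < PI -> x <> 0 -> 0 < sin x.
Proof. intros Hx H0; apply sin_gt_0; lra. Qed.

Lemma is_cot_inj (g : option R) (x y : R) : is_cot g x -> is_cot g y -> x = y.
Proof.
  intros [Hx Hgx] [Hy Hgy]; destruct g as [t|]; [|lra].
  destruct Hgx as [Nx Ex], Hgy as [Ny Ey].
  pose proof (is_cot_sin_pos x Hx Nx); pose proof (is_cot_sin_pos y Hy Ny).
  apply sin_diff_0; auto.
  rewrite sin_minus.
  replace (cos x) with (t * sin x) by (rewrite Ex; field; lra).
  replace (cos y) with (t * sin y) by (rewrite Ey; field; lra). ring.
Qed.

Lemma is_cot_fun (g g' : option R) (x : R) : is_cot g x -> is_cot g' x -> g = g'.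
Proof.
  intros [_ H] [_ H']; destruct g as [t|], g' as [t'|]; try tauto.
  destruct H as [_ ->], H' as [_ ->]; reflexivity.
Qed.

Lemma is_cot_exists (g : option R) : exists x, is_cot g x.
Proof.
  destruct g as [t|].
  (* The inverse cotangent of [t] with values strictly between 0 and [PI]. *)
  - exists (PI / 2 - atan t).
    pose proof (atan_bound t) as [H1 H2].
    split; [lra|split; [lra|]].
    rewrite cos_shift, sin_shift.
    rewrite <- (tan_atan t) at 1; reflexivity.
  - exists 0; split; [pose proof PI_RGT_0; lra|reflexivity].
Qed.

Lemma wronskian_lc (b f k l : nat -> R) (s t : R) (n : nat) :
  wronskian b f (lc s k t l) n = s * wronskian b f k n + t * wronskian b f l n.
Proof. unfold wronskian, lc; ring. Qed.

Lemma is_lim_seq_0_lin (x y : nat -> R) (s t : R) :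
  is_lim_seq x 0 -> is_lim_seq y 0 -> is_lim_seq (fun n => s * x n + t * y n) 0.
Proof.
  intros Hx Hy. replace 0 with (s * 0 + t * 0) by ring.
  apply is_lim_seq_plus'.
  - exact (is_lim_seq_scal_l x s 0 Hx).
  - exact (is_lim_seq_scal_l y t 0 Hy).
Qed.

Lemma rJ_domain (a b : nat -> R) (g : option R) : jacobi_domain a b (rJ a b g).
Proof.
  split; [|split].
  - intros f [[_ (H1 & H2 & _)]|(_ & H1 & H2 & _)]; now split.
  - intros f k s t [[Hp Hf]|(Hc & Hf1 & Hf2 & x & Hx & Hfx)]
      [[Hp' Hk]|(Hc' & Hk1 & Hk2 & y & Hy & Hky)]; try (exfalso; unfold limit_circle in *; tauto).
    + left; split; [exact Hp|]; rewrite rtau_lc; now apply rclos_lc.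
    + right; split; [exact Hc|]; rewrite rtau_lc.
      split; [now apply sqs_lc|split; [now apply sqs_lc|]].
      exists x; split; [exact Hx|].
      rewrite <- (is_cot_inj g x y Hx Hy) in Hky.
      eapply is_lim_seq_ext; [intros n; symmetry; apply wronskian_lc|].
      now apply is_lim_seq_0_lin.
  - intros f Hf; destruct (classic (limit_point a b)) as [Hp|Hp].
    + left; split; [exact Hp|now apply rclos_finsupp].
    + right; split; [exact Hp|].
      split; [now apply sqs_finsupp|split; [now apply sqs_finsupp, finsupp_rtau|]].
      destruct (is_cot_exists g) as [x Hx]; exists x; split; [exact Hx|].
      destruct Hf as [N HN].
      apply (is_lim_seq_ext_loc (fun _ => 0)); [|apply is_lim_seq_const].
      exists N; intros n Hn; unfold wronskian; rewrite !HN by lia; ring.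
Qed.

Lemma J_iff (a b : nat -> R) (g : option R) (f w : cseq) :
  J a b g f w <-> w = tau a b f /\ rJ a b g (re f) /\ rJ a b g (im f).
Proof.
  split.
  - intros [[Hp Hc]|(Hc & (Hf & Hw & Ht) & x & Hx & Hlim)].
    + apply closure_iff in Hc; destruct Hc as [H1 H2].
      pose proof (rclos_rtau _ _ _ _ H1) as E1; pose proof (rclos_rtau _ _ _ _ H2) as E2.
      split; [apply cseq_eq; now rewrite ?re_tau, ?im_tau|].
      rewrite E1 in H1; rewrite E2 in H2. split; left; now split.
    + apply functional_extensionality in Ht; subst w.
      apply W_lim_iff in Hlim; apply l2_iff in Hf, Hw.
      rewrite re_tau, im_tau in Hw.
      split; [reflexivity|split; right; (split; [exact Hc|]); 
        (split; [tauto|split; [tauto|]]); exists x; tauto].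
  - intros (-> & [[Hp Hf]|(Hc & Hf1 & Hf2 & x & Hx & Hfx)] &
      [[Hp' Hk]|(Hc' & Hk1 & Hk2 & y & Hy & Hky)]); try (exfalso; unfold limit_circle in *; tauto).
    + left; split; [exact Hp|]; apply closure_iff; now rewrite re_tau, im_tau.
    + right; split; [exact Hc|split].
      * split; [now apply l2_iff|split; [|easy]].
        apply l2_iff; now rewrite re_tau, im_tau.
      * exists x; split; [exact Hx|]; apply W_lim_iff.
        rewrite <- (is_cot_inj g x y Hx Hy) in Hky; now split.
Qed.

(** * Resolvent sets and norming constants in real terms *)

Lemma inner_re (f k : cseq) :
  sqs (re f) -> sqs (im f) -> sqs (re k) -> sqs (im k) ->
  Re (inner f k) = dot (re f) (re k) + dot (im f) (im k).
Proof.
  intros H1 H2 H3 H4; unfold inner; cbn [Re fst].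
  rewrite (Series_ext _ (fun n => 1 * (re f n * re k n) + 1 * (im f n * im k n))).
  - rewrite Series_lin by now apply ex_dot. unfold dot; ring.
  - intros n; unfold re, im, Re, Im; simpl; ring.
Qed.

Lemma inner_im (f k : cseq) :
  sqs (re f) -> sqs (im f) -> sqs (re k) -> sqs (im k) ->
  Im (inner f k) = dot (im f) (re k) - dot (re f) (im k).
Proof.
  intros H1 H2 H3 H4; unfold inner; cbn [Im snd].
  rewrite (Series_ext _ (fun n => 1 * (im f n * re k n) + (-1) * (re f n * im k n))).
  - rewrite Series_lin by now apply ex_dot. unfold dot; ring.
  - intros n; unfold re, im, Re, Im; simpl; ring.
Qed.

Lemma inner_e1 (f : cseq) : sqs (re f) -> sqs (im f) -> inner f e1 = f O.
Proof.
  intros H1 H2.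
  assert (E1 : re e1 = unit_at O)
    by (apply functional_extensionality; now intros [|n]).
  assert (E2 : im e1 = fun n => 0 * unit_at O n)
    by (apply functional_extensionality; intros [|n]; unfold im, Im; simpl; ring).
  assert (Hu := sqs_finsupp _ (finsupp_unit_at O)).
  assert (S2 : sqs (im e1)).
  { rewrite E2; apply sqs_finsupp; exists 1%nat; intros [|n] Hn; [lia|].
    unfold unit_at; simpl; ring. }
  apply C_eq; rewrite ?inner_re, ?inner_im by (rewrite ?E1; assumption);
    rewrite E1, E2, dot_scal_r, !(dot_comm _ (unit_at O)), !dot_unit_at;
    unfold re, im; ring.
Qed.

Lemma tau_bump (a b : nat -> R) (h : R) (f : cseq) :
  tau (bump (- h) a) b f = fun n => (tau a b f n - h * f O * e1 n)%C.
Proof.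
  apply functional_extensionality; intros [|n]; apply C_eq;
    unfold Re, Im, tau, bump, e1; simpl; ring.
Qed.

Lemma Jh_iff (a b : nat -> R) (h : R) (g : option R) (f w : cseq) :
  Jh a b h g f w <->
  w = tau (bump (- h) a) b f /\ rJ a b g (re f) /\ rJ a b g (im f).
Proof.
  rewrite tau_bump; split.
  - intros (w' & Hw' & Hw); apply J_iff in Hw'; destruct Hw' as (-> & H1 & H2).
    split; [|now split].
    apply functional_extensionality; intros n; rewrite Hw, inner_e1; [reflexivity|..];
      eapply sqs_dom; eauto using rJ_domain.
  - intros (-> & H1 & H2); exists (tau a b f); split; [now apply J_iff|].
    intros n; rewrite inner_e1; [reflexivity|..]; eapply sqs_dom; eauto using rJ_domain.
Qed.

Lemma re_shifted (a b : nat -> R) (z : R) (f : cseq) :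
  re (fun n => (tau a b f n - z * f n)%C) = shifted a b z (re f).
Proof.
  apply functional_extensionality; intros [|n]; unfold re, Re, tau, shifted, rtau;
    simpl; ring.
Qed.

Lemma im_shifted (a b : nat -> R) (z : R) (f : cseq) :
  im (fun n => (tau a b f n - z * f n)%C) = shifted a b z (im f).
Proof.
  apply functional_extensionality; intros [|n]; unfold im, Im, tau, shifted, rtau;
    simpl; ring.
Qed.

Lemma zero_seq_domain (a b : nat -> R) D :
  jacobi_domain a b D -> D (fun _ => 0).
Proof. intros HD; apply HD; now exists O. Qed.

Lemma sqs_zero : sqs (fun _ => 0).
Proof. apply sqs_finsupp; now exists O. Qed.

Lemma nrm_zero : nrm (fun _ => 0) = 0.
Proof.
  transitivity (nrm (fun n => 0 * (fun _ => 0) n)).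
  - f_equal; apply functional_extensionality; intros; ring.
  - rewrite nrm_scal, Rabs_R0; ring.
Qed.

Lemma shifted_zero (a b : nat -> R) (z : R) :
  shifted a b z (fun _ => 0) = fun _ => 0.
Proof.
  apply functional_extensionality; intros [|n]; unfold shifted, rtau; ring.
Qed.

Lemma resolvent_iff (a b : nat -> R) (h : R) (g : option R) (z : R) :
  resolvent_set (Jh a b h g) (RtoC z) <->
  regular (bump (- h) a) b (rJ a b g) z.
Proof.
  pose proof (jacobi_domain_bump _ _ _ (- h) (rJ_domain a b g)) as HD.
  split.
  - intros [H1 [K HK]]; split.
    + intros y Hy.
      destruct (H1 (cplx y (fun _ => 0))) as (x & w & Hx & Hw).
      { apply l2_iff; split; [exact Hy|exact sqs_zero]. }
      apply Jh_iff in Hx; destruct Hx as (-> & Hx & _).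
      exists (re x); split; [exact Hx|]; intros n.
      rewrite <- re_shifted; unfold re; now rewrite Hw.
    + exists K; intros f Hf.
      assert (Hs := sqs_dom _ _ _ _ HD Hf).
      assert (Hs' := sqs_shifted _ _ _ _ z HD Hf).
      assert (HJ : Jh a b h g (cplx f (fun _ => 0))
                     (tau (bump (- h) a) b (cplx f (fun _ => 0)))).
      { apply Jh_iff; split; [reflexivity|split; [exact Hf|]].
        exact (zero_seq_domain _ _ _ HD). }
      specialize (HK _ _ HJ).
      assert (E : forall k : cseq, sqs (re k) -> im k = (fun _ => 0) ->
        l2norm k = nrm (re k)).
      { intros k Hk Hi; apply Rle_antisym.
        - apply Rle_trans with (1 := l2norm_le k Hk ltac:(rewrite Hi; exact sqs_zero)).
          rewrite Hi, nrm_zero; lra.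
        - apply nrm_re_le; [exact Hk|rewrite Hi; exact sqs_zero]. }
      rewrite !E in HK.
      * rewrite re_shifted in HK; exact HK.
      * rewrite re_shifted; exact Hs'.
      * rewrite im_shifted; apply shifted_zero.
      * exact Hs.
      * reflexivity.
  - intros HR; destruct (regular_bound _ _ _ _ HR) as (K & K0 & HK); split.
    + intros y Hy; apply l2_iff in Hy; destruct Hy as [Hy1 Hy2].
      destruct (proj1 HR _ Hy1) as (f1 & Hf1 & E1).
      destruct (proj1 HR _ Hy2) as (f2 & Hf2 & E2).
      exists (cplx f1 f2), (tau (bump (- h) a) b (cplx f1 f2)); split.
      * now apply Jh_iff.
      * intros n; apply C_eq.
        -- apply (eq_trans (f_equal (fun k => k n)
             (re_shifted (bump (- h) a) b z (cplx f1 f2))) (E1 n)).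
        -- apply (eq_trans (f_equal (fun k => k n)
             (im_shifted (bump (- h) a) b z (cplx f1 f2))) (E2 n)).
    + exists K; intros x w Hx; apply Jh_iff in Hx; destruct Hx as (-> & Hx1 & Hx2).
      assert (S1 := sqs_dom _ _ _ _ HD Hx1); assert (S2 := sqs_dom _ _ _ _ HD Hx2).
      assert (S3 := sqs_shifted _ _ _ _ z HD Hx1).
      assert (S4 := sqs_shifted _ _ _ _ z HD Hx2).
      apply le_of_sq; [apply Rmult_le_pos; [lra|apply l2norm_ge0]|].
      match goal with |- _ <= ?u => replace u with
        (K * K * (l2norm (fun n => (tau (bump (- h) a) b x n - z * x n)%C)
                  * l2norm (fun n => (tau (bump (- h) a) b x n - z * x n)%C))) by ring end.
      rewrite !l2norm_sq; rewrite ?re_shifted, ?im_shifted; auto.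
      pose proof (HK _ Hx1); pose proof (HK _ Hx2).
      pose proof (nrm_ge0 (re x)); pose proof (nrm_ge0 (im x)).
      nra.
Qed.

(** The real and imaginary parts of the normalized eigenvector both solve the real recurrence; their
    first entries 1 and 0 identify them with [pol] and the zero sequence. *)
Lemma norming_constant_pol (a b : nat -> R) (h : R) (g : option R) (l gamma : R) :
  (forall n, 0 < b n) -> norming_constant (Jh a b h g) l gamma ->
  rJ a b g (pol (bump (- h) a) b l) /\
  gamma = / dot (pol (bump (- h) a) b l) (pol (bump (- h) a) b l).
Proof.
  intros Hb (u & Hu & Hu0 & Hg); apply Jh_iff in Hu; destruct Hu as (E & H1 & H2).
  set (p := pol (bump (- h) a) b l).
  assert (E0 : forall n, (tau (bump (- h) a) b u n - l * u n)%C = RtoC 0).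
  { intros n; rewrite <- E; ring. }
  assert (Er : re u = p).
  { apply functional_extensionality; intros n.
    rewrite (solution_is_pol (bump (- h) a) b (re u) l Hb).
    - unfold re at 1; rewrite Hu0; simpl; unfold p; ring.
    - intros k; rewrite <- re_shifted; unfold re; now rewrite E0. }
  assert (Ei : im u = fun _ => 0).
  { apply functional_extensionality; intros n.
    rewrite (solution_is_pol (bump (- h) a) b (im u) l Hb).
    - unfold im at 1; rewrite Hu0; simpl; ring.
    - intros k; rewrite <- im_shifted; unfold im; now rewrite E0. }
  rewrite Er in H1; split; [exact H1|].
  assert (Hs := sqs_dom _ _ _ _ (rJ_domain a b g) H1).
  rewrite Hg, norm2_eq, Er, Ei; rewrite ?Er, ?Ei; auto using sqs_zero.
  f_equal; rewrite <- (nrm_sq _ sqs_zero), nrm_zero; ring.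
Qed.

(* If no solution of the eigenvalue equation were square-summable, the
   closure of the minimal operator would be self-adjoint. *)
Lemma limit_circle_solution (a b : nat -> R) (h z : R) (g : option R) :
  (forall n, 0 < b n) -> limit_circle a b ->
  regular (bump h a) b (rJ a b g) z -> sqs (pol (bump h a) b z).
Proof.
  intros Hb Hc HR; apply NNPP; intros Hp; apply Hc.
  assert (HD := rJ_domain a b g).
  assert (Hsym := symmetric_maximal a b h z _ Hb HD HR Hp).
  intros f w; split.
  (* The closure lies in its adjoint because the maximal operator is symmetric under the present
     assumption. *)
  - intros Hf; apply closure_iff in Hf; destruct Hf as [Hf1 Hf2].
    assert (W1 := rclos_rtau _ _ _ _ Hf1); assert (W2 := rclos_rtau _ _ _ _ Hf2).
    destruct Hf1 as (A1 & A2 & _), Hf2 as (A3 & A4 & _).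
    split; [now apply l2_iff|split; [now apply l2_iff|]].
    intros u v Hu; apply closure_iff in Hu; destruct Hu as [Hu1 Hu2].
    assert (V1 := rclos_rtau _ _ _ _ Hu1); assert (V2 := rclos_rtau _ _ _ _ Hu2).
    destruct Hu1 as (B1 & B2 & _), Hu2 as (B3 & B4 & _).
    apply C_eq; rewrite ?inner_re, ?inner_im by assumption;
      rewrite V1 in *; rewrite V2 in *; rewrite W1 in *; rewrite W2 in *;
      rewrite !Hsym by assumption; reflexivity.
  - intros (Hf & Hw & Hadj); apply l2_iff in Hf, Hw.
    destruct Hf as [F1 F2], Hw as [W1 W2].
    (* Testing the adjoint relation against unit vectors shows that the adjoint acts as [tau]; then
       [rclos_maximal] puts [f] into the domain of the closure. *)
    assert (HE : forall k, rtau a b (re f) k = re w k /\ rtau a b (im f) k = im w k).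
    { intros k.
      set (e := unit_at k).
      assert (He : finsupp e) by apply finsupp_unit_at.
      assert (He' := finsupp_rtau a b e He).
      assert (Es := sqs_finsupp _ He); assert (Es' := sqs_finsupp _ He').
      assert (Hcl : closure (Jmin a b) (cplx e (fun _ => 0))
                      (cplx (rtau a b e) (fun _ => 0))).
      { apply closure_iff; split; [now apply rclos_finsupp|].
        change (im (cplx (rtau a b e) (fun _ => 0))) with (fun _ : nat => 0).
        replace (fun _ : nat => 0) with (rtau a b (fun _ => 0)) at 2.
        - apply rclos_finsupp; now exists O.
        - apply functional_extensionality; intros [|n]; unfold rtau; ring. }
      specialize (Hadj _ _ Hcl).
      assert (Hfin : forall y, sqs y -> dot (rtau a b e) y = rtau a b y k).
      { intros y Hy. rewrite <- (dot_unit_at k (rtau a b y)); fold e.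
        destruct He as [N HN].
        assert (HS : is_series (fun n => rtau a b e n * y n - e n * rtau a b y n) 0).
        { apply is_series_ext_R with
            (fun n => shifted a b 0 e n * y n - e n * shifted a b 0 y n).
          - intros n; unfold shifted; ring.
          - apply Series_zero_tail with N; intros n Hn; rewrite green, !HN by lia; ring. }
        assert (X2 : ex_series (fun n => e n * rtau a b y n)).
        { eexists; apply (is_series_finite _ N); intros n Hn; rewrite HN by lia; ring. }
        assert (X1 := ex_dot _ _ Es' Hy).
        apply is_series_unique in HS.
        rewrite (Series_ext _ (fun n => 1 * (rtau a b e n * y n)
          + (-1) * (e n * rtau a b y n))) in HS by (intros; ring).
        rewrite Series_lin in HS by assumption. unfold dot; lra. }
      assert (Z := sqs_zero).
      assert (Z0 : forall y, dot (fun _ => 0) y = 0).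
      { intros y; replace (fun _ : nat => 0) with (fun n : nat => 0 * unit_at O n)
          by (apply functional_extensionality; intros; ring).
        rewrite dot_scal_l; ring. }
      split.
      - apply (f_equal Re) in Hadj; rewrite !inner_re in Hadj by assumption.
        change (re (cplx (rtau a b e) (fun _ => 0))) with (rtau a b e) in Hadj.
        change (re (cplx e (fun _ => 0))) with e in Hadj.
        change (im (cplx (rtau a b e) (fun _ => 0))) with (fun _ : nat => 0) in Hadj.
        change (im (cplx e (fun _ => 0))) with (fun _ : nat => 0) in Hadj.
        rewrite !Z0, Hfin in Hadj by assumption.
        unfold e in Hadj; rewrite dot_unit_at in Hadj; lra.
      - apply (f_equal Im) in Hadj; rewrite !inner_im in Hadj by assumption.
        change (re (cplx (rtau a b e) (fun _ => 0))) with (rtau a b e) in Hadj.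
        change (re (cplx e (fun _ => 0))) with e in Hadj.
        change (im (cplx (rtau a b e) (fun _ => 0))) with (fun _ : nat => 0) in Hadj.
        change (im (cplx e (fun _ => 0))) with (fun _ : nat => 0) in Hadj.
        rewrite !Z0, Hfin in Hadj by assumption.
        unfold e in Hadj; rewrite dot_unit_at in Hadj; lra. }
    assert (E1 : re w = rtau a b (re f))
      by (apply functional_extensionality; intros k; symmetry; apply HE).
    assert (E2 : im w = rtau a b (im f))
      by (apply functional_extensionality; intros k; symmetry; apply HE).
    apply closure_iff; rewrite E1 in *; rewrite E2 in *.
    split; apply (rclos_maximal a b h z _ Hb HD HR Hp); assumption.
Qed.

(** * The boundary condition at infinity *)

Lemma bump_bump (a : nat -> R) (c d : R) : bump c (bump d a) = bump (d + c) a.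
Proof. apply functional_extensionality; intros [|n]; simpl; ring. Qed.

(** Green's formula in the limit, where both inner products converge. *)
Lemma wronskian_lim (a b f k : nat -> R) :
  sqs f -> sqs (rtau a b f) -> sqs k -> sqs (rtau a b k) ->
  is_lim_seq (wronskian b f k) (dot f (rtau a b k) - dot (rtau a b f) k).
Proof.
  intros Hf Hf' Hk Hk'.
  assert (HS : is_series (fun n => shifted a b 0 k n * f n - k n * shifted a b 0 f n)
    (dot f (rtau a b k) - dot (rtau a b f) k)).
  { replace (dot f (rtau a b k) - dot (rtau a b f) k)
      with (1 * dot f (rtau a b k) + (-1) * dot (rtau a b f) k) by ring.
    eapply is_series_ext_R; [|apply is_series_lin; apply Series_correct; now apply ex_dot].
    intros n; unfold shifted; simpl; ring. }
  apply is_lim_seq_ext with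
    (sum_n (fun n => shifted a b 0 k n * f n - k n * shifted a b 0 f n)); [|exact HS].
  intros n; rewrite green; unfold wronskian; ring.
Qed.

Lemma wronskian_initial_solutions (a b : nat -> R) (n : nat) :
  (forall n, 0 < b n) -> wronskian b (c0 a b) (s0 a b) n = b O.
Proof.
  intros Hb; induction n as [|n IH].
  - unfold wronskian, c0, s0; simpl; ring.
  - pose proof (zero_solution_rec a b 1 0 n (Hb (S n))) as E1.
    pose proof (zero_solution_rec a b 0 1 n (Hb (S n))) as E2.
    cbv zeta in E1, E2; fold (c0 a b) in E1; fold (s0 a b) in E2.
    rewrite <- IH; unfold wronskian.
    set (c := c0 a b) in *; set (s := s0 a b) in *.
    replace (b (S n) * (c (S n) * s (S (S n)) - s (S n) * c (S (S n))))
      with (c (S n) * (b (S n) * s (S (S n))) - s (S n) * (b (S n) * c (S (S n))))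
      by ring.
    replace (b (S n) * s (S (S n))) with (- (b n * s n + a (S n) * s (S n))) by lra.
    replace (b (S n) * c (S (S n))) with (- (b n * c n + a (S n) * c (S n))) by lra.
    ring.
Qed.

(** Beyond the first row, [pol a b z] and the resolvent at [z] applied to [unit0] are two
    square-summable solutions. Their Wronskian is nonzero, so every solution there is a combination
    of them. *)
Lemma tail_solution_sqs (a b f : nat -> R) D (z : R) :
  (forall n, 0 < b n) -> jacobi_domain a b D -> regular a b D z ->
  sqs (pol a b z) -> (forall n, (0 < n)%nat -> shifted a b z f n = 0) -> sqs f.
Proof.
  intros Hb HD HR Hp Hf.
  destruct (proj1 HR unit0 (sqs_finsupp _ finsupp_unit0)) as (k & Hk & Ek).
  set (p := pol a b z) in *.
  assert (HW : b O * (p 1%nat * k O - p O * k 1%nat) = -1).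
  { rewrite <- (green a b p k z O), sum_O, Ek.
    unfold p; rewrite pol_solution by exact Hb; simpl; ring. }
  set (w := p 1%nat * k O - p O * k 1%nat) in *.
  assert (Hw : w <> 0) by (intros e; rewrite e in HW; lra).
  set (x := (f 1%nat * k O - f O * k 1%nat) / w).
  set (y := (p 1%nat * f O - p O * f 1%nat) / w).
  replace f with (lc x p y k); [apply sqs_lc; [exact Hp|eapply sqs_dom; eauto]|].
  apply functional_extensionality; intros n.
  apply (tail_solution_unique a b (lc x p y k) f z 0 Hb); [|unfold lc, x, y..|lia].
  - intros m Hm; rewrite Hf, shifted_lc by exact Hm; unfold lc, p.
    rewrite Ek, pol_solution by exact Hb.
    destruct m as [|m]; [lia|]; simpl; ring.
  - unfold w in *; field; exact Hw.
  - unfold w in *; field; exact Hw.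
Qed.

Lemma boundary_condition_unique (a b : nat -> R) (g g' : option R) (h c : R)
    (lam nu : nat -> R) :
  model (bump h a) b (rJ a b g) c lam nu -> c <> 0 -> limit_circle a b ->
  (forall i, rJ a b g' (pol (bump h a) b (lam i))) -> g = g'.
Proof.
  intros HM Hc Hlc Hg'.
  pose proof (model_pos _ _ _ _ _ _ HM) as Hb.
  pose proof (rJ_domain a b g) as HD0.
  pose proof (model_dom _ _ _ _ _ _ HM) as HD.
  apply NNPP; intros Hgg.
  set (a1 := bump h a) in *.
  set (u := fun i => pol a1 b (lam i)).
  destruct (is_cot_exists g) as [x Hx], (is_cot_exists g') as [y Hy].
  assert (Hsin : sin (x - y) <> 0).
  { intros E; apply Hgg; apply (is_cot_fun g g' x Hx).
    rewrite (sin_diff_0 x y (proj1 Hx) (proj1 Hy) E); exact Hy. }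
  assert (Hlim : forall g0 x0, is_cot g0 x0 -> (forall i, rJ a b g0 (u i)) ->
    forall i, is_lim_seq (wronskian b (rv a b x0) (u i)) 0).
  { intros g0 x0 Hx0 Hr i; destruct (Hr i) as [[Hp _]|(_ & _ & _ & t & Ht & Hw)].
    - now destruct Hlc.
    - now rewrite (is_cot_inj g0 x0 t Hx0 Ht). }
  assert (Lx := Hlim g x Hx (model_eig _ _ _ _ _ _ HM)).
  assert (Ly := Hlim g' y Hy Hg').
  (* Cramer's rule: for different angles [x] and [y] the two boundary solutions span [c0] and [s0],
     with determinant [sin (x - y)]. *)
  assert (Lc : forall i, is_lim_seq (wronskian b (c0 a b) (u i)) 0).
  { intros i.
    eapply is_lim_seq_ext;
      [|apply (is_lim_seq_0_lin _ _ (- sin y / sin (x - y)) (sin x / sin (x - y))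
          (Lx i) (Ly i))].
    intros n; unfold wronskian, rv; simpl; rewrite sin_minus in *; field; exact Hsin. }
  assert (Ls : forall i, is_lim_seq (wronskian b (s0 a b) (u i)) 0).
  { intros i.
    eapply is_lim_seq_ext;
      [|apply (is_lim_seq_0_lin _ _ (cos y / sin (x - y)) (- cos x / sin (x - y))
          (Lx i) (Ly i))].
    intros n; unfold wronskian, rv; simpl; rewrite sin_minus in *; field; exact Hsin. }
  assert (Htail : forall v1 v2 n, (0 < n)%nat ->
    rtau a1 b (zero_solution a b v1 v2) n = 0).
  { intros v1 v2 [|n] Hn; [lia|].
    pose proof (zero_solution_rec a b v1 v2 n (Hb (S n))) as E; cbv zeta in E.
    unfold rtau, a1, bump; exact E. }
  assert (Hts : forall v1 v2, sqs (rtau a1 b (zero_solution a b v1 v2))).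
  { intros v1 v2; apply sqs_finsupp; exists 1%nat; intros n Hn; apply Htail; lia. }
  assert (Hsol : forall d, regular (bump d a) b (rJ a b g) 0 ->
    forall v1 v2, sqs (zero_solution a b v1 v2)).
  { intros d Hd v1 v2.
    apply (tail_solution_sqs (bump d a) b _ _ 0 Hb (jacobi_domain_bump _ _ _ d HD0) Hd).
    - now apply limit_circle_solution with g.
    - intros [|n] Hn; [lia|].
      pose proof (zero_solution_rec a b v1 v2 n (Hb (S n))) as E; cbv zeta in E.
      unfold shifted, rtau, bump; lra. }
  (* No boundary term at infinity survives between an eigenvector and any element of the maximal
     domain. *)
  assert (Hgreen : (forall v1 v2, sqs (zero_solution a b v1 v2)) ->
    forall i f, sqs f -> sqs (rtau a1 b f) ->
    lam i * dot (u i) f = dot (u i) (rtau a1 b f)).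
  { intros Hcs i f Hf Hf'.
    destruct (proj1 HD _ (model_eig _ _ _ _ _ _ HM i)) as [Hu Hu'].
    change (sqs (u i)) in Hu; change (sqs (rtau a1 b (u i))) in Hu'.
    pose proof (wronskian_lim a1 b (u i) f Hu Hu' Hf Hf') as L1.
    pose proof (wronskian_lim a1 b f (s0 a b) Hf Hf' (Hcs 0 1) (Hts 0 1)) as L2.
    pose proof (wronskian_lim a1 b f (c0 a b) Hf Hf' (Hcs 1 0) (Hts 1 0)) as L3.
    pose proof (is_lim_seq_mult' _ _ _ _ (Lc i) L2) as L4.
    pose proof (is_lim_seq_mult' _ _ _ _ (Ls i) L3) as L5.
    rewrite Rmult_0_l in L4, L5.
    pose proof (is_lim_seq_0_lin _ _ (-1) 1 L4 L5) as L6.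
    pose proof (is_lim_seq_scal_l _ (b O) _ L1) as L7.
    (* Pluecker identity: [W(c0,s0) W(u,f) = W(s0,u) W(f,c0) - W(c0,u) W(f,s0)], where [W(c0,s0)] is
       constantly [b O]. *)
    assert (L8 : is_lim_seq (fun n => b O * wronskian b (u i) f n) 0).
    { eapply is_lim_seq_ext; [|exact L6]. intros n.
      rewrite <- (wronskian_initial_solutions a b n Hb); unfold wronskian; simpl; ring. }
    pose proof (is_lim_seq_unique _ _ L8) as E8.
    rewrite (is_lim_seq_unique _ _ L7) in E8; simpl in E8.
    injection E8 as E8.
    apply Rmult_integral in E8; destruct E8 as [E8|E8]; [specialize (Hb O); lra|].
    replace (rtau a1 b (u i)) with (fun n => lam i * u i n) in E8.
    - rewrite dot_scal_l in E8; lra.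
    - apply functional_extensionality; intros n; symmetry; now apply pol_recurrence. }
  destruct (classic (forall i, 0 <> lam i)) as [H0|H0].
  (* The solution at energy 0 is then orthogonal to every eigenvector, hence 0, although its first
     entry is 1. *)
  - pose proof (model_reg _ _ _ _ _ _ HM 0 H0) as HR.
    pose proof (limit_circle_solution a b h 0 g Hb Hlc HR) as Hp; fold a1 in Hp.
    assert (Ez : rtau a1 b (pol a1 b 0) = fun n => 0 * pol a1 b 0 n)
      by (apply functional_extensionality; intros n; now apply pol_recurrence).
    enough (E : pol a1 b 0 O = 0) by (simpl in E; lra).
    apply (eigenbasis_complete _ _ _ _ _ _ _ HM Hp); intros i.
    assert (Hz : sqs (rtau a1 b (pol a1 b 0))).
    { rewrite Ez; apply sqs_finsupp; exists O; intros; ring. }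
    pose proof (Hgreen (Hsol h HR) i _ Hp Hz) as E.
    rewrite Ez, dot_scal_r in E; rewrite dot_comm.
    apply Rmult_eq_reg_l with (lam i); [unfold u in E; lra|].
    intros e; apply (H0 i); auto.
  (* If 0 is the eigenvalue [lam j], the solution [p] at energy 0 for the perturbed operator has
     image [- c * unit0]; pairing with the [j]-th eigenvector gives [c = 0]. *)
  - apply not_all_ex_not in H0; destruct H0 as [j Hj]; apply NNPP in Hj.
    assert (HR : regular (bump c a1) b (rJ a b g) 0).
    { apply (model_reg' _ _ _ _ _ _ HM); intros i e.
      apply (model_sep _ _ _ _ _ _ HM i j); lra. }
    unfold a1 in HR; rewrite bump_bump in HR.
    pose proof (limit_circle_solution a b _ 0 g Hb Hlc HR) as Hp.
    set (p := pol (bump (h + c) a) b 0) in *.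
    assert (Ez : rtau a1 b p = fun n => - c * unit0 n).
    { apply functional_extensionality; intros n.
      pose proof (pol_recurrence (bump (h + c) a) b 0 n Hb) as E; fold p in E.
      rewrite <- bump_bump, rtau_bump in E; unfold lc in E; fold a1 in E.
      change (p O) with 1 in E; lra. }
    assert (Hz : sqs (rtau a1 b p)).
    { rewrite Ez; apply sqs_finsupp; exists 1%nat; intros [|n] Hn; [lia|simpl; ring]. }
    pose proof (Hgreen (Hsol _ HR) j _ Hp Hz) as E.
    rewrite Ez, dot_scal_r, dot_comm, <- Hj, (dot_comm (u j)), unit0_at, dot_unit_at in E.
    change (u j O) with 1 in E; lra.
Qed.

(** * Reduction of the theorem *)

(** A bijection from the natural numbers onto [M], so that sums over [M] become ordinary series. *)
Definition enumeration (M : Z -> Prop) (e : nat -> Z) : Prop :=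
  (forall i, M (e i)) /\ (forall n, M n -> exists i, e i = n) /\
  (forall i j, e i = e j -> i = j).

Lemma indexed_shape (M : Z -> Prop) (x y : Z -> R) : indexed M x y ->
  (forall n, M n) \/ (exists k, forall n, M n <-> (n <= k)%Z) \/
  (exists k, forall n, M n <-> (k <= n)%Z).
Proof.
  intros [_ [(_ & _ & H & _)|[(_ & _ & (k & _ & H) & _)|[(_ & H)|[(_ & H)|
    (_ & _ & (k & _ & H) & _)]]]]]; eauto.
Qed.

Lemma enumeration_exists (M : Z -> Prop) (x y : Z -> R) :
  indexed M x y -> exists e, enumeration M e.
Proof.
  intros H; destruct (indexed_shape _ _ _ H) as [Hs|[[k Hs]|[k Hs]]].
  (* Even indices run through the nonnegative integers, odd ones through the negative integers. *)
  - exists (fun i => if Nat.even i then Z.of_nat (Nat.div2 i)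
                     else (- Z.of_nat (Nat.div2 i) - 1)%Z).
    split; [auto|split].
    + intros n _; destruct (Z_lt_le_dec n 0) as [L|L].
      * exists (S (2 * Z.to_nat (- n - 1))).
        rewrite Nat.even_succ, <- Nat.negb_even, Nat.even_mul.
        rewrite Nat.div2_succ_double; simpl; lia.
      * exists (2 * Z.to_nat n)%nat.
        rewrite Nat.even_mul, Nat.div2_double; simpl; lia.
    + intros i j E.
      pose proof (Nat.div2_odd i) as Oi; pose proof (Nat.div2_odd j) as Oj.
      rewrite <- Nat.negb_even in Oi, Oj.
      destruct (Nat.even i), (Nat.even j); cbn [negb Nat.b2n] in Oi, Oj; lia.
  - exists (fun i => (k - Z.of_nat i)%Z); split; [|split].
    + intros i; apply Hs; lia.
    + intros n Hn; apply Hs in Hn; exists (Z.to_nat (k - n)); lia.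
    + intros i j E; lia.
  - exists (fun i => (k + Z.of_nat i)%Z); split; [|split].
    + intros i; apply Hs; lia.
    + intros n Hn; apply Hs in Hn; exists (Z.to_nat (n - k)); lia.
    + intros i j E; lia.
Qed.

(** In each alternative [M] is an interval of integers, so the interlacing inequalities can be
    chained from [n] to [k]. *)
Lemma indexed_lt (M : Z -> Prop) (x y : Z -> R) (n k : Z) :
  indexed M x y -> M n -> M k -> (n < k)%Z -> y n < x k.
Proof.
  intros H Hn Hk Hlt.
  assert (Hcv : forall l, (n <= l <= k)%Z -> M l).
  { intros l Hl; destruct (indexed_shape _ _ _ H) as [Hs|[[q Hs]|[q Hs]]]; auto;
      apply Hs; apply Hs in Hn; apply Hs in Hk; lia. }
  destruct H as [Hi _].
  assert (HH : forall d : nat, (n + 1 + Z.of_nat d <= k)%Z ->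
    y n < x (n + 1 + Z.of_nat d)%Z).
  { intros d; induction d as [|d IH]; intros Hd.
    - rewrite Z.add_0_r in *; apply (Hi n Hn), Hcv; lia.
    - apply Rlt_trans with (1 := IH ltac:(lia)).
      replace (n + 1 + Z.of_nat (S d))%Z with (n + 1 + Z.of_nat d + 1)%Z in * by lia.
      destruct (Hi (n + 1 + Z.of_nat d)%Z) as [L1 L2]; [apply Hcv; lia|].
      apply Rlt_trans with (1 := L1), L2, Hcv; lia. }
  specialize (HH (Z.to_nat (k - n - 1)) ltac:(lia)).
  now replace (n + 1 + Z.of_nat (Z.to_nat (k - n - 1)))%Z with k in HH by lia.
Qed.

(** The two possible orders of [h1] and [h2] are merged into sign conditions on products, after
    which the enumeration convention is used no further. *)
Lemma two_spectra_order (a b : nat -> R) (g : option R) (h1 h2 : R)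
    (M : Z -> Prop) (lam nu : Z -> R) :
  h1 <> h2 -> two_spectra a b g h1 h2 M lam nu ->
  (exists e, enumeration M e) /\
  (forall k, M k -> 0 < (nu k - lam k) * (h1 - h2)) /\
  (forall n k, M n -> M k -> n <> k ->
     0 < (lam n - lam k) * (lam n - nu k) /\ nu n <> nu k).
Proof.
  intros Hh (_ & _ & H1 & H2).
  destruct (Rtotal_order h1 h2) as [L|[L|L]]; [|easy|].
  - specialize (H2 L).
    assert (Hi : forall k, M k -> nu k < lam k) by (intros k Hk; now apply H2).
    assert (Hlt : forall n k, M n -> M k -> (n < k)%Z -> lam n < nu k)
      by (intros n k Hn Hk; now apply (indexed_lt M)).
    split; [now apply enumeration_exists with nu lam|split].
    + intros k Hk; specialize (Hi k Hk); nra.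
    + intros n k Hn Hk Hnk.
      pose proof (Hi n Hn); pose proof (Hi k Hk).
      destruct (Z_lt_le_dec n k) as [S|S];
        [pose proof (Hlt n k Hn Hk S)|pose proof (Hlt k n Hk Hn ltac:(lia))];
        split; nra.
  - specialize (H1 L).
    assert (Hi : forall k, M k -> lam k < nu k) by (intros k Hk; now apply H1).
    assert (Hlt : forall n k, M n -> M k -> (n < k)%Z -> nu n < lam k)
      by (intros n k Hn Hk; now apply (indexed_lt M)).
    split; [now apply enumeration_exists with lam nu|split].
    + intros k Hk; specialize (Hi k Hk); nra.
    + intros n k Hn Hk Hnk.
      pose proof (Hi n Hn); pose proof (Hi k Hk).
      destruct (Z_lt_le_dec n k) as [S|S];
        [pose proof (Hlt n k Hn Hk S)|pose proof (Hlt k n Hk Hn ltac:(lia))];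
        split; nra.
Qed.

Lemma enumerates_regular (a b : nat -> R) (g : option R) (h z : R)
    (M : Z -> Prop) (lam : Z -> R) (e : nat -> Z) :
  enumeration M e -> enumerates M lam (spectrum (Jh a b h g)) ->
  (forall i, z <> lam (e i)) -> regular (bump (- h) a) b (rJ a b g) z.
Proof.
  intros (_ & He & _) Hs Hz; apply resolvent_iff, NNPP; intros Hn.
  apply Hs in Hn; destruct Hn as (n & Hn & E).
  destruct (He n Hn) as [i Hi]; apply (Hz i); rewrite Hi; now injection E.
Qed.

(** The operator for [h1] is taken as the unperturbed one; passing to [h2] then adds [h1 - h2] to
    its first diagonal coefficient. *)
Lemma two_spectra_model (a b : nat -> R) (g : option R) (h1 h2 : R)
    (M : Z -> Prop) (lam nu gam : Z -> R) (e : nat -> Z) :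
  (forall n, 0 < b n) -> h1 <> h2 -> enumeration M e ->
  two_spectra a b g h1 h2 M lam nu -> norming_constants a b g h1 M lam gam ->
  model (bump (- h1) a) b (rJ a b g) (h1 - h2)
    (fun i => lam (e i)) (fun i => nu (e i)).
Proof.
  intros Hb Hh He Ht Hg.
  destruct (two_spectra_order _ _ _ _ _ _ _ _ Hh Ht) as (_ & Hpos & Hord).
  destruct Ht as (Hlam & Hnu & _).
  assert (Eb : bump (h1 - h2) (bump (- h1) a) = bump (- h2) a)
    by (rewrite bump_bump; f_equal; ring).
  assert (HeM := proj1 He).
  split; rewrite ?Eb.
  - exact Hb.
  - apply jacobi_domain_bump, rJ_domain.
  - intros i; exact (proj1 (norming_constant_pol _ _ _ _ _ _ Hb (Hg _ (HeM i)))).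
  - intros z Hz; now apply enumerates_regular with M lam e.
  - intros z Hz; now apply enumerates_regular with M nu e.
  - intros i Hr; apply resolvent_iff in Hr.
    assert (Hsp : spectrum (Jh a b h2 g) (RtoC (nu (e i))))
      by (apply Hnu; now exists (e i)).
    now apply Hsp.
  - intros i j E; destruct (Z.eq_dec (e j) (e i)) as [Eij|Eij].
    + specialize (Hpos _ (HeM i)); rewrite Eij in E; rewrite E in Hpos; lra.
    + destruct (Hord _ _ (HeM j) (HeM i) Eij) as [Hp _]; rewrite E in Hp; lra.
  - intros i j E; destruct (Z.eq_dec (e i) (e j)) as [Eij|Eij].
    + now apply He.
    + destruct (Hord _ _ (HeM i) (HeM j) Eij) as [Hp _]; rewrite E in Hp; lra.
Qed.

Lemma model_mass (a b : nat -> R) D c lam nu :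
  model a b D c lam nu -> is_series (weight a b lam) 1.
Proof.
  intros H; apply is_series_ext_R with (2 := orthonormality _ _ _ _ _ _ H O O).
  intros i; simpl; ring.
Qed.

Lemma weight_nonneg (a b : nat -> R) D c lam nu i :
  model a b D c lam nu -> 0 <= weight a b lam i.
Proof. intros H; left; apply Rinv_0_lt_compat, (eig_pos _ _ _ _ _ _ H). Qed.

(* Primed names are the data of the operator written with tildes. *)
Theorem theorem3p6
  (a b a' b' : nat -> R) (g g' : option R) (h1 h2 h1' h2' : R)
  (M : Z -> Prop) (lam nu gam lam' nu' gam' : Z -> R)
  (A : Z -> Prop) (m : Z) :
  (forall n, 0 < b n) -> (forall n, 0 < b' n) ->
  discrete_spectrum (J a b g) -> discrete_spectrum (J a' b' g') ->
  h1 <> h2 -> h1' <> h2' ->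
  two_spectra a b g h1 h2 M lam nu ->
  two_spectra a' b' g' h1' h2' M lam' nu' ->
  norming_constants a b g h1 M lam gam ->
  norming_constants a' b' g' h1' M lam' gam' ->
  (forall n, A n -> M n) ->
  (forall n, M n -> lam n = lam' n) ->
  (forall n, M n -> ~ A n -> nu n = nu' n) ->
  (forall n, A n -> gam n = gam' n) ->
  M m -> ~ A m -> gam m = gam' m ->
  (h1 = h1' ->
     (forall n, a n = a' n) /\ (forall n, b n = b' n) /\ h2 = h2' /\
     (limit_circle a b -> g = g')) /\
  (h2 = h2' ->
     (forall n, a n = a' n) /\ (forall n, b n = b' n) /\ h1 = h1' /\
     (limit_circle a b -> g = g')).
Proof.
  intros Hb Hb' _ _ Hh Hh' Ht Ht' Hg Hg' HAM El En Eg Hm HmA Em.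
  destruct (two_spectra_order _ _ _ _ _ _ _ _ Hh Ht) as ([e He] & Hpos & Hord).
  destruct (two_spectra_order _ _ _ _ _ _ _ _ Hh' Ht') as (_ & Hpos' & _).
  pose proof (two_spectra_model _ _ _ _ _ _ _ _ _ _ Hb Hh He Ht Hg) as H.
  pose proof (two_spectra_model _ _ _ _ _ _ _ _ _ _ Hb' Hh' He Ht' Hg') as H'.
  destruct He as (HeM & Hes & Hei).
  replace (fun i => lam' (e i)) with (fun i => lam (e i)) in H'
    by (apply functional_extensionality; intros i; auto).
  set (l := fun i => lam (e i)) in *.
  destruct (Hes m Hm) as [i0 Hi0].
  assert (Ew : forall i, weight (bump (- h1) a) b l i = gam (e i)).
  { intros i; symmetry; exact (proj2 (norming_constant_pol _ _ _ _ _ _ Hb (Hg _ (HeM i)))). }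
  assert (Ew' : forall i, weight (bump (- h1') a') b' l i = gam' (e i)).
  { intros i; unfold weight, l; rewrite El by auto; symmetry.
    exact (proj2 (norming_constant_pol _ _ _ _ _ _ Hb' (Hg' _ (HeM i)))). }
  (* Pairs are removed exactly at the indices outside [A], where the [nu] agree; the base index [i0]
     corresponds to [m]. *)
  destruct (mixed_data_unique l (fun i => nu (e i)) (fun i => ~ A (e i)) i0
    (h1 - h2) (h1' - h2') (weight (bump (- h1) a) b l) (weight (bump (- h1') a') b' l))
    as [Ec Ewt].
  - intros n k Hnk E; apply Hnk, (model_inj _ _ _ _ _ _ H), E.
  - intros k n _ E; apply (model_sep _ _ _ _ _ _ H k n); auto.
  - intros k n _ _ Hkn; apply Hord; auto.
  - intros k n _ Hkn; apply Hord; auto.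
  - exact (model_infinity _ _ _ _ _ _ H).
  - intros k _; apply Hpos, HeM.
  - intros k Hk; unfold l; rewrite En, El by auto; apply Hpos', HeM.
  - intros n; exact (weight_nonneg _ _ _ _ _ _ n H).
  - intros n; exact (weight_nonneg _ _ _ _ _ _ n H').
  - exact (model_mass _ _ _ _ _ _ H).
  - exact (model_mass _ _ _ _ _ _ H').
  - intros k _; exact (weyl_zero _ _ _ _ _ _ k H).
  - intros k Hk; rewrite En by auto; exact (weyl_zero _ _ _ _ _ _ k H').
  - intros n Hn; rewrite Ew, Ew'; apply Eg, NNPP, Hn.
  - now rewrite Hi0.
  - now rewrite Ew, Ew', Hi0.
  (* The spectral data determine the coefficients of the perturbed operators, hence [a O] only
     together with the boundary condition at the origin. *)
  - assert (Hco : forall n, bump (- h1) a n = bump (- h1') a' n /\ b n = b' n).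
    { apply coefficients_unique with l (weight (bump (- h1) a) b l); auto.
      - exact (orthonormality _ _ _ _ _ _ H).
      - intros j k.
        apply is_series_ext_R with (2 := orthonormality _ _ _ _ _ _ H' j k).
        intros i; now rewrite Ewt. }
    assert (Hfin : h1 = h1' ->
      (forall n, a n = a' n) /\ (forall n, b n = b' n) /\ h2 = h2' /\
      (limit_circle a b -> g = g')).
    { intros E1.
      assert (Ea : forall n, a n = a' n).
      { intros [|n]; [destruct (Hco O) as [E _]|destruct (Hco (S n)) as [E _]];
          simpl in E; lra. }
      assert (Eb : forall n, b n = b' n) by (intros n; apply Hco).
      split; [exact Ea|split; [exact Eb|split; [lra|]]]; intros Hlc.
      apply functional_extensionality in Ea, Eb; subst a' b' h1'.
      (* With the coefficients identified, the two operators have the same eigenvectors, which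
         therefore satisfy both boundary conditions at infinity. *)
      apply (boundary_condition_unique _ _ _ _ _ _ _ _ H); [lra|exact Hlc|].
      exact (model_eig _ _ _ _ _ _ H'). }
    (* The differences [h1 - h2] and [h1' - h2'] agree, so this case reduces to the previous one. *)
    split; [exact Hfin|]; intros E2.
    assert (E1 : h1 = h1') by lra.
    destruct (Hfin E1) as (Ea & Eb & _ & Eg'); auto.
Qed.
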